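(* Let $\tau\in\mathbf C$, $\tau\ne2$. Suppose that $\rho\in\mathcal X_\tau$ is stabilized by $\langle H\rangle<\mathcal{MCG}\cong\mathrm{SL}(2,\mathbf Z)$, where $H$ is a parabolic element of $\mathrm{SL}(2,\mathbf Z)$. Let $[g_0]$ be the unique element of $\hat\Omega$ fixed by $H_*$. Then $$\sum_{[[g]]\in(\hat\Omega/\langle H_*\rangle)-[[g_0]]}{\mathfrak h}\big(\mathrm{tr}\,\rho[[g]]\big)=0\mod 2\pi i,$$ where ${\mathfrak h}=h$ if $\tau=-2$ and ${\mathfrak h}={\mathfrak h}_\tau$ if $\tau\neq-2$, and the sum converges absolutely, if and only if both of the following hold: (i) $\mathrm{tr}\,\rho[[g]]\notin(-2,2)$ for all $[[g]]\in(\hat\Omega/\langle H_*\rangle)-[[g_0]]$, and (ii) $|\mathrm{tr}\,\rho[[g]]|\le2$ for only finitely many classes $[[g]]\in\hat\Omega/\langle H_*\rangle$.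
   Context: $\Gamma$ is the fundamental group of the once punctured torus $\mathbb T$, a free group on two generators. $\mathcal X=\mathrm{Hom}(\Gamma,\mathrm{SL}(2,\mathbf C))/\mathrm{SL}(2,\mathbf C)$, the quotient being by conjugation; a conjugacy class of representations is denoted by a representative $\rho$. $\mathcal X_\tau\subset\mathcal X$ is the set of (classes of) $\tau$-representations, i.e. those with $\mathrm{tr}\,\rho([a,b])=\tau$ for some (hence every) pair $a,b$ of free generators of $\Gamma$, where $[a,b]=aba^{-1}b^{-1}$. Define $g\sim h$ on $\Gamma$ if $g$ is conjugate to $h$ or to $h^{-1}$. $\hat\Omega\subset\Gamma/\!\sim$ is the subset corresponding to free homotopy classes of non-trivial, non-peripheral, unoriented simple closed curves on $\mathbb T$ (equivalently, the classes of elements of $\Gamma$ that belong to some free basis of $\Gamma$). The value $\mathrm{tr}\,\rho[g]:=\mathrm{tr}\,\rho(g)$ depends only on $[g]$. $\mathcal{MCG}\cong\mathrm{SL}(2,\mathbf Z)$ is the (orientation-preserving) mapping class group of $\mathbb T$. Each $H\in\mathcal{MCG}$ induces an automorphism $H_*$ of $\Gamma$ (well defined up to inner automorphisms, and inducing the corresponding element of $\mathrm{SL}(2,\mathbf Z)$ on the abelianization $\mathbf Z^2$ of $\Gamma$), hence a well-defined action on $\Gamma/\!\sim$ and on $\hat\Omega$; $H$ acts on $\mathcal X_\tau$ by $H(\rho)(g)=\rho(H_*(g))$. ''$\rho$ is stabilized by $\langle H\rangle$'' means $H(\rho)=\rho$ in $\mathcal X_\tau$. $H$ is parabolic if its trace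 is $\pm2$ and $H\ne\pm I$; then, for some free generating pair $a,b$ of $\Gamma$, $H_*(a)=a^{\pm1}$, $H_*(b)=a^{N}b^{\pm1}$ (same sign) with $N\ne0$ an integer, and $[g_0]=[a]$. $[[g]]\in\hat\Omega/\langle H_*\rangle$ denotes the orbit of $[g]$; when $\rho$ is stabilized by $\langle H\rangle$, $\mathrm{tr}\,\rho[[g]]:=\mathrm{tr}\,\rho(g)$ is well defined. Branch conventions for $u\in\mathbf C$: $\sqrt u$ has positive real part if $u\notin(-\infty,0]$ and positive imaginary part if $u\in(-\infty,0)$; $\log u$ ($u\ne0$) has imaginary part in $(-\pi,\pi]$; $\cosh^{-1}(u)$ has real part $\ge0$ and imaginary part in $(-\pi,\pi]$, and has imaginary part in $[0,\pi]$ when its real part is $0$. Define, for $x\in\mathbf C\setminus\{0\}$, $$h(x)=\frac12\bigg(1-\sqrt{1-\frac4{x^2}}\,\bigg),$$ and, for fixed $\tau\ne\pm2$ with $\nu=\cosh^{-1}(-\tau/2)$, $${\mathfrak h}_{\tau}(x)=\log\frac{1+(e^{\nu}-1)h(x)}{1+(e^{-\nu}-1)h(x)},\qquad x\neq 0,\ \pm\sqrt{\tau+2}.$$ The statement that the sum converges absolutely to the given value includes the statement that all its terms are defined. ''$=0\mod 2\pi i$'' means that the sum is an integer multiple of $2\pi i$. *)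

(* Defs.v *)
(* MathComp / MathComp-Analysis; complex numbers are R[i] with R : realType. *)
From HB Require Import structures.
From mathcomp Require Export all_boot all_order all_algebra.
From mathcomp Require Export all_classical all_reals all_analysis.
From mathcomp Require Export complex.
From mathcomp Require Import ring lra.

Set Implicit Arguments.
Unset Strict Implicit.
Unset Printing Implicit Defensive.

Import Order.TTheory GRing.Theory Num.Theory.
Import ComplexField.

Local Open Scope classical_set_scope.
Local Open Scope ring_scope.
Local Open Scope complex_scope.

Section ComplexFunctions.
Context {R : realType}.
Implicit Types (x u z nu tau : R[i]).

Definition expc z : R[i] :=
  (expR (complex.Re z))%:C * (cos (complex.Im z) +i* sin (complex.Im z)).

Definition coshc z : R[i] := (expc z + expc (- z)) / 2.

(* [logc] (for u != 0) and [acoshc] select a value satisfying the branch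
   conventions; [logcP] and [acoshcP] show that there is one. *)
Definition logc u : R[i] :=
  xget 0 [set z | expc z = u /\ - pi < complex.Im z <= pi].

Definition acoshc u : R[i] :=
  xget 0 [set z | [/\ coshc z = u,
                      0 <= complex.Re z,
                      - pi < complex.Im z <= pi &
                      (complex.Re z = 0 -> 0 <= complex.Im z)]].

Lemma logcP u : u != 0 ->
  expc (logc u) = u /\ - pi < complex.Im (logc u) <= pi.
Proof.
move=> u0; suff: exists z, expc z = u /\ - pi < complex.Im z <= pi.
  by move=> ?; exact: (@xgetPex _ 0 [set z | expc z = u /\ _]).
case: u u0 => a b u0; set r := Num.sqrt (a ^+ 2 + b ^+ 2).
have s0 : 0 < a ^+ 2 + b ^+ 2.
  rewrite lt_neqAle addr_ge0 ?sqr_ge0// andbT eq_sym paddr_eq0 ?sqr_ge0//.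
  by rewrite !sqrf_eq0; apply: contra u0 => /andP[/eqP-> /eqP->].
have r0 : 0 < r by rewrite sqrtr_gt0.
have r2 : r ^+ 2 = a ^+ 2 + b ^+ 2 by rewrite sqr_sqrtr// ltW.
have q1 : (b / r) ^+ 2 = 1 - (a / r) ^+ 2.
  apply/eqP; rewrite eq_sym subr_eq; apply/eqP.
  by rewrite !expr_div_n -mulrDl addrC -r2 divff// sqrf_eq0 gt_eqF.
have ab1 : -1 <= a / r <= 1 by have := sqr_ge0 (b / r); rewrite q1; nra.
have sE : sin (acos (a / r)) = `|b / r| by rewrite sin_acos// -q1 sqrtr_sqr.
have nE : `|b / r| = `|b| / r by rewrite normrM normfV (gtr0_norm r0).
have [b0|b0] := leP 0 b.
  exists (ln r +i* acos (a / r)); split=> /=.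
    rewrite /expc/= lnK ?posrE// acosK ?in_itv//= sE nE (ger0_norm b0).
    by simpc; congr (_ +i* _); rewrite mulrC divfK// gt_eqF.
  rewrite acos_lepi// andbT (lt_le_trans _ (acos_ge0 ab1))//.
  by rewrite oppr_lt0 pi_gt0.
have aN : -1 < a / r.
  have : 0 < (b / r) ^+ 2.
    by rewrite exprn_even_gt0//= mulf_neq0 ?invr_neq0 ?(lt_eqF b0) ?(gt_eqF r0).
  by rewrite q1; nra.
exists (ln r +i* - acos (a / r)); split=> /=.
  rewrite /expc/= lnK ?posrE// cosN sinN acosK ?in_itv//= sE nE (ltr0_norm b0).
  rewrite mulNr opprK.
  by simpc; congr (_ +i* _); rewrite mulrC divfK// gt_eqF.
rewrite ltrN2 acos_ltpi ?aN ?(andP ab1).2//=.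
by rewrite (@le_trans _ _ 0) ?pi_ge0// oppr_le0 acos_ge0.
Qed.

Lemma expcN z : expc (- z) = (expc z)^-1.
Proof.
case: z => a b; have E : expc (- (a +i* b)) * expc (a +i* b) = 1.
  rewrite /expc /= cosN sinN expRN; simpc.
  have e0 : expR a != 0 by rewrite gt_eqF ?expR_gt0.
  have cs := cos2Dsin2 b.
  apply/eqP; rewrite eq_complex /=; apply/andP; split; apply/eqP; last by ring.
  transitivity (((expR a)^-1 * expR a) * (cos b ^+ 2 + sin b ^+ 2)); first by ring.
  by rewrite cs mulVf// mulr1.
have e0 : expc (a +i* b) != 0.
  by apply/eqP => e0; move: E; rewrite e0 mulr0 => /esym/eqP; rewrite oner_eq0.
by apply: (mulIf e0); rewrite E mulVf.
Qed.

Lemma normc_expc z : `|expc z| = (expR (complex.Re z))%:C.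
Proof.
rewrite /expc normrM !normc_def /= cos2Dsin2 sqrtr1 mulr1 expr0n/= addr0.
by rewrite sqrtr_sqr ger0_norm// expR_ge0.
Qed.

Lemma acoshcP u : [/\ coshc (acoshc u) = u, 0 <= complex.Re (acoshc u),
  - pi < complex.Im (acoshc u) <= pi &
  (complex.Re (acoshc u) = 0 -> 0 <= complex.Im (acoshc u))].
Proof.
suff: exists z, [/\ coshc z = u, 0 <= complex.Re z, - pi < complex.Im z <= pi &
                      (complex.Re z = 0 -> 0 <= complex.Im z)].
  by move=> ?; exact: (@xgetPex _ 0 [set z | [/\ coshc z = u, _, _ & _]]).
set s := sqrtc (u ^+ 2 - 1); have s2 : s ^+ 2 = u ^+ 2 - 1 by exact: sqr_sqrtc.
have p1 : (u + s) * (u - s) = 1 by rewrite mulrC -subr_sqr s2 opprB addrC subrK.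
have n0 : u + s != 0 by apply/eqP => e; move: p1; rewrite e mul0r => /esym/eqP; rewrite oner_eq0.
have [e1 i1] := logcP n0; set z := logc (u + s) in e1 i1.
have cz : coshc z = u.
  have -> : coshc z = ((u + s) + (u + s)^-1) / 2 by rewrite /coshc expcN e1.
  have -> : (u + s)^-1 = u - s by apply: (mulfI n0); rewrite mulfV// p1.
  rewrite (_ : u + s + (u - s) = u * 2); last by ring.
  by rewrite mulfK// pnatr_eq0.
have czN : coshc (- z) = u by rewrite /coshc opprK addrC.
have [m im] := andP i1.
have [r0|r0|r0] := ltgtP 0 (complex.Re z).
- by exists z; split=> //; [exact: ltW | move=> e; rewrite e ltxx in r0].
- have [ip|ip] := eqVneq (complex.Im z) pi.
    exists (- (z) + ((2 * pi) *i)).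
    have E : expc (- z + (2 * pi) *i) = expc (- z).
      rewrite /expc; case: (z) => a b /=; rewrite addr0 !mulr_natl.
      by rewrite (@cosD _ (- b)) (@sinD _ (- b)) cos2pi sin2pi !mulr1 !mulr0 subr0 addr0.
    have E' : expc (- (- z + (2 * pi) *i)) = expc z.
      by rewrite expcN E expcN invrK.
    split; first by rewrite /coshc E E' addrC.
    + by case: (z) r0 => a b /= r0; rewrite addr0 oppr_ge0 ltW.
    + case: (z) ip => a b /= ->; have := @pi_gt0 R; move=> p0.
      by apply/andP; split; lra.
    + case: (z) r0 => a b /= r0; rewrite addr0 => /eqP; rewrite oppr_eq0 => /eqP a0.
      by rewrite a0 ltxx in r0.
  exists (- z); split=> //; case: (z) r0 m im ip => a b /= r0 m im ip.
  + by rewrite oppr_ge0 ltW.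
  + by rewrite ltrN2 lt_neqAle ip im/= lerNl ltW.
  + by move/eqP; rewrite oppr_eq0 => /eqP a0; rewrite a0 ltxx in r0.
- have [i0|i0] := leP 0 (complex.Im z); first by exists z; split; rewrite -?r0.
  exists (- z); split=> //; case: (z) r0 m im i0 => a b /= r0 m im i0.
  + by rewrite -r0 oppr0.
  + by rewrite (@lt_trans _ _ 0) ?oppr_lt0 ?pi_gt0 ?oppr_gt0//= lerNl ltW.
  + by rewrite oppr_ge0 ltW.
Qed.

Lemma sqrtc_branch u :
  (~~ (u <= 0) -> 0 < complex.Re (sqrtc u)) /\
  (u < 0 -> 0 < complex.Im (sqrtc u)).
Proof.
case: u => a b; rewrite lecE ltcE /= [0 == b]eq_sym; split=> [|/andP[/eqP -> a0]].
  rewrite negb_and -ltNge => h; rewrite sqrtr_gt0 divr_gt0 ?ltr0n//.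
  rewrite -ltrBlDr sub0r; have [a0|a0] := ltP 0 a.
    by rewrite (@lt_le_trans _ _ 0) ?sqrtr_ge0// oppr_lt0.
  rewrite -[ltLHS]ger0_norm ?oppr_ge0// normrN -sqrtr_sqr ltr_sqrt; last first.
    by rewrite ltr_wpDl ?sqr_ge0// exprn_even_gt0//=; move: h; rewrite ltNge a0 orbF.
  by rewrite ltrDl exprn_even_gt0//=; move: h; rewrite ltNge a0 orbF.
rewrite eqxx mul1r sqrtr_gt0 divr_gt0 ?ltr0n// subr_gt0.
by rewrite (lt_le_trans a0) ?sqrtr_ge0.
Qed.
(* [sqrtc] has the required branch, by [sqr_sqrtc] and [sqrtc_branch]. *)
Definition hfun x : R[i] := 2^-1 * (1 - sqrtc (1 - 4 / x ^+ 2)).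

Definition hfun_tau tau x : R[i] :=
  let nu := acoshc (- tau / 2) in
  logc ((1 + (expc nu - 1) * hfun x) / (1 + (expc (- nu) - 1) * hfun x)).

Definition hfrak tau x : R[i] :=
  if tau == -2 then hfun x else hfun_tau tau x.

Definition hfrak_defined tau x : Prop :=
  x <> 0 /\
  (tau <> -2 -> x <> sqrtc (tau + 2) /\ x <> - sqrtc (tau + 2)).

Definition in_open_m2_2 z : Prop := exists2 r : R, -2 < r < 2 & z = r%:C.

End ComplexFunctions.

Section UnorderedSums.
Context {R : realType} {I : choiceType}.

Definition abs_summable (D : set I) (f : I -> R[i]) : Prop :=
  (\esum_(i in D) (Normc.normc (f i))%:E < +oo)%E.

(* s is the limit of the sums of f over the finite subsets of D, directed by
   inclusion. *)
Definition has_sum (D : set I) (f : I -> R[i]) (s : R[i]) : Prop :=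
  forall e : R, 0 < e ->
  exists A0 : set I, [/\ finite_set A0, A0 `<=` D &
    forall A : set I, finite_set A -> A0 `<=` A -> A `<=` D ->
      Normc.normc (\sum_(i \in A) f i - s) < e].

End UnorderedSums.

Section FreeGroup.
Variable Gam : groupType.
Implicit Types (a b g : Gam) (c d : set Gam).

Definition free_basis a b : Prop :=
  forall (G : groupType) (x y : G),
  exists f : {multiplicative Gam -> G},
    [/\ f a = x, f b = y &
        forall f' : {multiplicative Gam -> G},
          f' a = x -> f' b = y -> f' =1 f].

Definition primitive g : Prop := exists a b, free_basis a b /\ (g = a \/ g = b).

(* the class of g for the relation "conjugate to g or to its inverse" *)
Definition cls g : set Gam :=
  [set k | exists l : Gam, k = (l * g * l^-1)%g \/ k = (l * g^-1 * l^-1)%g].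

Definition Omega_hat : set (set Gam) := [set cls g | g in primitive].

(* the orbit of the class c under the group generated by the bijection F *)
Definition orbit (F : Gam -> Gam) c : set (set Gam) :=
  [set d | exists n : nat,
     d = iter n (fun e => F @` e) c \/ c = iter n (fun e => F @` e) d].

Definition Omega_hat_mod (F : Gam -> Gam) : set (set (set Gam)) :=
  [set orbit F c | c in Omega_hat].

(* ab is the abelianization Gam -> Z^2 that sends the free basis (a, b) to the
   standard basis of Z^2. *)
Definition abelianization a b (ab : Gam -> 'cV[int]_2) : Prop :=
  [/\ (forall g k, ab (g * k)%g = ab g + ab k),
      ab a = delta_mx 0 0 & ab b = delta_mx 1 0].

Section Representations.
Variable R : realType.
Implicit Types (rho : Gam -> 'M[R[i]]_2) (tau : R[i]).

Definition SL2_rep rho : Prop :=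
  (forall g, \det (rho g) = 1) /\
  (forall g k, rho (g * k)%g = rho g *m rho k).

Definition conj_rep rho1 rho2 : Prop :=
  exists P : 'M[R[i]]_2,
    \det P = 1 /\ forall g, rho1 g = P *m rho2 g *m invmx P.

Definition tau_rep rho tau : Prop :=
  exists a b, free_basis a b /\ \tr (rho (a * b * a^-1 * b^-1)%g) = tau.

(* the common value of the traces on an orbit of classes; it is well defined
   when the class of rho is stabilized *)
Definition tr_orbit rho (O : set (set Gam)) : R[i] :=
  xget 0 [set t | exists2 c, O c & exists2 g, c g & t = \tr (rho g)].

End Representations.
End FreeGroup.

Definition parabolic (M : 'M[int]_2) : Prop :=
  (\tr M = 2 \/ \tr M = -2) /\ M <> 1%:M /\ M <> - 1%:M.

(* Main.v *)
(* The classes of primitive elements are the regions complementary to the Farey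
   tree. A parabolic H fixes the region of g0 and shifts the regions around it,
   so modulo H there remain a finite fan of regions together with the binary
   trees behind its edges.

   Let x, y be the traces of the two regions along an edge and z the trace of
   the region behind it, and put psi = z / (x y), c = e^nu - 1, mu = tau + 2. If
   tau = -2 then psi is additive at the vertices of the tree; otherwise
   1 + c psi is multiplicative up to the factor 1 - mu / w^2 of the region w in
   front of the edge. Together with an exact formula relating psi to h(x) and
   h(y) this expresses the sum over a tree, cut at depth m, by its value on the
   boundary edge and an error at depth m; the boundary values telescope to zero
   (to one, for the product) along the periodic fan.

   Under (i) and (ii) the errors vanish and the sum converges absolutely: an
   edge where this fails starts an infinite path of such edges. A path around a
   single region is excluded by the linear growth of the traces of its
   neighbours. On any other path the traces either grow, up to a size beyond
   which growth is exponential, or decrease forever, which forces the Markoff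
   parameter mu to be 4, i.e. tau = 2.

   Conversely, the summand is bounded below on bounded sets, so summability
   leaves only finitely many traces in each disc, while infinitely many traces
   stay bounded around a region with trace in (-2, 2). *)
Require Import Defs.
From HB Require Import structures.
From mathcomp Require Import ring lra zify.
Set Implicit Arguments.
Unset Strict Implicit.
Unset Printing Implicit Defensive.
Import Order.TTheory GRing.Theory Num.Theory.
Import ComplexField.
Local Open Scope classical_set_scope.
Local Open Scope ring_scope.
Local Open Scope complex_scope.

(** A free basis is given by its universal property alone, so everything about primitive elements
    has to be extracted from homomorphisms out of the group: one into the subgroup spanned by the
    basis shows that the basis generates, one into SL(2,Z) that nonempty reduced words are
    nontrivial. Nielsen's theorem then lists the primitive classes along the Farey tree and the
    abelianization tells them apart. As a primitive class is determined by its slope, the action of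
    H on the regions is read off the matrix H; no image under [Hstar] has to be computed as a word.

    The summand is undefined at a nonzero trace w with w^2 = mu, and neither (i) nor (ii) mentions
    such a trace. It is excluded because the traces around its region would decay to 0 in one of the
    two directions, against (ii).

    For tau different from -2 the value is found after exponentiating, where the logarithms become
    factors of a product; this is why it is known only modulo 2 pi i. *)

Section TraceTree.
Variable K : comPzRingType.
Implicit Types (e : K * K * K) (s : seq bool).

(* A state (x, y, z) is an edge of the tree of Markoff triples: x and y are the
   traces of the two regions along the edge, z the one behind it. *)
Definition tnew e : K := e.1.1 * e.1.2 - e.2.
Definition tstep (d : bool) e : K * K * K :=
  if d then (e.1.1, tnew e, e.1.2) else (tnew e, e.1.2, e.1.1).
Definition tnode e s := foldl (fun e d => tstep d e) e s.
Definition tkappa e : K :=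
  e.1.1 ^+ 2 + e.1.2 ^+ 2 + e.2 ^+ 2 - e.1.1 * e.1.2 * e.2.

Lemma tkappa_step d e : tkappa (tstep d e) = tkappa e.
Proof. by case: e => [[x y] z]; case: d; rewrite /tkappa /tstep /tnew /=; ring. Qed.

Lemma tkappa_node e s : tkappa (tnode e s) = tkappa e.
Proof. by elim: s e => [//|d s IH] e; rewrite /= IH tkappa_step. Qed.

End TraceTree.

(** * Free groups of rank two *)

(** The first component selects the generator ([true] for the first one), the second its sign
    ([true] for the generator itself, [false] for its inverse). *)
Notation letter := (bool * bool)%type.
Definition linv (l : letter) : letter := (l.1, ~~ l.2).
Definition winv (w : seq letter) := rev (map linv w).
Definition reduced := sorted (fun l l' : letter => l' != linv l).
Definition cons_reduce (l : letter) (w : seq letter) : seq letter :=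
  if w is l' :: w' then (if l' == linv l then w' else l :: w) else [:: l].

Lemma linvK : involutive linv. Proof. by case=> c []. Qed.

Lemma linv_neq l : linv l != l. Proof. by case: l => [[] []]. Qed.

Lemma winvK : involutive winv.
Proof. by move=> w; rewrite /winv map_rev revK -map_comp map_id_in// => l _; exact: linvK. Qed.

Lemma size_winv w : size (winv w) = size w.
Proof. by rewrite size_rev size_map. Qed.

Lemma winv_cat w w' : winv (w ++ w') = winv w' ++ winv w.
Proof. by rewrite /winv map_cat rev_cat. Qed.

Lemma reduced_winv w : reduced (winv w) = reduced w.
Proof.
rewrite /reduced /winv rev_sorted sorted_map; apply: eq_sorted => l l' /=.
by rewrite linvK eq_sym.
Qed.

Lemma cons_reduceP l w : reduced w -> reduced (cons_reduce l w).
Proof.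
case: w => [//|l' w] rw /=; case: eqP => [_|/eqP ne] /=; first exact: path_sorted rw.
by rewrite ne.
Qed.

Section WordValues.
Variable G : groupType.
Implicit Types (x y : G) (w : seq letter).
Local Open Scope group_scope.

Definition lval x y (l : letter) : G :=
  let g := if l.1 then x else y in if l.2 then g else g^-1.
Definition wval x y w : G := foldr (fun l g => lval x y l * g) 1 w.

Lemma lval_inv x y l : lval x y (linv l) = (lval x y l)^-1.
Proof. by case: l => [c []]; rewrite /lval /= ?invgK. Qed.

Lemma wval_cons x y l w : wval x y (l :: w) = lval x y l * wval x y w.
Proof. by []. Qed.

Lemma wval_cat x y w w' : wval x y (w ++ w') = wval x y w * wval x y w'.
Proof. by elim: w => [|l w IH] /=; rewrite ?mul1g// IH mulgA. Qed.

Lemma wval_winv x y w : wval x y (winv w) = (wval x y w)^-1.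
Proof.
elim: w => [|l w IH]; first by rewrite invg1.
rewrite /winv /= rev_cons -cats1 wval_cat -/(winv w) IH invgM /=.
by rewrite mulg1 lval_inv.
Qed.

Lemma wval_cons_reduce x y l w : wval x y (cons_reduce l w) = wval x y (l :: w).
Proof.
by case: w => [//|l' w] /=; case: eqP => [->|//]; rewrite lval_inv mulgA mulgV mul1g.
Qed.

Lemma wval_foldr_reduce x y w : wval x y (foldr cons_reduce [::] w) = wval x y w.
Proof. by elim: w => [//|l w IH]; rewrite [LHS]wval_cons_reduce /= -/(wval _ _ _) IH. Qed.

Lemma reduced_foldr w : reduced (foldr cons_reduce [::] w).
Proof. by elim: w => [//|l w IH]; exact: cons_reduceP. Qed.

Lemma wval_subst x y w s t : wval (wval x y s) (wval x y t) w =
  wval x y (flatten [seq (let u := if l.1 then s else t in if l.2 then u else winv u) | l <- w]).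
Proof.
elim: w => [//|l w IH] /=; rewrite wval_cat -IH; congr (_ * _).
by case: l => [[] []]; rewrite /lval //= wval_winv.
Qed.

End WordValues.

Lemma multiplicative1 (G G' : groupType) (f : {multiplicative G -> G'}) :
  f 1%g = 1%g.
Proof. by apply: (mulgI (f 1%g)); rewrite -gmulfM !mulg1. Qed.

Lemma multiplicativeV (G G' : groupType) (f : {multiplicative G -> G'}) :
  {morph f : x / x^-1%g}.
Proof.
move=> x; apply: (mulgI (f x)).
by rewrite -gmulfM !mulgV multiplicative1.
Qed.

Lemma wval_morph (G G' : groupType) (f : {multiplicative G -> G'}) x y w :
  f (wval x y w) = wval (f x) (f y) w.
Proof.
elim: w => [|l w IH] /=; first exact: multiplicative1.
by rewrite gmulfM IH; congr (_ * _)%g; case: l => [[] []]; rewrite /lval ?multiplicativeV.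
Qed.

Section Generation.
Variables (G : groupType) (a b : G).

Definition in_span : {pred G} := fun g => `[< exists w, g = wval a b w >].

Lemma in_span_closed : group_closed in_span.
Proof.
split; first by apply/asboolP; exists [::].
move=> _ _ /asboolP[w ->] /asboolP[w' ->]; apply/asboolP.
by exists (w ++ winv w'); rewrite wval_cat wval_winv.
Qed.

End Generation.

Record span_type (G : groupType) (a b : G) :=
  SpanType { span_val :> G; _ : span_val \in in_span a b }.
HB.instance Definition _ (G : groupType) (a b : G) :=
  [isSub of span_type a b for @span_val G a b].
HB.instance Definition _ (G : groupType) (a b : G) :=
  [Choice of span_type a b by <:].
HB.instance Definition _ (G : groupType) (a b : G) :=
  SubChoice_isSubGroup.Build G (in_span a b) (span_type a b) (in_span_closed a b).

(** The universal property gives a homomorphism into the subgroup of values of words; followed by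
    the inclusion it fixes a and b, so by uniqueness it is the identity. *)
Lemma free_basis_span (Gam : groupType) (a b : Gam) :
  free_basis a b -> forall g, exists w, g = wval a b w.
Proof.
move=> hab g; pose S := span_type a b.
have ha : a \in in_span a b.
  by apply/asboolP; exists [:: (true, true)]; rewrite /= mulg1.
have hb : b \in in_span a b.
  by apply/asboolP; exists [:: (false, true)]; rewrite /= mulg1.
have [f [fa fb _]] := hab S (SpanType ha) (SpanType hb).
have [i [ia ib iU]] := hab Gam a b.
pose vf : {multiplicative Gam -> Gam} := (val : {multiplicative S -> Gam}) \o f.
have := iU vf; rewrite /vf /= fa fb => /(_ erefl erefl g) Eg.
have := iU idfun erefl erefl g; rewrite -Eg /= => ->.
exact: asboolW (valP (f g)).
Qed.

(** A concrete target for the universal property, in which reduced words can be seen to act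
    nontrivially. *)
Record sl2z := SL2Z { sl2z_val :> 'M[int]_2; sl2z_det : \det sl2z_val == 1 }.
HB.instance Definition _ := [isSub of sl2z for sl2z_val].
HB.instance Definition _ := [Choice of sl2z by <:].

Section SL2ZGroup.
Implicit Types g h : sl2z.

Let sl2z_one : sl2z := SL2Z (introT eqP (det1 _ 2)).

Let sl2z_mul_proof g h : \det (g *m h) == 1.
Proof. by rewrite det_mulmx (eqP (sl2z_det g)) (eqP (sl2z_det h)) mulr1. Qed.
Let sl2z_mul g h : sl2z := SL2Z (sl2z_mul_proof g h).

Let sl2z_inv_proof g : \det (invmx g) == 1.
Proof. by rewrite det_inv (eqP (sl2z_det g)) invr1. Qed.
Let sl2z_inv g : sl2z := SL2Z (sl2z_inv_proof g).

Lemma sl2z_unit g : sl2z_val g \in unitmx.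
Proof. by rewrite unitmxE (eqP (sl2z_det g)) unitr1. Qed.

Let sl2z_mulA : associative sl2z_mul.
Proof. by move=> x y z; apply: val_inj; rewrite /= mulmxA. Qed.
Let sl2z_mul1 : left_id sl2z_one sl2z_mul.
Proof. by move=> x; apply: val_inj; rewrite /= mul1mx. Qed.
Let sl2z_1mul : right_id sl2z_one sl2z_mul.
Proof. by move=> x; apply: val_inj; rewrite /= mulmx1. Qed.
Let sl2z_mulV : left_inverse sl2z_one sl2z_inv sl2z_mul.
Proof. by move=> x; apply: val_inj; rewrite /= mulVmx ?sl2z_unit. Qed.
Let sl2z_Vmul : right_inverse sl2z_one sl2z_inv sl2z_mul.
Proof. by move=> x; apply: val_inj; rewrite /= mulmxV ?sl2z_unit. Qed.

HB.instance Definition _ :=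
  isGroup.Build sl2z sl2z_mulA sl2z_mul1 sl2z_1mul sl2z_mulV sl2z_Vmul.

Lemma sl2z_mulE (g h : sl2z) : (g * h)%g = g *m h :> 'M[int]_2.
Proof. by []. Qed.

Lemma sl2z_invE (g : sl2z) : (g^-1)%g = invmx g :> 'M[int]_2.
Proof. by []. Qed.

End SL2ZGroup.

(** * Ping-pong: nonempty reduced words are nontrivial *)

Section PingPong.

Definition mat2 (p q r s : int) : 'M[int]_2 :=
  \matrix_(i, j) (if i == 0 then if j == 0 then p else q
                  else if j == 0 then r else s).

Lemma det_mat2 p q r s : \det (mat2 p q r s) = p * s - q * r.
Proof.
rewrite (expand_det_row _ 0) big_ord_recl big_ord1 /cofactor !det_mx11 !mxE /=.
by rewrite expr0 expr1; lia.
Qed.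

Definition vec2 (p q : int) : 'cV[int]_2 := \col_i (if i == 0 then p else q).

Lemma mat2_vec2 p q r s x y :
  mat2 p q r s *m vec2 x y = vec2 (p * x + q * y) (r * x + s * y).
Proof.
apply/matrixP => i j; rewrite !mxE big_ord_recl big_ord1 !mxE /=.
by case: eqP.
Qed.

Lemma det_ppA : \det (mat2 1 3 0 1) == 1. Proof. by rewrite det_mat2. Qed.
Lemma det_ppB : \det (mat2 1 0 3 1) == 1. Proof. by rewrite det_mat2. Qed.

(* Ping-pong: with 3 rather than 2 off the diagonal the vector (1, 1) lies in
   none of the four regions. *)
Definition pp_act (l : letter) (x : int * int) : int * int :=
  let s : int := if l.2 then 3 else -3 in
  if l.1 then (x.1 + s * x.2, x.2) else (x.1, x.2 + s * x.1).

(** For the first matrix: 0 < |x.2| < |x.1| with x.1 * x.2 of the sign of the letter, written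
    without absolute values; for the second matrix the two coordinates are exchanged. *)
Definition pp_region (l : letter) (x : int * int) : bool :=
  let s : int := if l.2 then 1 else -1 in
  if l.1 then x.2 * x.2 < s * x.1 * x.2 else x.1 * x.1 < s * x.1 * x.2.

Lemma pp_actP l x : lval (SL2Z det_ppA) (SL2Z det_ppB) l *m vec2 x.1 x.2 =
  vec2 (pp_act l x).1 (pp_act l x).2.
Proof.
case: l => [c []].
  by case: c; rewrite /lval /pp_act /= mat2_vec2; congr vec2; lia.
rewrite -[(c, false)]/(linv (c, true)) lval_inv sl2z_invE.
set g := lval _ _ _; apply: (can_inj (mulKmx (sl2z_unit g))).
rewrite mulKVmx ?sl2z_unit// /g /pp_act.
by case: c {g}; rewrite /lval /= mat2_vec2; congr vec2; lia.
Qed.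

Lemma pp_step l l' x : l' != linv l -> pp_region l' x -> pp_region l (pp_act l x).
Proof.
case: x => p q; case: l => [[] []]; case: l' => [[] []] //= _;
  rewrite /pp_region /pp_act /=; nia.
Qed.

(** The image of a nonempty word moves (1, 1) into the region of its first letter, and (1, 1) is in
    no region. *)
Lemma reduced_wval_neq1 (Gam : groupType) (a b : Gam) w :
  free_basis a b -> reduced w -> wval a b w = 1%g -> w = [::].
Proof.
move=> hab rw w1; case: w => [//|l w] in rw w1 *; exfalso.
have [f [fa fb _]] := hab sl2z (SL2Z det_ppA) (SL2Z det_ppB).
move: (congr1 f w1); rewrite wval_morph multiplicative1 fa fb.
set v := wval _ _ => v1.
have vE u : v u *m vec2 1 1 = vec2 (foldr pp_act (1, 1) u).1 (foldr pp_act (1, 1) u).2.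
  elim: u => [|k u IH]; first by rewrite mul1mx.
  by rewrite /v wval_cons sl2z_mulE -mulmxA IH pp_actP.
have vP : forall k u, reduced (k :: u) -> pp_region k (foldr pp_act (1, 1) (k :: u)).
  move=> k u; elim: u k => [|k' u IH] k.
    by case: k => [[] []].
  by rewrite /reduced /= => /andP[kk' /IH]; exact: pp_step.
have := vP _ _ rw; have := vE (l :: w).
rewrite v1 mul1mx; case: (foldr _ _ _) => p q /= /matrixP E.
by move: (E 0 0) (E 1 0); rewrite !mxE /= => <- <-; case: l {rw v1 E w1} => [[] []].
Qed.

End PingPong.

(** * Cancellation between reduced words *)

Lemma reduced_catE p x y q : reduced (rcons p x ++ y :: q) =
  [&& reduced (rcons p x), y != linv x & reduced (y :: q)].
Proof. by case: p => [|z p]; rewrite /reduced /= ?cat_path ?last_rcons /=. Qed.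

Lemma reduced_catl p q : reduced (p ++ q) -> reduced p.
Proof. by case: p => //= x p; rewrite /reduced /= cat_path => /andP[]. Qed.

Lemma reduced_catr p q : reduced (p ++ q) -> reduced q.
Proof. by elim: p => [//|x p IH] /path_sorted. Qed.

Lemma reduced_cat3 p m q :
  m <> [::] -> reduced (p ++ m) -> reduced (m ++ q) -> reduced (p ++ m ++ q).
Proof.
case: m => // x m _; case/lastP: p => [//|p y]; rewrite cat_cons !reduced_catE.
by move=> /and3P[-> -> _].
Qed.

(** The middle letter of such a word would be its own inverse, or, in even length, its two middle
    letters would cancel. *)
Lemma winv_fixed s : reduced s -> winv s = s -> s = [::].
Proof.
move=> rs sE; apply: size0nil; apply: contrapT => /eqP; rewrite -lt0n => s0.
have nE i : (i < size s)%N ->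
    nth (true, true) s i = linv (nth (true, true) s (size s - i.+1)).
  move=> si; rewrite -[in LHS]sE /winv nth_rev ?size_map//.
  by rewrite (nth_map (true, true))// subnSK// leq_subr.
have [m E] : exists m, size s = (m + m).+1 \/ size s = (m + m).+2.
  exists (size s).-1./2; have := odd_double_half (size s).-1.
  by rewrite -addnn; case: odd => ?; [right|left]; lia.
case: E => E.
  have := linv_neq (nth (true, true) s m).
  have /eqP := nE m ltac:(lia); have -> : (size s - m.+1)%N = m by lia.
  by rewrite eq_sym => ->.
have /(sortedP (true, true))/(_ m) := rs; rewrite E => /(_ ltac:(lia)).
rewrite (nE m.+1) ?E; last by lia.
by have -> : ((m + m).+2 - m.+2)%N = m by [lia]; rewrite eqxx.
Qed.

Lemma cancellation x y : reduced x -> reduced y ->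
  exists p q r, [/\ x = p ++ r, y = winv r ++ q & reduced (p ++ q)].
Proof.
elim: y x => [|l y IH] x rx ry.
  by exists x, [::], [::]; rewrite !cats0.
case/lastP: x rx => [|x l'] rx; first by exists [::], (l :: y), [::].
have [E|ne] := eqVneq l (linv l'); last first.
  by exists (rcons x l'), (l :: y), [::]; rewrite cats0 reduced_catE rx ne.
have [||p [q [r [-> -> pq]]]] := IH x.
- by move: rx; rewrite -cats1; exact: reduced_catl.
- exact: path_sorted ry.
exists p, q, (rcons r l'); split=> //; first by rewrite -rcons_cat.
by rewrite E /winv map_rcons rev_rcons.
Qed.

(** * Normal forms and Nielsen-reduced pairs *)

Section NormalForm.
Variables (Gam : groupType) (a b : Gam).
Hypothesis hab : free_basis a b.
Local Open Scope group_scope.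
Implicit Types (g h u v : Gam) (w p q r s : seq letter).
Local Notation val_ w := (wval a b w).

Lemma wval_inj w w' : reduced w -> reduced w' -> val_ w = val_ w' -> w = w'.
Proof.
elim: w w' => [|l w IH] [|l' w'] rw rw' E //.
- by rewrite (reduced_wval_neq1 hab rw').
- by rewrite (reduced_wval_neq1 hab rw).
have [ll'|ne] := eqVneq l' l.
  move: E; rewrite ll' !wval_cons => /mulgI E; congr (_ :: _).
  by apply: IH => //; [exact: path_sorted rw|exact: path_sorted rw'].
suff /(reduced_wval_neq1 hab) : reduced (winv (l :: w) ++ l' :: w').
  rewrite wval_cat wval_winv E mulVg => /(_ erefl).
  by case: (winv _).
have Ew : winv (l :: w) = rcons (winv w) (linv l) by rewrite /winv /= rev_cons.
by rewrite Ew reduced_catE linvK ne rw' -Ew reduced_winv rw.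
Qed.

Definition nf g : seq letter := xget [::] [set w | reduced w /\ val_ w = g].

Lemma nfP g : reduced (nf g) /\ val_ (nf g) = g.
Proof.
have [w ->] := free_basis_span hab g.
apply: (@xgetPex _ _ [set w0 | reduced w0 /\ val_ w0 = val_ w]).
by exists (foldr cons_reduce [::] w); rewrite /= reduced_foldr wval_foldr_reduce.
Qed.

Lemma nf_red g : reduced (nf g). Proof. by have [] := nfP g. Qed.
Lemma nfK g : val_ (nf g) = g. Proof. by have [] := nfP g. Qed.
Lemma nf_wval w : reduced w -> nf (val_ w) = w.
Proof. by move=> rw; apply: wval_inj; rewrite ?nf_red ?nfK. Qed.

Definition len g := size (nf g).

Lemma nfV g : nf g^-1 = winv (nf g).
Proof. by rewrite -[in LHS](nfK g) -wval_winv nf_wval// reduced_winv nf_red. Qed.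

Lemma lenV g : len g^-1 = len g. Proof. by rewrite /len nfV size_winv. Qed.

Lemma nf1 : nf 1 = [::]. Proof. by rewrite -[1]/(val_ [::]) nf_wval. Qed.

Lemma nf_eq0 g : nf g = [::] -> g = 1.
Proof. by move=> E; rewrite -(nfK g) E. Qed.

Lemma len_wval w : (len (val_ w) <= size w)%N.
Proof.
rewrite /len -(wval_foldr_reduce a b w) nf_wval ?reduced_foldr//.
elim: w => [//|l w] /= IH; case: (foldr _ _ _) IH => [//|l' w'] /= IH.
by case: eqP => _ /=; [exact: leq_trans (ltnW _) (leqnSn _)|].
Qed.

Lemma nfM g h : exists p q r,
  [/\ nf g = p ++ r, nf h = winv r ++ q & nf (g * h) = p ++ q].
Proof.
have [p [q [r [E1 E2 pq]]]] := cancellation (nf_red g) (nf_red h).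
exists p, q, r; split=> //.
have gE : g = val_ p * val_ r by rewrite -wval_cat -E1 nfK.
have hE : h = (val_ r)^-1 * val_ q by rewrite -wval_winv -wval_cat -E2 nfK.
by rewrite gE hE mulgA mulgK -wval_cat nf_wval.
Qed.

(** If half of [g] or more cancelled in g * g, then r = s ++ q with s its own inverse; so s is empty
    and g = p p^-1 = 1. *)
Lemma square_cancellation g p q r : g <> 1 -> nf g = p ++ r ->
  nf g = winv r ++ q -> (size r < size p)%N.
Proof.
move=> g1 E1 E2; rewrite ltnNge; apply/negP => pr; apply: g1.
have sE : size q = size p.
  by have := congr1 size E1; rewrite E2 !size_cat size_winv addnC => /addIn.
have rE : winv r = p ++ drop (size p) (winv r).
  rewrite -[LHS](cat_take_drop (size p)); congr (_ ++ _).
  have := congr1 (take (size p)) E1; rewrite E2 [in RHS]take_size_cat//.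
  by rewrite takel_cat ?size_winv//.
set s := drop _ _ in rE.
have rE' : r = s ++ q.
  have := congr1 (drop (size p)) E2; rewrite E1 [in LHS]drop_size_cat// rE -catA.
  by rewrite drop_size_cat.
have rE2 : r = winv s ++ winv p by rewrite -winv_cat -rE winvK.
have ss : winv s = s.
  have := congr1 (take (size s)) rE'; rewrite {1}rE2 !take_size_cat//.
  by rewrite size_winv.
have s0 : s = [::].
  apply: winv_fixed ss; have := nf_red g; rewrite E1 rE' => /reduced_catr.
  exact: reduced_catl.
have qE : q = winv p by move: rE2; rewrite rE' s0.
have rp : r = winv p by rewrite rE' s0.
by rewrite -(nfK g) E1 rp wval_cat wval_winv mulgV.
Qed.

(** Conjugation is a move of its own. It shortens the pairs that the elementary moves cannot
    shorten, and so replaces the well-ordering of words in the usual proof of Nielsen's theorem; the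
    classes of the two elements do not see it. *)
Inductive nielsen : Gam -> Gam -> Prop :=
| nielsen_base : nielsen a b
| nielsen_inv u v of nielsen u v : nielsen u^-1 v
| nielsen_swap u v of nielsen u v : nielsen v u
| nielsen_mul u v of nielsen u v : nielsen (u * v) v
| nielsen_conj u v g of nielsen u v : nielsen (g * u * g^-1) (g * v * g^-1).

Lemma nielsen_invr u v : nielsen u v -> nielsen u v^-1.
Proof. by move=> /nielsen_swap/nielsen_inv/nielsen_swap. Qed.

Lemma nielsen_lval u v (e e' : bool) : nielsen (lval u u (true, e)) (lval v v (true, e')) ->
  nielsen u v.
Proof.
case: e; case: e'; rewrite /lval //= => n.
- by rewrite -(invgK v); exact: nielsen_invr.
- by rewrite -(invgK u); exact: nielsen_inv.
- by rewrite -(invgK u) -(invgK v); apply: nielsen_invr; exact: nielsen_inv.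
Qed.

Lemma nielsen_mulV u v : nielsen (u * v) v -> nielsen u v.
Proof.
move=> /nielsen_invr/nielsen_mul; rewrite mulgK => /nielsen_invr.
by rewrite invgK.
Qed.

Lemma nielsen_conjV u v g : nielsen (g * u * g^-1) (g * v * g^-1) -> nielsen u v.
Proof.
by move=> /(nielsen_conj g^-1); rewrite !mulgA !mulVg !mul1g !invgK !mulgVK.
Qed.

Definition spans u v := forall g, g \in in_span u v.

Lemma spans_trans u v u' v' : spans u v -> u \in in_span u' v' ->
  v \in in_span u' v' -> spans u' v'.
Proof.
move=> uv /asboolP[s us] /asboolP[t vt] g; have /asboolP[w ->] := uv g.
by apply/asboolP; rewrite us vt wval_subst; eexists.
Qed.

Lemma spanP u v l : lval u v l \in in_span u v.
Proof. by apply/asboolP; exists [:: l]; rewrite /= mulg1. Qed.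

Lemma spanM u v : {in in_span u v &, forall g h, g * h \in in_span u v}.
Proof.
move=> _ _ /asboolP[s ->] /asboolP[t ->].
by apply/asboolP; exists (s ++ t); rewrite wval_cat.
Qed.

Lemma len_gt0 g : g <> 1 -> (0 < len g)%N.
Proof. by move=> g1; rewrite lt0n; apply/eqP => /size0nil/nf_eq0. Qed.

(* Nielsen-reduced pairs: no product is shorter than a factor, and a factor is
   not used up by the cancellations on its two sides. *)
Definition nielsen_reduced u v := [/\ u <> 1, v <> 1,
  forall l l', l' != linv l -> forall p q r, nf (lval u v l) = p ++ r ->
    nf (lval u v l') = winv r ++ q -> reduced (p ++ q) ->
    (size r <= size p)%N /\ (size r <= size q)%N &
  forall l l' l'' p q r p' q' r', l' != linv l -> l'' != linv l' ->
    nf (lval u v l) = p ++ r -> nf (lval u v l') = winv r ++ q ->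
    reduced (p ++ q) ->
    nf (lval u v l') = p' ++ r' -> nf (lval u v l'') = winv r' ++ q' ->
    reduced (p' ++ q') -> (size r + size r' < len (lval u v l'))%N].

(** Induction from the right: of the value of the first letter a nonempty beginning p survives in
    the product. The cancellation with one more letter on the left does not use up that beginning,
    so each letter leaves at least one letter behind. *)
Lemma nielsen_reduced_len u v l s : nielsen_reduced u v -> reduced (l :: s) ->
  (size s < len (wval u v (l :: s)))%N.
Proof.
move=> [u1 v1 N1 N2] ls.
have l1 k : (0 < len (lval u v k))%N.
  by apply: len_gt0; case: k => [[] []]; rewrite /lval //= => /eqP;
     rewrite invg_eq1 => /eqP.
suff [p [t [E ts p0 _]]] : exists p t, [/\ nf (wval u v (l :: s)) = p ++ t,
    (size s <= size t)%N, (0 < size p)%N &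
    if s is l' :: _ then exists r q, [/\ nf (lval u v l) = p ++ r,
       nf (lval u v l') = winv r ++ q & reduced (p ++ q)]
    else p = nf (lval u v l)].
  by rewrite /len E size_cat; lia.
elim: s l ls => [|l' s IH] l ls.
  by exists (nf (lval u v l)), [::]; rewrite /= mulg1 cats0; split=> //; exact: l1.
have [ll' l's] : l' != linv l /\ reduced (l' :: s) by move: ls => /= /andP[].
have [p' [t [E ts p'0 R]]] := IH l' l's.
have [p [q [r [E1 E2 E3]]]] := nfM (lval u v l) (lval u v l').
have pq : reduced (p ++ q) by rewrite -E3 nf_red.
have [rp rq] := N1 _ _ ll' _ _ _ E1 E2 pq.
have [r' E' rr'] : exists2 r', nf (lval u v l') = p' ++ r' & (size r < size p')%N.
  case: s ls l's ts R {IH E} => [|l'' s] ls l's ts.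
    move=> ->; exists [::]; rewrite ?cats0//.
    by have := l1 l'; rewrite /len E2 size_cat size_winv; lia.
  move=> [r' [q' [F1 F2 F3]]]; exists r' => //.
  have l'l'' : l'' != linv l' by move: l's => /= /andP[].
  have := N2 _ _ _ _ _ _ _ _ _ ll' l'l'' E1 E2 pq F1 F2 F3.
  by rewrite /len F1 size_cat; lia.
(* m is what remains of the value of l' between the cancellations on its two sides. *)
set m := drop (size r) p'.
have p'E : p' = winv r ++ m.
  rewrite -[LHS](cat_take_drop (size r)); congr (_ ++ _).
  have := congr1 (take (size r)) E2; rewrite take_size_cat ?size_winv// => <-.
  by rewrite E' takel_cat// ltnW.
have qE : q = m ++ r'.
  have := congr1 (drop (size r)) E2; rewrite drop_size_cat ?size_winv// => <-.
  by rewrite E' p'E -catA drop_size_cat// size_winv.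
have m0 : m <> [::] by move=> m0; move: rr'; rewrite p'E m0 cats0 size_winv ltnn.
have pmt : reduced (p ++ m ++ t).
  apply: reduced_cat3 m0 _ _.
    by move: pq; rewrite qE catA => /reduced_catl.
  by have := nf_red (wval u v (l' :: s)); rewrite E p'E -catA => /reduced_catr.
have lE : lval u v l = val_ p * val_ r by rewrite -wval_cat -E1 nfK.
have sE : wval u v (l' :: s) = (val_ r)^-1 * val_ (m ++ t).
  by rewrite -wval_winv -wval_cat catA -p'E -E nfK.
exists p, (m ++ t); split.
- by rewrite wval_cons lE sE mulgA mulgK -wval_cat nf_wval.
- by rewrite size_cat; case: (m) m0 => //= ? ? _; lia.
- by have := l1 l; rewrite /len E1 size_cat; lia.
- by exists r, q.
Qed.

End NormalForm.

(** * Nielsen's theorem *)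

Section NielsenTheorem.
Variables (Gam : groupType) (a b : Gam).
Hypothesis hab : free_basis a b.
Local Open Scope group_scope.
Implicit Types (g h u v : Gam) (w p q r s : seq letter).
Local Notation val_ w := (wval a b w).
Local Notation nf := (nf a b).
Local Notation len := (len a b).
Local Notation nielsen := (nielsen a b).

Lemma nf_a : nf a = [:: (true, true)].
Proof. by rewrite -(nf_wval hab (w := [:: (true, true)]))//= mulg1. Qed.
Lemma nf_b : nf b = [:: (false, true)].
Proof. by rewrite -(nf_wval hab (w := [:: (false, true)]))//= mulg1. Qed.

Lemma spans_sym u v : spans u v -> spans v u.
Proof.
move=> uv; apply: (spans_trans uv); first exact: (spanP v u (false, true)).
exact: (spanP v u (true, true)).
Qed.

Lemma spans_neq1 u v : spans u v -> u <> 1.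
Proof.
move=> uv u1; have comm g h : (g * v = v * g) -> g * h = h * g.
  move=> gv; have /asboolP[w ->] := uv h; rewrite u1; elim: w => [|l w IH].
    by rewrite mulg1 mul1g.
  rewrite wval_cons mulgA -[RHS]mulgA -IH mulgA; congr (_ * _).
  case: l => [[] []]; rewrite /lval /= ?invg1 ?mul1g ?mulg1//.
  exact: commuteV.
have : a * b = b * a by apply: (comm a b); apply/esym; exact: comm.
have -> : a * b = val_ [:: (true, true); (false, true)] by rewrite /= mulg1.
have -> : b * a = val_ [:: (false, true); (true, true)] by rewrite /= mulg1.
by move=> /(wval_inj hab) /= -/(_ erefl erefl).
Qed.

Lemma spans_letters u v l l' : l.1 != l'.1 -> spans u v ->
  spans (lval u v l) (lval u v l').
Proof.
have key x y e e' : spans x y -> spans (lval x y (true, e)) (lval x y (false, e')).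
  move=> xy; apply: (spans_trans xy).
    apply/asboolP; exists [:: (true, e)].
    by rewrite /= mulg1; case: e; rewrite /lval //= invgK.
  apply/asboolP; exists [:: (false, e')].
  by rewrite /= mulg1; case: e'; rewrite /lval //= invgK.
case: l l' => [[] e] [[] e'] //= _ uv; first exact: key.
by apply: spans_sym; exact: key.
Qed.

Lemma nielsen_letters u v l l' : l.1 != l'.1 ->
  nielsen (lval u v l) (lval u v l') -> nielsen u v.
Proof.
case: l l' => [[] e] [[] e'] //= _; first exact: nielsen_lval.
by move=> /nielsen_swap; exact: nielsen_lval.
Qed.

Lemma len_letters u v l l' : l.1 != l'.1 ->
  (len (lval u v l) + len (lval u v l') = len u + len v)%N.
Proof.
by case: l l' => [[] []] [[] []] //= _; rewrite /lval/= ?(lenV hab)// addnC.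
Qed.

Lemma wval_conj u v g w : wval (g * u * g^-1) (g * v * g^-1) w = g * wval u v w * g^-1.
Proof.
elim: w => [|l w IH]; first by rewrite /= mulg1 mulgV.
rewrite !wval_cons IH !mulgA; congr (_ * _ * _).
have -> : lval (g * u * g^-1) (g * v * g^-1) l = g * lval u v l * g^-1.
  by case: l => [[] []]; rewrite /lval /= ?invgM ?invgK ?mulgA.
by rewrite mulgVK.
Qed.

Lemma spans_conjV u v g : spans (g * u * g^-1) (g * v * g^-1) -> spans u v.
Proof.
move=> uv h; have /asboolP[w] := uv (g * h * g^-1); rewrite wval_conj.
by move=> /mulIg/mulgI ->; apply/asboolP; exists w.
Qed.

(** Induction on the total length. A pair that cannot be shortened is Nielsen-reduced; then only
    single letters in u and v have length one, so a and b are among them. *)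
Lemma nielsen_theorem u v : spans u v -> nielsen u v.
Proof.
have [n] := ubnP (len u + len v); elim: n u v => // n IHn u v.
rewrite ltnS => uvn uv.
have {uvn}IH u' v' : (len u' + len v' < len u + len v)%N -> spans u' v' ->
    nielsen u' v'.
  by move=> lt; apply: IHn; exact: leq_trans lt uvn.
set x := lval u v.
have xneq l : x l <> 1.
  case: l => [c e]; apply: (@spans_neq1 _ (x (~~ c, true))).
  by apply: spans_letters uv; case: c.
have [] := pselect (exists (l l' : letter), l.1 != l'.1 /\ (len (x l * x l') < len (x l))%N).
  move=> [l [l' [ll' lt]]]; apply: (nielsen_letters ll'); apply: nielsen_mulV.
  apply: IH; first by rewrite -(len_letters u v ll') ltn_add2r.
  apply: (spans_trans (spans_letters ll' uv)); last exact: (spanP (x l * x l') (x l') (false, true)).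
  rewrite -[X in X \in _](mulgK (x l')); apply: spanM; first exact: (spanP (x l * x l') (x l') (true, true)).
  exact: (spanP (x l * x l') (x l') (false, false)).
move=> nA.
have len1 (l l' : letter) : l.1 != l'.1 -> (len (x l) <= len (x l * x l'))%N.
  by move=> ll'; rewrite leqNgt; apply/negP => lt; apply: nA; exists l, l'.
have len2 (l l' : letter) : l.1 != l'.1 -> (len (x l') <= len (x l * x l'))%N.
  move=> ll'; have := len1 (linv l') (linv l); rewrite /x !lval_inv (lenV hab).
  have -> : (lval u v l')^-1 * (lval u v l)^-1 = (lval u v l * lval u v l')^-1 by rewrite invgM.
  rewrite (lenV hab).
  by apply; rewrite eq_sym.
(* The obstruction that multiplication does not shorten: x l' is cancelled by x l from both sides,
   half from each. Conjugation by r takes (x l' * x l, x l') to (d, r' * r^-1), which saves at least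
   the length of x l'. *)
have [] := pselect (exists (l l' : letter) d r r', [/\ l.1 != l'.1, size r = size r',
    nf (x l) = winv r' ++ d ++ r & nf (x l') = winv r ++ r']).
  move=> [l [l' [d [r [r' [ll' rr' E1 E2]]]]]]; apply: (nielsen_letters ll').
  rewrite -/(x l) -/(x l').
  have r0 : (0 < size r)%N.
    rewrite lt0n; apply/eqP => r0; apply: (xneq l'); apply: (nf_eq0 hab).
    by rewrite E2 (size0nil r0) (size0nil (etrans (esym rr') r0)).
  have xE : x l = (val_ r')^-1 * (val_ d * val_ r).
    by rewrite -wval_winv -!wval_cat -E1 nfK.
  have yE : x l' = (val_ r)^-1 * val_ r'.
    by rewrite -wval_winv -!wval_cat -E2 nfK.
  have E3 : x l' * x l = (val_ r)^-1 * val_ d * (val_ r)^-1^-1.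
    by rewrite xE yE invgK !mulgA mulgK.
  have E4 : x l' = (val_ r)^-1 * (val_ r' * (val_ r)^-1) * (val_ r)^-1^-1.
    by rewrite yE invgK mulgA mulgVK.
  apply: nielsen_mulV; apply: (@nielsen_conjV _ _ _ _ _ (x l')).
  rewrite mulgA mulgK mulgK -/(x l') E3 [X in nielsen _ X]E4.
  apply: nielsen_conj; apply: IH.
    rewrite -(len_letters u v ll') -/(x l) -/(x l').
    have := len_wval hab d; have := len_wval hab (r' ++ winv r).
    rewrite wval_cat wval_winv size_cat size_winv.
    by rewrite /len E1 E2 !size_cat size_winv; lia.
  apply: (@spans_conjV _ _ (val_ r)^-1); rewrite -E3 -E4.
  apply: (spans_trans (spans_letters ll' uv)).
    rewrite -[lval u v l](mulKg (x l')); apply: spanM; first exact: (spanP (x l' * x l) (x l') (false, false)).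
    exact: (spanP (x l' * x l) (x l') (true, true)).
  exact: (spanP (x l' * x l) (x l') (false, true)).
move=> nB.
have red : nielsen_reduced a b u v.
  have N1 l l' : l' != linv l -> forall p q r, nf (x l) = p ++ r ->
      nf (x l') = winv r ++ q -> reduced (p ++ q) ->
      (size r <= size p)%N /\ (size r <= size q)%N.
    move=> l'l p q r E1 E2 pq.
    have [ll'|ll'] := eqVneq l l'.
      rewrite -ll' in E2; have rp := square_cancellation hab (@xneq l) E1 E2.
      have := congr1 size E1; rewrite E2 !size_cat size_winv; lia.
    have {}ll' : l.1 != l'.1 by case: l l' l'l ll' {E1 E2} => [[] []] [[] []].
    have E3 : nf (x l * x l') = p ++ q.
      rewrite -(nfK hab (x l)) -(nfK hab (x l')) E1 E2 !wval_cat wval_winv.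
      by rewrite mulgA mulgK -wval_cat nf_wval.
    have := len1 _ _ ll'; have := len2 _ _ ll'.
    by rewrite /len E3 E1 E2 !size_cat size_winv; lia.
  split; [exact: (xneq (true, true))|exact: (xneq (false, true))|exact: N1|].
  move=> l l' l'' p q r p' q' r' ll' l'l'' E1 E2 pq E3 E4 pq'.
  have [rp rq] := N1 _ _ ll' _ _ _ E1 E2 pq.
  have [rp' rq'] := N1 _ _ l'l'' _ _ _ E3 E4 pq'.
  rewrite ltnNge; apply/negP; rewrite /len E3 size_cat => le.
  have sE : size (winv r ++ q) = size (p' ++ r') by rewrite -E2 E3.
  rewrite !size_cat size_winv in sE.
  have [sr sp'] : size r = size r' /\ size p' = size (winv r) by rewrite size_winv; lia.
  have p'E : p' = winv r.
    by have := congr1 (take (size p')) E3; rewrite E2 take_size_cat// sp' take_size_cat.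
  rewrite p'E in E3 E4 sp' sE rp' le pq'.
  have nll' : l.1 != l'.1.
    have [E|ne] := eqVneq l l'; last by case: l l' l'l'' ll' ne {E1 E2 E3} => [[] []] [[] []].
    rewrite -E in E2; have := square_cancellation hab (@xneq l) E1 E2.
    have := congr1 size E1; rewrite E2 !size_cat size_winv in sE *; lia.
  have nl'l'' : l'.1 != l''.1.
    have [E|ne] := eqVneq l' l''; last by case: l' l'' l'l'' ll' ne nll' {E1 E2 E3 E4} => [[] []] [[] []].
    rewrite -E in E4; have := square_cancellation hab (@xneq l') E3 E4.
    by rewrite size_winv; lia.
  (* With only two generators x l'' is x l or its inverse; the inverse would give r = r' and hence x
     l' = 1. *)
  have [l''l|l''l] := eqVneq l'' (linv l).
    have := E4; rewrite l''l /x lval_inv nfV// -/x E1 winv_cat => E5.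
    have rr' : r = r'.
      apply: (can_inj winvK); have := congr1 (take (size r)) E5.
      by rewrite take_size_cat ?size_winv// take_size_cat// size_winv.
    by apply: (xneq l'); rewrite -(nfK hab (x l')) E3 rr' wval_cat wval_winv mulVg.
  have {}l''l : l'' = l.
    by case: l l' l'' l''l nll' nl'l'' {E1 E2 E3 E4 ll' l'l''} => [[] []] [[] []] [[] []].
  rewrite l''l in E4; apply: nB.
  exists l, l', (drop (size r') p), r, r'; split=> //.
  rewrite E1 catA; congr (_ ++ _); rewrite -[LHS](cat_take_drop (size r')).
  congr (_ ++ _); have := congr1 (take (size r')) E4; rewrite E1.
  by rewrite takel_cat -?sr// sr take_size_cat ?size_winv.
have lett g : len g = 1%N -> exists l, g = x l.
  move=> g1; have /asboolP[w] := uv g.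
  rewrite -wval_foldr_reduce; have := reduced_foldr w.
  case: (foldr _ _ _) => [|l s] rs gE; first by move: g1; rewrite gE /len /= nf1.
  have := nielsen_reduced_len hab red rs; rewrite -gE g1.
  by case: s {rs} gE => //= -> _; exists l; rewrite mulg1.
have [|l aE] := lett a; first by rewrite /len nf_a.
have [|l' bE] := lett b; first by rewrite /len nf_b.
have [ll'|] := eqVneq l.1 l'.1; last first.
  by move=> /nielsen_letters; apply; rewrite -/(x l) -/(x l') -aE -bE; exact: nielsen_base.
exfalso; have : b = a \/ b = a^-1.
  rewrite bE aE; case: l l' ll' {aE bE} => [c []] [_ []] /= <-; [by left|right|right|by left].
    by rewrite -/(linv (c, true)) /x lval_inv.
  by rewrite -[(c, true)]/(linv (c, false)) /x lval_inv.
by case=> /(congr1 nf); rewrite ?nfV// nf_b nf_a.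
Qed.

End NielsenTheorem.

(** * The Farey tree of primitive elements *)

Section SternBrocot.
Variables (Gam : groupType) (a b : Gam).
Local Open Scope group_scope.
Implicit Types (g h u v : Gam) (n : int) (s : seq bool) (e : Gam * Gam).

Definition zpow g n : Gam := match n with Posz k => g ^+ k | Negz k => (g ^+ k.+1)^-1 end.

Lemma zpowS g n : zpow g (n + 1)%R = g * zpow g n.
Proof.
case: n => [k|[|k]]; first by rewrite /= addn1 expgS.
  by rewrite /= expg1 mulgV.
rewrite (_ : (_ + _)%R = Negz k); last by lia.
by rewrite /= [g ^+ k.+2]expgSr invgM mulgA mulgV mul1g.
Qed.

Definition fan n := zpow a n * b.

Lemma fan0 : fan 0 = b. Proof. by rewrite /fan mul1g. Qed.

Lemma fanS n : fan (n + 1)%R = a * fan n.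
Proof. by rewrite /fan zpowS mulgA. Qed.

(* A pair (u, v) stands for the edge of the Farey tree between the slopes of
   u and v; beyond it lies the slope of u * v. *)
Definition farey_step (d : bool) e := if d then (e.1, e.1 * e.2) else (e.1 * e.2, e.2).
Definition farey_node e s := foldl (fun e d => farey_step d e) e s.
Definition fan_node n s := farey_node (fan (n + 1)%R, fan n) s.

(* Up to conjugation and inversion, the primitive elements other than a. *)
Definition region n (o : option (seq bool)) : Gam :=
  if o is Some s then (fan_node n s).1 * (fan_node n s).2 else fan n.

Inductive farey_edge : Gam -> Gam -> Prop :=
| farey_edge_fan n : farey_edge a (fan n)
| farey_edge_node n s : farey_edge (fan_node n s).1 (fan_node n s).2.

Let gsimp := (@invgM Gam, @invgK Gam, @invg1 Gam, @mulgA Gam, @mulgK Gam,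
  @mulgVK Gam, @mulVg Gam, @mulgV Gam, @mul1g Gam, @mulg1 Gam).

(** The letters l and l' of different generators encode both orders of the pair and all signs. *)
Definition std u v := exists p q g l l', [/\ farey_edge p q, l.1 != l'.1,
  u = g * lval p q l * g^-1 & v = g * lval p q l' * g^-1].

Lemma std_edge p q : farey_edge p q -> std p q.
Proof.
move=> pq; exists p, q, 1, (true, true), (false, true).
by rewrite invg1 !mulg1 !mul1g.
Qed.

Lemma std_inv u v : std u v -> std u^-1 v.
Proof.
move=> [p [q [g [l [l' [pq ll' -> ->]]]]]]; exists p, q, g, (linv l), l'; split=> //.
by rewrite lval_inv !invgM invgK mulgA.
Qed.

Lemma std_swap u v : std u v -> std v u.
Proof.
move=> [p [q [g [l [l' [pq ll' -> ->]]]]]]; exists p, q, g, l', l; split=> //.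
by rewrite eq_sym.
Qed.

Lemma std_invr u v : std u v -> std u v^-1.
Proof. by move=> /std_swap/std_inv/std_swap. Qed.

Lemma std_conj g u v : std u v -> std (g * u * g^-1) (g * v * g^-1).
Proof.
move=> [p [q [h [l [l' [pq ll' -> ->]]]]]]; exists p, q, (g * h), l, l'.
by split=> //; rewrite !invgM !mulgA.
Qed.

(** An edge of the Farey triangulation lies in two triangles: the products are the other two sides
    of one of them, the quotients those of the other. *)
Lemma farey_neighbours p q : farey_edge p q ->
  [/\ std (p * q) q, std (p * q) p, std (p * q^-1) q & std (p * q^-1) p].
Proof.
have conjV g h : (g * h * g^-1)^-1 = g * h^-1 * g^-1.
  by rewrite !invgM invgK mulgA.
case=> [n|n s].
  have E : fan n = a * fan (n - 1)%R by rewrite -fanS subrK.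
  split.
  - by rewrite -fanS; exact: (std_edge (farey_edge_node n [::])).
  - by rewrite -fanS; apply: std_swap; exact: std_edge (farey_edge_fan _).
  - have := std_swap (std_edge (farey_edge_node (n - 1)%R [::])).
    rewrite /= subrK => /(std_conj (fan n))/std_inv.
    rewrite mulgK conjV.
    by have -> : fan n * (fan (n - 1)%R)^-1 = a by rewrite E mulgK.
  - have := std_swap (std_edge (farey_edge_fan (n - 1)%R)).
    move=> /(std_conj a)/std_inv; rewrite mulgK -E.
    by rewrite invgM invgK.
have child d : std (farey_step d (fan_node n s)).1 (farey_step d (fan_node n s)).2.
  have := std_edge (farey_edge_node n (rcons s d)).
  by rewrite /fan_node /farey_node foldl_rcons.
split; [exact: (child false)|exact: (std_swap (child true))| |].
- case/lastP: s child => [_|s d _].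
    rewrite /= fanS mulgK; exact: std_edge (farey_edge_fan _).
  have := std_edge (farey_edge_node n s).
  have := std_edge (farey_edge_node n (rcons s (~~ d))).
  rewrite /fan_node /farey_node !foldl_rcons -/(farey_node _ s) -/(fan_node n s).
  case: (fan_node n s) => p0 q0; case: d => /= pq pq'; last by rewrite mulgK.
  have := std_conj (p0 * q0) (std_swap pq); rewrite mulgK => /std_inv.
  by rewrite conjV !invgM !mulgA !mulgK.
- case/lastP: s child => [_|s d _].
    rewrite /= {1}fanS mulgK; exact: std_edge (farey_edge_fan _).
  have := std_edge (farey_edge_node n s).
  have := std_edge (farey_edge_node n (rcons s (~~ d))).
  rewrite /fan_node /farey_node !foldl_rcons -/(farey_node _ s) -/(fan_node n s).
  case: (fan_node n s) => p0 q0; case: d => /= pq pq'; last by rewrite mulgK.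
  have := std_conj p0 (std_swap pq'); rewrite mulgK => /std_inv.
  by rewrite conjV !invgM !mulgA.
Qed.

Lemma nielsen_std u v : nielsen a b u v -> std u v.
Proof.
elim=> {u v}[|u v _|u v _|u v _|u v g _].
- by have := std_edge (farey_edge_fan 0); rewrite fan0.
- exact: std_inv.
- exact: std_swap.
- move=> [p [q [g [l [l' [pq ll' -> ->]]]]]].
  have -> : g * lval p q l * g^-1 * (g * lval p q l' * g^-1) =
      g * (lval p q l * lval p q l') * g^-1 by rewrite !mulgA mulgVK.
  apply: std_conj; have [N1 N2 N3 N4] := farey_neighbours pq.
  (* Up to inversion and conjugation the eight products of signed letters are the four neighbours
     just obtained. *)
  case: l l' ll' => [[] []] [[] []] //= _; rewrite /lval /=.
  + exact: std_invr N3.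
  + by have := std_inv (std_conj q^-1 N3); rewrite !gsimp.
  + by have := std_invr (std_inv (std_conj q N1)); rewrite !gsimp.
  + by have := std_conj p^-1 N2; rewrite !gsimp.
  + by have := std_invr (std_inv N4); rewrite !gsimp.
  + by have := std_conj p^-1 N4; rewrite !gsimp.
  + by have := std_invr (std_inv N2); rewrite !gsimp.
- exact: std_conj.
Qed.

Lemma cls_refl g : cls g g.
Proof. by exists 1; left; rewrite mul1g invg1 mulg1. Qed.

Lemma cls_conj g h : cls (h * g * h^-1) = cls g.
Proof.
apply/seteqP; split=> k [l lP].
  exists (l * h); case: lP => ->; [left|right]; rewrite !invgM ?invgK !mulgA //.
exists (l * h^-1); case: lP => ->; [left|right];
  by rewrite !invgM ?invgK !mulgA !mulgVK.
Qed.

Lemma cls_inv g : cls g^-1 = cls g.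
Proof.
by apply/seteqP; split=> k [l [] ->]; exists l; rewrite ?invgK; [right|left|right|left].
Qed.

Lemma cls_eqP g k : cls g k -> cls k = cls g.
Proof. by move=> [l [] ->]; rewrite cls_conj ?cls_inv. Qed.

Lemma farey_edge_region p q : farey_edge p q ->
  (p = a \/ exists n o, p = region n o) /\ (exists n o, q = region n o).
Proof.
case=> [n|n s]; first by split; [left|exists n, None].
suff [] : (exists n' o, (fan_node n s).1 = region n' o) /\
    (exists n' o, (fan_node n s).2 = region n' o) by split; [right|].
elim/last_ind: s => [|s d [IH1 IH2]].
  by split; [exists (n + 1)%R, None|exists n, None].
rewrite /fan_node /farey_node foldl_rcons -/(farey_node _ s) -/(fan_node n s).
by case: d => /=; split=> //; exists n, (Some s).
Qed.

Lemma primitive_region g : free_basis a b -> primitive g ->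
  cls g = cls a \/ exists n o, cls g = cls (region n o).
Proof.
move=> hab [u [v [uv guv]]].
have /nielsen_std[p [q [h [l [l' [pq ll' uE vE]]]]]] : nielsen a b u v.
  apply: nielsen_theorem => // k; apply/asboolP; exact: free_basis_span.
have [P Q] := farey_edge_region pq.
suff key k : cls (h * lval p q k * h^-1) = cls a \/
    exists n o, cls (h * lval p q k * h^-1) = cls (region n o).
  by case: guv => ->; rewrite ?uE ?vE; exact: key.
rewrite cls_conj; have -> : cls (lval p q k) = cls (if k.1 then p else q).
  by case: k => [[] []]; rewrite /lval //= cls_inv.
case: k.1; last by right; have [n [c E]] := Q; exists n, c; rewrite E.
by case: P => [->|[n [c E]]]; [left|right; exists n, c; rewrite E].
Qed.

Lemma free_basis_sym u v : free_basis u v -> free_basis v u.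
Proof.
move=> uv G x y; have [f [fu fv fU]] := uv G y x.
by exists f; split=> // f' f'v f'u; exact: fU.
Qed.

Lemma free_basis_mul u v : free_basis u v -> free_basis (u * v) v.
Proof.
move=> uv G x y; have [f [fu fv fU]] := uv G (x * y^-1) y.
exists f; split=> //; first by rewrite gmulfM fu fv mulgVK.
move=> f' f'uv f'v; apply: fU => //.
by rewrite -f'uv -f'v gmulfM mulgK.
Qed.

Lemma free_basis_mulr u v : free_basis u v -> free_basis u (u * v).
Proof.
move=> uv G x y; have [f [fu fv fU]] := uv G x (x^-1 * y).
exists f; split=> //; first by rewrite gmulfM fu fv mulgA mulgV mul1g.
move=> f' f'u f'uv; apply: fU => //.
by rewrite -f'uv -f'u gmulfM mulgA mulVg mul1g.
Qed.

Lemma free_basis_mulVr u v : free_basis u (u * v) -> free_basis u v.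
Proof.
move=> uv G x y; have [f [fu fuv fU]] := uv G x (x * y).
exists f; split=> //.
  by move: fuv; rewrite gmulfM fu => /mulgI.
by move=> f' f'u f'v; apply: fU => //; rewrite gmulfM f'u f'v.
Qed.

Lemma free_basis_fan n : free_basis a b -> free_basis a (fan n).
Proof.
move=> hab; elim/int_rec: n => [|n IH|n IH]; first by rewrite fan0.
  by rewrite -[X in fan X]/(Posz n.+1) -addn1 PoszD fanS; exact: free_basis_mulr.
apply: free_basis_mulVr; rewrite -fanS.
by have -> : (- n.+1%:Z + 1 = - n%:Z)%R by lia.
Qed.

Lemma free_basis_node n s : free_basis a b ->
  free_basis (fan_node n s).1 (fan_node n s).2.
Proof.
move=> hab; elim/last_ind: s => [|s d IH].
  apply: free_basis_sym; rewrite /= fanS; apply/free_basis_sym/free_basis_mul.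
  exact: free_basis_fan.
rewrite /fan_node /farey_node foldl_rcons -/(farey_node _ s) -/(fan_node n s).
by case: d; [exact: free_basis_mulr|exact: free_basis_mul].
Qed.

Lemma region_primitive n o : free_basis a b -> primitive (region n o).
Proof.
move=> hab; case: o => [s|].
  by exists (region n (Some s)), (fan_node n s).2; split; [apply: free_basis_mul;
    exact: free_basis_node|left].
by exists a, (fan n); split; [exact: free_basis_fan|right].
Qed.

End SternBrocot.

(** * Slopes: the regions seen in the abelianization *)

Lemma lift01 : lift ord0 (ord0 : 'I_1) = 1 :> 'I_2.
Proof. exact: val_inj. Qed.

Lemma sum_ord2 (V : zmodType) (F : 'I_2 -> V) : \sum_i F i = F 0 + F 1.
Proof. by rewrite !big_ord_recl big_ord0 addr0 lift01. Qed.

Lemma det_ord2 (K : comPzRingType) (M : 'M[K]_2) :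
  \det M = M 0 0 * M 1 1 - M 0 1 * M 1 0.
Proof.
rewrite (expand_det_row _ 0) sum_ord2 /cofactor !det_mx11 !mxE /=.
have -> : lift 0 0 = 1 :> 'I_2 by exact: val_inj.
have -> : lift 1 0 = 0 :> 'I_2 by exact: val_inj.
by rewrite expr0 expr1 mul1r mulN1r mulrN.
Qed.

(** Stern-Brocot coordinates: the coefficients of the region reached by the path s behind an edge,
    in terms of the two regions along that edge. *)
Fixpoint coef (s : seq bool) : nat * nat :=
  if s is d :: s' then
    let c := coef s' in if d then ((c.1 + c.2)%N, c.2) else (c.1, (c.1 + c.2)%N)
  else (1%N, 1%N).

Lemma coef_gt0 s : (0 < (coef s).1)%N /\ (0 < (coef s).2)%N.
Proof. by elim: s => [//|[] s [IH1 IH2]] /=; lia. Qed.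

(** The Euclidean algorithm: the larger coefficient tells the first letter of the path, and the
    coefficients are equal only for the empty path. *)
Lemma coef_inj : injective coef.
Proof.
elim=> [|d s IH] [|d' s'] //=.
- by have := coef_gt0 s'; case: d' => /= -[? ?] []; lia.
- by have := coef_gt0 s; case: d => /= -[? ?] []; lia.
have := coef_gt0 s; have := coef_gt0 s'; have := IH s'.
case: (coef s) => i j; case: (coef s') => i' j' /= E [? ?] [? ?].
by case: d; case: d' => -[] *; (try (exfalso; lia)); rewrite E//; congr pair; lia.
Qed.

Definition slope (n : int) (o : option (seq bool)) : int * int :=
  if o is Some s then
    (n * ((coef s).1 + (coef s).2)%N%:Z + (coef s).1%:Z, ((coef s).1 + (coef s).2)%N%:Z)
  else (n, 1).

Lemma slope_gt0 n o : 0 < (slope n o).2.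
Proof. by case: o => [s|] //=; have := coef_gt0 s; lia. Qed.

(** The quotient of the two coordinates is n, or n + i / (i + j) with i and j positive; so n is its
    integer part. *)
Lemma slope_inj n o n' o' : slope n o = slope n' o' -> n = n' /\ o = o'.
Proof.
case: o o' => [s|] [s'|] /= [].
- have := coef_gt0 s; have := coef_gt0 s'; have := @coef_inj s s'.
  case: (coef s) => i j; case: (coef s') => i' j' /= E [? ?] [? ?] Ep Eq.
  have nn' : n = n' by nia.
  subst n'; have ii' : i = i' by nia.
  by split=> //; congr Some; apply: E; congr pair; lia.
- by have := coef_gt0 s; lia.
- by have := coef_gt0 s'; lia.
- by [].
Qed.

Lemma slope_shift m n o :
  slope (n + m) o = ((slope n o).1 + (slope n o).2 * m, (slope n o).2).
Proof. by case: o => [s|] /=; congr pair; lia. Qed.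

Section Slopes.
Variables (Gam : groupType) (a b : Gam) (ab : Gam -> 'cV[int]_2).
Hypothesis abM : forall g k, ab (g * k)%g = ab g + ab k.
Implicit Types (g h u v : Gam).

Lemma ab1 : ab 1%g = 0.
Proof. by apply: (addrI (ab 1%g)); rewrite -abM mulg1 addr0. Qed.

Lemma abV g : ab g^-1%g = - ab g.
Proof. by apply: (addrI (ab g)); rewrite -abM mulgV ab1 subrr. Qed.

Lemma abJ g h : ab (h * g * h^-1)%g = ab g.
Proof. by rewrite !abM abV addrAC subrr add0r. Qed.

Lemma ab_cls g h : cls g = cls h -> ab g = ab h \/ ab g = - ab h.
Proof.
move=> E; have : cls h g by rewrite -E; exact: cls_refl.
by move=> [l [] ->]; rewrite abJ; [left|right; rewrite abV].
Qed.

Lemma ab_node (e : Gam * Gam) s :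
  ab ((farey_node e s).1 * (farey_node e s).2)%g =
  (coef s).1%:Z *: ab e.1 + (coef s).2%:Z *: ab e.2.
Proof.
elim: s e => [|d s IH] e; first by rewrite !scale1r abM.
rewrite -[farey_node e _]/(farey_node (farey_step d e) s) IH.
by case: d; rewrite /= abM !PoszD scalerDr scalerDl addrA.
Qed.

Lemma ab_zpow g n : ab (zpow g n) = n *: ab g.
Proof.
elim/int_rec: n => [|n IH|n IH]; first by rewrite ab1 scale0r.
  by rewrite -[Posz n.+1]/(Posz (1 + n)) PoszD addrC zpowS abM IH scalerDl scale1r addrC.
have := zpowS g (- n.+1%:Z); have -> : - n.+1%:Z + 1 = - n%:Z by lia.
move=> /(congr1 ab); rewrite abM IH => E; apply: (addrI (ab g)); rewrite -E.
by rewrite -[X in X + _]scale1r -scalerDl; congr (_ *: _); lia.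
Qed.

Lemma ab_fan n : ab (fan a b n) = n *: ab a + ab b.
Proof. by rewrite abM ab_zpow. Qed.

Lemma ab_region n o :
  ab (region a b n o) = (slope n o).1 *: ab a + (slope n o).2 *: ab b.
Proof.
case: o => [s|] /=; last by rewrite ab_fan scale1r.
rewrite ab_node /= !ab_fan !scalerDr !scalerA addrACA -!scalerDl -PoszD.
by congr (_ *: _ + _); rewrite PoszD; lia.
Qed.

Definition det2 (X Y : 'cV[int]_2) := X 0 0 * Y 1 0 - X 1 0 * Y 0 0.

(** Used to see that the abelianization of every free basis is a basis of Z^2. *)
Lemma nielsen_det2 u v : nielsen a b u v ->
  `|det2 (ab u) (ab v)|%N = `|det2 (ab a) (ab b)|%N.
Proof.
elim=> {u v} [|u v _ <-|u v _ <-|u v _ <-|u v g _ <-] //.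
- by rewrite /det2 abV !mxE -abszN; congr (absz _); ring.
- by rewrite /det2 -abszN; congr (absz _); ring.
- by rewrite /det2 abM !mxE; congr (absz _); ring.
- by rewrite /det2 !abJ.
Qed.

Lemma det2_free X Y (p q p' q' : int) : det2 X Y != 0 ->
  p *: X + q *: Y = p' *: X + q' *: Y -> p = p' /\ q = q'.
Proof.
rewrite /det2 => d0 /colP E; move: (E 0) (E 1); rewrite !mxE => E0 E1.
have Ep : (p - p') * (X 0 0 * Y 1 0 - X 1 0 * Y 0 0) = 0.
  transitivity ((p * X 0 0 + q * Y 0 0 - (p' * X 0 0 + q' * Y 0 0)) * Y 1 0 -
                (p * X 1 0 + q * Y 1 0 - (p' * X 1 0 + q' * Y 1 0)) * Y 0 0); first by ring.
  by rewrite E0 E1 !subrr !mul0r subrr.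
have Eq : (q - q') * (X 0 0 * Y 1 0 - X 1 0 * Y 0 0) = 0.
  transitivity ((p * X 1 0 + q * Y 1 0 - (p' * X 1 0 + q' * Y 1 0)) * X 0 0 -
                (p * X 0 0 + q * Y 0 0 - (p' * X 0 0 + q' * Y 0 0)) * X 1 0); first by ring.
  by rewrite E0 E1 !subrr !mul0r subrr.
move/eqP: Ep; move/eqP: Eq; rewrite !mulf_eq0 (negbTE d0) !orbF !subr_eq0.
by move=> /eqP -> /eqP ->.
Qed.

Hypothesis ind : det2 (ab a) (ab b) != 0.

Lemma ab_region_inj n o n' o' :
  ab (region a b n o) = ab (region a b n' o') \/
  ab (region a b n o) = - ab (region a b n' o') -> n = n' /\ o = o'.
Proof.
rewrite !ab_region => E; apply: slope_inj.
have := slope_gt0 n o; have := slope_gt0 n' o'.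
case: E.
  move=> /(det2_free ind)[]; case: (slope n o) => ? ?; case: (slope n' o') => ? ? /=.
  by move=> -> ->.
rewrite opprD -!scaleNr => /(det2_free ind)[].
by case: (slope n o) => ? ?; case: (slope n' o') => ? ? /=; lia.
Qed.

Lemma cls_region_inj n o n' o' :
  cls (region a b n o) = cls (region a b n' o') -> n = n' /\ o = o'.
Proof. by move=> /ab_cls; exact: ab_region_inj. Qed.

Lemma ab_region_neq n o :
  ~ (ab (region a b n o) = ab a \/ ab (region a b n o) = - ab a).
Proof.
rewrite ab_region.
rewrite -[X in _ = X \/ _]addr0 -(scale0r (ab b)) -{1}[X in _ = X + _]scale1r.
rewrite -[X in _ \/ _ = X]addr0 -(scale0r (ab b)) -[X in _ \/ _ = X + _]scaleN1r.
by case=> /(det2_free ind) []; have := slope_gt0 n o; lia.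
Qed.

Lemma cls_region_neq n o : cls (region a b n o) <> cls a.
Proof. by move=> /ab_cls; exact: ab_region_neq. Qed.

End Slopes.

(** * The parabolic automorphism as a shift of the regions *)

Section ParabolicAction.
Variables (Gam : groupType) (a b : Gam) (ab : Gam -> 'cV[int]_2).
Hypothesis hab : free_basis a b.
Hypothesis abM : forall g k, ab (g * k)%g = ab g + ab k.
Hypothesis ind : `|det2 (ab a) (ab b)|%N = 1%N.
Variables (H : 'M[int]_2) (Hstar : {multiplicative Gam -> Gam}).
Hypothesis hdet : \det H = 1.
Hypothesis hpar : parabolic H.
Hypothesis hbij : bijective Hstar.
Hypothesis hinduced : forall g, ab (Hstar g) = H *m ab g.
Hypothesis hfix : Hstar @` cls a = cls a.
Implicit Types (g h u v : Gam).

Let ind0 : det2 (ab a) (ab b) != 0.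
Proof. by move: ind; case: (det2 _ _) => [[|?]|?]. Qed.

Lemma image_cls g : Hstar @` cls g = cls (Hstar g).
Proof.
have [Hi HiK KHi] := hbij.
apply/seteqP; split=> [_ [k [l lP] <-]|k [l lP]].
  by exists (Hstar l); case: lP => ->; rewrite !gmulfM !multiplicativeV; [left|right].
exists (Hi k); rewrite ?KHi//; exists (Hi l).
case: lP => kE; [left|right]; apply: (can_inj HiK);
  by rewrite !gmulfM !multiplicativeV !KHi.
Qed.

Lemma det2_mul X Y : det2 (H *m X) (H *m Y) = \det H * det2 X Y.
Proof.
rewrite det_ord2 /det2 !mxE !sum_ord2; ring.
Qed.

(** In the basis ab a, ab b the matrix of H is triangular because the class of a is fixed; by the
    determinant its diagonal entries are the same sign e, and N = 0 would mean H = e I. *)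
Lemma parabolic_shift : exists (N e : int), [/\ N != 0, e * e = 1,
  H *m ab a = e *: ab a & H *m ab b = e *: (ab b + N *: ab a)].
Proof.
pose A := ab a; pose B := ab b; pose d := det2 A B.
have dd : d * d = 1 by rewrite /d /A /B; lia.
(* Cramer's rule; d is its own inverse. *)
have coords V : V = (d * det2 V B) *: A + (d * det2 A V) *: B.
  apply/colP => i; rewrite !mxE.
  have : d * d * V i 0 = V i 0 by rewrite dd mul1r.
  have [->|->] : i = 0 \/ i = 1.
    by case: i => [[|[|//]] Hi]; [left|right]; exact: val_inj.
  - by move=> <-; rewrite /d /det2; ring.
  - by move=> <-; rewrite /d /det2; ring.
have [e ee Ha] : exists2 e : int, e * e = 1 & H *m A = e *: A.
  have : cls (Hstar a) = cls a by rewrite -image_cls.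
  move=> /(ab_cls abM); rewrite hinduced => -[] E; [exists 1|exists (-1)] => //.
    by rewrite scale1r.
  by rewrite scaleN1r.
pose p := d * det2 (H *m B) B; pose q := d * det2 A (H *m B).
have Hb : H *m B = p *: A + q *: B := coords _.
have qe : q = e.
  have := det2_mul A B; rewrite hdet mul1r Ha -/d => E.
  have dE : det2 (e *: A) (H *m B) = e * det2 A (H *m B).
    by rewrite /det2 !mxE; ring.
  have eq1 : e * q = 1 by rewrite /q mulrCA -dE E.
  by rewrite -[q]mul1r -ee -mulrA eq1 mulr1.
rewrite qe in Hb; exists (e * p), e; split=> //; last first.
  by rewrite Hb scalerDr scalerA mulrA ee mul1r addrC.
apply/eqP => ep0; have p0 : p = 0 by rewrite -[p]mul1r -ee -mulrA ep0 mulr0.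
have HV (V : 'cV[int]_2) : H *m V = e *: V.
  rewrite (coords V) mulmxDr -!scalemxAr Ha Hb p0 scale0r add0r scalerDr.
  by rewrite !scalerA ![e * _]mulrC.
have HE : H = e%:M.
  apply/matrixP => i j; have := HV (delta_mx j 0); rewrite -colE => /colP/(_ i).
  by rewrite !mxE => ->; case: eqP => _; rewrite ?mulr1 ?mulr0 ?mulr1n ?mulr0n ?andbT.
have [_ [H1 HN1]] := hpar.
have [e1|e1] : e = 1 \/ e = -1 by nia.
  by apply: H1; rewrite HE e1.
by apply: HN1; rewrite HE e1 raddfN.
Qed.

Lemma free_basis_image u v : free_basis u v -> free_basis (Hstar u) (Hstar v).
Proof.
have [Hi HiK KHi] := hbij; move=> uv G x y.
have HiM : {morph Hi : g h / (g * h)%g}.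
  by move=> g h; apply: (can_inj HiK); rewrite gmulfM !KHi.
pose M : {multiplicative Gam -> Gam} := HB.pack Hi (isMultiplicative.Build _ _ Hi HiM).
have [f [fu fv fU]] := uv G x y.
pose fM : {multiplicative Gam -> G} := f \o M.
exists fM; rewrite /fM /= !HiK; split=> // f' f'u f'v g.
pose f'H : {multiplicative Gam -> G} := f' \o Hstar.
by have := fU f'H f'u f'v (Hi g); rewrite /f'H /= KHi.
Qed.

(** The image of a region is primitive, so up to conjugation and inversion it is a or a region, and
    its abelianization leaves one candidate. *)
Lemma Hstar_region : exists2 N : int, N != 0 & forall n o,
  cls (Hstar (region a b n o)) = cls (region a b (n + N) o).
Proof.
have [N [e [N0 e2 Ha Hb]]] := parabolic_shift; exists N => // n o.
have abE : ab (Hstar (region a b n o)) = e *: ab (region a b (n + N) o).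
  rewrite hinduced !(ab_region a b abM) slope_shift mulmxDr -!scalemxAr Ha Hb /=.
  by apply/colP => i; rewrite !mxE; ring.
have prim : primitive (Hstar (region a b n o)).
  have [u [v [uv nE]]] := region_primitive n o hab.
  exists (Hstar u), (Hstar v); split; first exact: free_basis_image.
  by case: nE => ->; [left|right].
have e1 : e = 1 \/ e = -1 by nia.
have abE' : ab (Hstar (region a b n o)) = ab (region a b (n + N) o) \/
    ab (Hstar (region a b n o)) = - ab (region a b (n + N) o).
  by case: e1 abE => -> ->; rewrite ?scale1r ?scaleN1r; [left|right].
case: (primitive_region hab prim) => [E|[n' [c E]]].
  exfalso; apply: (@ab_region_neq _ a b ab abM ind0 (n + N) o).
  have := ab_cls abM E; case: abE' => ->; first by [].
  by case=> [<-|/oppr_inj <-]; rewrite ?opprK; tauto.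
rewrite E; have [|-> ->] := @ab_region_inj _ a b ab abM ind0 n' c (n + N) o; last by [].
have := ab_cls abM (esym E); case: abE' => ->; rewrite ?opprK; tauto.
Qed.

End ParabolicAction.

(** * Orbits and traces *)

Lemma iter_injective (T : Type) (f : T -> T) k : injective f -> injective (iter k f).
Proof. by move=> fI; elim: k => [//|k IH] x y; rewrite !iterS => /fI/IH. Qed.

Section ParabolicOrbits.
Variables (Gam : groupType) (a b : Gam).
Variables (Hstar : {multiplicative Gam -> Gam}) (N : int).
Hypothesis hbij : bijective Hstar.
Hypothesis Hreg : forall n o,
  cls (Hstar (region a b n o)) = cls (region a b (n + N) o).

Definition region_orbit n o := orbit Hstar (cls (region a b n o)).

Let image_inj : injective (fun c : set Gam => Hstar @` c).
Proof.
have [Hi HiK _] := hbij; move=> c d cd; apply/seteqP; split=> g gc.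
  have : (Hstar @` d) (Hstar g) by rewrite -cd; exists g.
  by move=> [h hd] /(can_inj HiK) <-.
have : (Hstar @` c) (Hstar g) by rewrite cd; exists g.
by move=> [h hd] /(can_inj HiK) <-.
Qed.

Lemma iter_image_region k n o :
  iter k (fun c => Hstar @` c) (cls (region a b n o)) =
  cls (region a b (n + k%:Z * N) o).
Proof.
elim: k => [|k IH]; first by rewrite mul0r addr0.
by rewrite iterS IH image_cls// Hreg; congr (cls (region _ _ _ _)); lia.
Qed.

Lemma region_orbitP n o c :
  region_orbit n o c <-> exists k : int, c = cls (region a b (n + k * N) o).
Proof.
split=> [[k [->|E]]|[[k|k] ->]].
- by exists k; rewrite iter_image_region.
- exists (- k%:Z); apply: (@iter_injective _ _ k image_inj).
  by rewrite -E iter_image_region; congr (cls (region _ _ _ _)); lia.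
- by exists k; left; rewrite iter_image_region.
- exists k.+1; right; rewrite iter_image_region.
  by congr (cls (region _ _ _ _)); rewrite NegzE; lia.
Qed.

Variable ab : Gam -> 'cV[int]_2.
Hypothesis abM : forall g k, ab (g * k)%g = ab g + ab k.
Hypothesis ind0 : det2 (ab a) (ab b) != 0.

Lemma region_orbit_eqP n o n' o' : region_orbit n o = region_orbit n' o' <->
  o = o' /\ exists k : int, n = n' + k * N.
Proof.
split=> [E|[-> [k ->]]].
  have : region_orbit n' o' (cls (region a b n o)).
    by rewrite -E; apply/region_orbitP; exists 0; rewrite mul0r addr0.
  move=> /region_orbitP[k /(cls_region_inj abM ind0)[-> ->]].
  by split=> //; exists k.
apply/seteqP; split=> c /region_orbitP[k' ->]; apply/region_orbitP.
  by exists (k + k'); congr (cls (region _ _ _ _)); lia.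
by exists (k' - k); congr (cls (region _ _ _ _)); lia.
Qed.

Hypothesis hfix : Hstar @` cls a = cls a.

Lemma orbit_fixed : orbit Hstar (cls a) = [set cls a].
Proof.
have ik k : iter k (fun c => Hstar @` c) (cls a) = cls a.
  by elim: k => [//|k IH]; rewrite iterS IH hfix.
apply/seteqP; split=> [c [k [->|E]]|c ->] //=.
  by apply: (@iter_injective _ _ k image_inj); rewrite -E ik.
by exists 0%N; left.
Qed.

Hypothesis hab : free_basis a b.

Lemma Omega_hat_mod_region O :
  (Omega_hat_mod Hstar `\ orbit Hstar (cls a)) O <-> exists n o, O = region_orbit n o.
Proof.
split=> [[[c [g gp <-] <-]] nO|[n [c ->]]].
  case: (primitive_region hab gp) => [E|[n [c' E]]]; last by exists n, c'; rewrite /region_orbit E.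
  by exfalso; apply: nO; rewrite /= E.
split.
  exists (cls (region a b n c)) => //; exists (region a b n c) => //.
  exact: region_primitive.
rewrite /= orbit_fixed => E; have : region_orbit n c (cls (region a b n c)).
  by apply/region_orbitP; exists 0; rewrite mul0r addr0.
by rewrite E => /(cls_region_neq abM ind0).
Qed.

End ParabolicOrbits.

(** * Trace identities for determinant one *)

Section SL2Traces.
Variables (R : realType) (Gam : groupType) (rho : Gam -> 'M[R[i]]_2).
Hypothesis hrho : SL2_rep rho.
Implicit Types (g h u v : Gam).

(** The adjugate, which is the inverse when the determinant is 1. *)
Definition adj2 (M : 'M[R[i]]_2) : 'M[R[i]]_2 := (\tr M)%:M - M.

Lemma tr_ord2 (M : 'M[R[i]]_2) : \tr M = M 0 0 + M 1 1.
Proof. by rewrite /mxtrace sum_ord2. Qed.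

Lemma rho1 : rho 1%g = 1%:M.
Proof.
have [rdet rM] := hrho.
have U : rho 1%g \in unitmx by rewrite unitmxE rdet unitr1.
by rewrite -[LHS](mulmxK U) -rM mulg1 mulmxV.
Qed.

Lemma cayley_hamilton2 (M : 'M[R[i]]_2) : \det M = 1 -> M *m adj2 M = 1%:M.
Proof.
rewrite det_ord2 => dM; apply/matrixP => i j.
rewrite !mxE sum_ord2 !mxE tr_ord2 -dM.
have I2 (k : 'I_2) : k = 0 \/ k = 1.
  by case: k => [[|[|//]] Hk]; [left|right]; exact: val_inj.
by case: (I2 i) => ->; case: (I2 j) => -> /=; rewrite ?mulr1n ?mulr0n; ring.
Qed.

Lemma rhoV g : rho g^-1%g = adj2 (rho g).
Proof.
have [rdet rM] := hrho.
have U : rho g \in unitmx by rewrite unitmxE rdet unitr1.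
apply: (can_inj (mulKmx U)).
by rewrite -rM mulgV rho1 cayley_hamilton2.
Qed.

Lemma tr_rhoV g : \tr (rho g^-1%g) = \tr (rho g).
Proof. by rewrite rhoV raddfB /= mxtrace_scalar mulr2n addrK. Qed.

Lemma tr_rhoC g h : \tr (rho (g * h)%g) = \tr (rho (h * g)%g).
Proof. by have [_ rM] := hrho; rewrite !rM mxtrace_mulC. Qed.

Lemma tr_rhoJ g h : \tr (rho (h * g * h^-1)%g) = \tr (rho g).
Proof. by rewrite tr_rhoC mulgA mulVg mul1g. Qed.

Lemma tr_cls g h : cls g = cls h -> \tr (rho g) = \tr (rho h).
Proof.
move=> E; have : cls h g by rewrite -E; exact: cls_refl.
by move=> [l [] ->]; rewrite tr_rhoJ ?tr_rhoV.
Qed.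

(* Fricke: M + M^-1 is the scalar tr M. *)
Lemma tr_rhoM g h : \tr (rho (g * h)%g) =
  \tr (rho g) * \tr (rho h) - \tr (rho (g * h^-1)%g).
Proof.
have [_ rM] := hrho; rewrite !rM rhoV /adj2 mulmxBr mul_mx_scalar raddfB /=.
by rewrite mxtraceZ opprB addrCA mulrC subrr addr0.
Qed.

(** Fricke's identity. It gives the Markoff invariant of an edge the value tau + 2. *)
Lemma tr_commutator u v : tkappa (\tr (rho u), \tr (rho v), \tr (rho (u * v^-1)%g)) =
  \tr (rho (u * v * u^-1 * v^-1)%g) + 2.
Proof.
have [rdet rM] := hrho; rewrite !rM !rhoV /tkappa /=.
have := rdet u; have := rdet v; rewrite !det_ord2.
move: (rho u) (rho v) => M P.
rewrite /adj2 !tr_ord2; do 4! rewrite ?mxE ?sum_ord2; rewrite /= ?mulr1n ?mulr0n.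
move: (M 0 0) (M 0 1) (M 1 0) (M 1 1) (P 0 0) (P 0 1) (P 1 0) (P 1 1).
move=> a b c d e f g h dP dM; rewrite !sub0r.
(* The two sides agree only modulo det M = det P = 1; this is the combination of the two relations
   by which they differ as polynomials. *)
rewrite -[RHS]addr0; have <- : (a + d) ^+ 2 * (1 - (e * h - f * g)) +
    (e + h) ^+ 2 * (1 - (a * d - b * c)) +
    2 * ((a * d - b * c) * (e * h - f * g) - 1) = 0.
  by rewrite dP dM; ring.
ring.
Qed.

Lemma nielsen_commutator a b u v : nielsen a b u v ->
  \tr (rho (u * v * u^-1 * v^-1)%g) = \tr (rho (a * b * a^-1 * b^-1)%g).
Proof.
elim=> {u v} [|u v _ <-|u v _ <-|u v _ <-|u v g _ <-] //.
- rewrite -[RHS]tr_rhoV -[RHS](tr_rhoJ _ u^-1%g).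
  by rewrite !invgM !invgK !mulgA mulgVK.
- by rewrite -[RHS]tr_rhoV !invgM !invgK !mulgA.
- by rewrite invgM !mulgA mulgK.
- rewrite -[RHS](tr_rhoJ _ g) !invgM !invgK !mulgA.
  by rewrite !mulgVK.
Qed.

End SL2Traces.

(** * The function h *)

Section ComplexNorm.
Variable R : realType.
Implicit Types (x y z : R[i]).
Local Notation nc := (@Normc.normc R).

Lemma nc_ge0 x : 0 <= nc x.
Proof. by case: x => a b; exact: sqrtr_ge0. Qed.

Lemma nc0 : nc 0 = 0. Proof. exact: Normc.normc0. Qed.
Lemma nc1 : nc 1 = 1. Proof. exact: Normc.normc1. Qed.
Lemma ncM x y : nc (x * y) = nc x * nc y. Proof. exact: Normc.normcM. Qed.
Lemma ncV x : nc x^-1 = (nc x)^-1. Proof. exact: Normc.normcV. Qed.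

Lemma nc_eq0 x : (nc x == 0) = (x == 0).
Proof. by apply/eqP/eqP => [/Normc.eq0_normc|->]; rewrite ?nc0. Qed.

Lemma nc_gt0 x : (0 < nc x) = (x != 0).
Proof. by rewrite lt_neqAle nc_ge0 andbT eq_sym nc_eq0. Qed.

Lemma ncX x n : nc (x ^+ n) = nc x ^+ n.
Proof. by elim: n => [|n IH]; rewrite ?expr0 ?nc1// !exprS ncM IH. Qed.

Lemma nc_sqr x : nc x ^+ 2 = complex.Re x ^+ 2 + complex.Im x ^+ 2.
Proof. by case: x => a b /=; rewrite sqr_sqrtr// addr_ge0 ?sqr_ge0. Qed.

Lemma ncN x : nc (- x) = nc x.
Proof. by case: x => a b /=; rewrite !sqrrN. Qed.

Lemma nc_real (r : R) : nc r%:C = `|r|.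
Proof. by rewrite /= expr0n/= addr0 sqrtr_sqr. Qed.

Lemma nc_nat n : nc n%:R = n%:R.
Proof. by rewrite -[n%:R](rmorph_nat (real_complex R)) nc_real ger0_norm. Qed.

Lemma Re_nc x : `|complex.Re x| <= nc x.
Proof.
rewrite -(@ler_pXn2r _ 2)// ?nnegrE ?nc_ge0// nc_sqr real_normK ?num_real//.
by rewrite lerDl sqr_ge0.
Qed.

Lemma Im_nc x : `|complex.Im x| <= nc x.
Proof.
rewrite -(@ler_pXn2r _ 2)// ?nnegrE ?nc_ge0// nc_sqr real_normK ?num_real//.
by rewrite lerDr sqr_ge0.
Qed.

Lemma ncD x y : nc (x + y) <= nc x + nc y.
Proof. by have := ler_normD x y; rewrite !normc_def -!rmorphD/= lecR; case: x; case: y. Qed.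

Lemma ncB x y : nc (x - y) <= nc x + nc y.
Proof. by rewrite -(ncN y) ncD. Qed.

Lemma ncD_ge x y : nc x - nc y <= nc (x + y).
Proof. by have := ncB (x + y) y; rewrite addrK; lra. Qed.

Lemma ncB_ge x y : nc x - nc y <= nc (x - y).
Proof. by rewrite -(ncN y) ncD_ge. Qed.

Lemma nc_parallelogram x y :
  nc (x + y) ^+ 2 + nc (x - y) ^+ 2 = 2 * nc x ^+ 2 + 2 * nc y ^+ 2.
Proof. by rewrite !nc_sqr; case: x => a b; case: y => c d /=; ring. Qed.

End ComplexNorm.

Section SmallRoot.
Variable R : realType.
Implicit Types (x y z : R[i]).
Local Notation nc := (@Normc.normc R).

Lemma hfun_eq x : x != 0 -> x ^+ 2 * (hfun x * (1 - hfun x)) = 1.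
Proof.
move=> x0; rewrite /hfun; set r := sqrtc _.
have r2 : r ^+ 2 = 1 - 4 / x ^+ 2 by exact: sqr_sqrtc.
have n2 : (2 : R[i]) != 0 by rewrite pnatr_eq0.
have -> : 2^-1 * (1 - r) * (1 - 2^-1 * (1 - r)) = (1 - r ^+ 2) / 4 by field.
by rewrite r2; field.
Qed.

Lemma hfun_inv x : x != 0 -> hfun x * (1 - hfun x) = x ^- 2.
Proof. by move=> x0; apply: (mulfI (expf_neq0 2 x0)); rewrite hfun_eq// mulfV// expf_neq0. Qed.

Lemma Re_hfun x : 2 * complex.Re (hfun x) = 1 - complex.Re (sqrtc (1 - 4 / x ^+ 2)).
Proof.
rewrite /hfun; case: (sqrtc _) => a b.
have -> : (2^-1 : R[i]) = (2^-1)%:C by rewrite rmorphV ?unitfE ?pnatr_eq0// rmorph_nat.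
by rewrite /=; field.
Qed.

Lemma Re_sqrtc_ge0 (u : R[i]) : 0 <= complex.Re (sqrtc u).
Proof. by case: u => a b; rewrite /= sqrtr_ge0. Qed.

Lemma Re_hfun_le x : complex.Re (hfun x) <= 2^-1.
Proof. by have := Re_hfun x; have := Re_sqrtc_ge0 (1 - 4 / x ^+ 2); lra. Qed.

(** The branch of the square root puts h in the half plane Re <= 1/2, so of the two solutions h and
    1 - h of X (1 - X) = x^-2 it is the one nearer to 0. *)
Lemma nc_1Bhfun x : nc (hfun x) <= nc (1 - hfun x) /\ 2^-1 <= nc (1 - hfun x).
Proof.
have := Re_hfun_le x; case: (hfun x) => a b /= ab; split.
  by rewrite ler_sqrt ?addr_ge0 ?sqr_ge0//; nra.
apply: le_trans (Re_nc ((1 - a) +i* (0 - b))); apply: le_trans (ler_norm _).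
by rewrite /=; lra.
Qed.

Lemma nc_hfun_le x : x != 0 -> nc (hfun x) <= 2 / nc x ^+ 2.
Proof.
move=> x0; have [_ h1] := nc_1Bhfun x.
have x2 : 0 < nc x ^+ 2 by rewrite exprn_gt0 ?nc_gt0.
have := congr1 nc (hfun_eq x0); rewrite nc1 ncM ncX ncM => E.
rewrite ler_pdivlMr//; have := nc_ge0 (hfun x); nra.
Qed.

(** If |h| < 1 then |1 - h| <= 2, while |x|^2 |h| |1 - h| = 1. *)
Lemma nc_hfun_ge x (B : R) : x != 0 -> nc x <= B ->
  1 <= nc (hfun x) \/ (2 * B ^+ 2)^-1 <= nc (hfun x).
Proof.
move=> x0 xB; have x1 : 0 < nc x by rewrite nc_gt0.
have := congr1 nc (hfun_eq x0); rewrite nc1 ncM ncX ncM => E.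
have := ncB 1 (hfun x); rewrite nc1 => h1; have h0 := nc_ge0 (hfun x).
case: (leP 1 (nc (hfun x))) => h2; [by left|right].
have B0 : 0 < 2 * B ^+ 2 by nra.
rewrite -[_^-1]mul1r ler_pdivrMr//.
have : nc x ^+ 2 <= B ^+ 2 by nra.
set p := nc x ^+ 2 in E *; set q := B ^+ 2; set u := nc (hfun x) in E h1 h0 h2 *.
set v := nc (1 - _) in E h1 * => pq.
have v2 : v <= 2 by lra.
have v0 : 0 <= v by exact: nc_ge0.
have p0 : 0 <= p by rewrite exprn_ge0 ?nc_ge0.
have : p * (u * v) <= q * (u * 2).
  by apply: ler_pM => //; rewrite ?mulr_ge0// ler_wpM2l.
by rewrite E; nra.
Qed.

(* The root of larger modulus of [X^2 - x X + 1]. *)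
Definition big_root x := x * (1 - hfun x).
Definition small_root x := x * hfun x.

Lemma rootD x : big_root x + small_root x = x.
Proof. by rewrite /big_root /small_root; ring. Qed.

Lemma rootM x : x != 0 -> big_root x * small_root x = 1.
Proof. by move=> /hfun_eq <-; rewrite /big_root /small_root; ring. Qed.

Lemma nc_small_root x : x != 0 -> nc (small_root x) <= 1 /\ 1 <= nc (big_root x).
Proof.
move=> x0; have [h1 _] := nc_1Bhfun x.
have := congr1 nc (rootM x0); rewrite nc1 ncM => E.
have le : nc (small_root x) <= nc (big_root x).
  by rewrite (ncM x (hfun x)) (ncM x (1 - hfun x)); apply: ler_wpM2l; rewrite ?nc_ge0.
by have := nc_ge0 (small_root x); have := nc_ge0 (big_root x); nra.
Qed.

(** |h| = |1 - h| means Re h = 1/2, so the square root has real part 0 and 1 - 4 / x^2 <= 0. Then x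
    is real with x^2 <= 4, and only the end points remain. *)
Lemma hfun_unit x : x != 0 -> ~ in_open_m2_2 x -> nc (big_root x) = 1 ->
  x ^+ 2 = 4 /\ big_root x = small_root x.
Proof.
move=> x0 nx n1; have := congr1 nc (rootM x0); rewrite nc1 ncM n1 mul1r => n2.
have hE : nc (hfun x) = nc (1 - hfun x).
  have := n2; rewrite -[RHS]n1 (ncM x (hfun x)) (ncM x (1 - hfun x)).
  by apply: mulfI; rewrite nc_eq0.
have Re0 : complex.Re (sqrtc (1 - 4 / x ^+ 2)) = 0.
  have := Re_hfun x; have : nc (hfun x) ^+ 2 = nc (1 - hfun x) ^+ 2 by rewrite hE.
  by rewrite !nc_sqr; case: (hfun x) => a b /=; nra.
have [br _] := sqrtc_branch (1 - 4 / x ^+ 2).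
have le0 : 1 - 4 / x ^+ 2 <= 0.
  by apply: contraT => /br; rewrite Re0 ltxx.
have x2 : x ^+ 2 = 4.
  have [r r1 Er] : exists2 r : R, 1 <= r & 4 / x ^+ 2 = r%:C.
    move: le0; case: (4 / x ^+ 2) => p q; rewrite lecE /= => /andP[/eqP q0 p1].
    by exists p; [lra|apply/eqP; rewrite eq_complex /= eqxx/=; apply/eqP; lra].
  have x2E : x ^+ 2 * r%:C = 4 by rewrite -Er mulrC divfK// expf_neq0.
  case: x x0 nx x2E {n1 n2 hE Re0 br le0 Er} => p q x0 nx x2E.
  have C4 : (4 : R[i]) = 4%:C by rewrite rmorph_nat.
  have [E1 E2] : (p * p - q * q) * r = 4 /\ (p * q + q * p) * r = 0.
    by move: x2E; rewrite C4 expr2; simpc => -[].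
  have pq : p * q = 0 by nra.
  have q0 : q = 0.
    move/eqP: pq; rewrite mulf_eq0 => /orP[/eqP p0|/eqP//].
    by move: E1; rewrite p0; nra.
  have p2 : 4 <= p ^+ 2.
    rewrite leNgt; apply/negP => lt; apply: nx; exists p; rewrite ?q0//.
    by apply/andP; split; nra.
  have rE : r = 1 by rewrite q0 in E1; nra.
  rewrite C4 expr2 q0; simpc; congr (_ +i* _).
  by move: E1; rewrite rE q0; lra.
split=> //; rewrite /big_root /small_root /hfun x2 divff ?pnatr_eq0// subrr.
by rewrite sqrtc0 subr0 mulr1; congr (_ * _); field.
Qed.

End SmallRoot.

(** * Convergence on trees of traces *)

Section TreeFold.
Variables (K : comPzRingType) (V : Type).
Implicit Types (e : K * K * K).

(* [edge_fold op F m e] combines F over the edges m steps beyond e, and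
   [region_fold op idx f m e] combines f over the regions fewer than m + 1
   steps beyond e. *)
Fixpoint edge_fold (op : V -> V -> V) (F : K * K * K -> V) m e : V :=
  if m is m'.+1 then
    op (edge_fold op F m' (tstep true e)) (edge_fold op F m' (tstep false e))
  else F e.
Fixpoint region_fold (op : V -> V -> V) (idx : V) (f : K -> V) m e : V :=
  if m is m'.+1 then
    op (f (tnew e)) (op (region_fold op idx f m' (tstep true e))
                        (region_fold op idx f m' (tstep false e)))
  else idx.

Lemma edge_foldS op F m e : edge_fold op F m.+1 e =
  op (edge_fold op F m (tstep true e)) (edge_fold op F m (tstep false e)).
Proof. by []. Qed.

Lemma region_foldS op idx f m e : region_fold op idx f m.+1 e =
  op (f (tnew e)) (op (region_fold op idx f m (tstep true e))
                      (region_fold op idx f m (tstep false e))).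
Proof. by []. Qed.

Definition tswap e : K * K * K := (e.1.2, e.1.1, e.2).

Lemma tswap_step d e : tstep d (tswap e) = tswap (tstep (~~ d) e).
Proof. by case: d; case: e => [[x y] z]; rewrite /tstep /tswap /tnew /= mulrC. Qed.

Lemma tnew_swap e : tnew (tswap e) = tnew e.
Proof. by case: e => [[x y] z]; rewrite /tnew /= mulrC. Qed.

End TreeFold.

Notation edge_sum := (edge_fold +%R).
Notation region_sum := (region_fold +%R 0).

Section Convergence.
Variable R : realType.
Local Notation C := (R[i]).
Local Notation nc := (@Normc.normc R).
Implicit Types (e : C * C * C) (x y z : C) (m : nat).
Variables (c mu : C).

(* sigma is the limiting value of psi along an edge with large traces; the
   telescoped sums converge when the normalised difference err vanishes. *)
Definition psi e : C := e.2 / (e.1.1 * e.1.2).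
Definition hfac x : C := 1 + c * hfun x.
Definition sigma e : C := hfun e.1.1 + hfun e.1.2 + c * hfun e.1.1 * hfun e.1.2.
Definition err e : R := nc ((psi e - sigma e) / (hfac e.1.1 * hfac e.1.2)).

Definition vanishing (F : C * C * C -> R) (eps : R) e :=
  exists m0, forall m, (m0 <= m)%N -> edge_sum F m e <= eps.

(** The first half dominates the summands and gives absolute convergence, the second half gives the
    value of the sum. *)
Definition convergent e :=
  (exists B, forall m, region_sum (fun w => nc w ^- 2) m e <= B) /\
  (forall eps, 0 < eps -> vanishing err eps e).

Lemma hfac_sigma e : hfac e.1.1 * hfac e.1.2 = 1 + c * sigma e.
Proof. by rewrite /hfac /sigma; ring. Qed.

Lemma err_ge0 e : 0 <= err e. Proof. exact: nc_ge0. Qed.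

Lemma vanishing_step F (d1 d2 : R) e : vanishing F d1 (tstep true e) ->
  vanishing F d2 (tstep false e) -> vanishing F (d1 + d2) e.
Proof.
move=> [m1 h1] [m2 h2]; exists (maxn m1 m2).+1 => -[//|m]; rewrite ltnS geq_max.
by move=> /andP[/h1 k1 /h2 k2] /=; exact: lerD.
Qed.

Lemma convergent_step e : convergent (tstep true e) -> convergent (tstep false e) ->
  convergent e.
Proof.
move=> [[B1 h1] v1] [[B2 h2] v2]; split; last first.
  by move=> eps e0; rewrite (splitr eps); apply: vanishing_step; [apply: v1|apply: v2];
    rewrite divr_gt0.
exists (nc (tnew e) ^- 2 + (B1 + B2)) => -[|m] /=; last by rewrite !lerD.
have := h1 0%N; have := h2 0%N; rewrite /= => *.
by rewrite !addr_ge0// invr_ge0 exprn_ge0 ?nc_ge0.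
Qed.

Lemma err_swap e : err (tswap e) = err e.
Proof.
case: e => [[x y] z]; rewrite /err /psi /sigma /tswap /= [y * x]mulrC.
by rewrite [hfac y * _]mulrC [hfun y + _]addrC mulrAC.
Qed.

Lemma edge_sum_swap m e : edge_sum err m (tswap e) = edge_sum err m e.
Proof.
elim: m e => [|m IH] e; first exact: err_swap.
by rewrite !edge_foldS !tswap_step !IH addrC.
Qed.

Lemma region_sum_swap (f : C -> R) m e : region_sum f m (tswap e) = region_sum f m e.
Proof.
elim: m e => [//|m IH] e.
by rewrite !region_foldS !tswap_step !IH tnew_swap [X in _ + X]addrC.
Qed.

Lemma convergent_swap e : convergent (tswap e) -> convergent e.
Proof.
move=> [[B hB] v]; split; first by exists B => m; rewrite -region_sum_swap.
by move=> eps /v[m0 h]; exists m0 => m; rewrite -edge_sum_swap; exact: h.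
Qed.

Hypothesis t0 : 1 + c != 0.
Hypothesis mu_c : (1 + c) * mu = - c ^+ 2.

(** The Markoff equation divided by (x y)^2. *)
Lemma psi_eq e : tkappa e = mu -> e.1.1 != 0 -> e.1.2 != 0 ->
  psi e - psi e ^+ 2 = e.1.1 ^- 2 + e.1.2 ^- 2 - mu * e.1.1 ^- 2 * e.1.2 ^- 2.
Proof.
case: e => [[x y] z] <- /= x0 y0; rewrite /psi /tkappa /=; field.
by rewrite x0 y0.
Qed.

(** psi solves a quadratic equation with coefficients in h(x) and h(y), and sigma solves it up to a
    multiple of h(x) h(y); the difference of the two relations factors. *)
Lemma psi_sigma e : tkappa e = mu -> e.1.1 != 0 -> e.1.2 != 0 ->
  (psi e - sigma e) * (1 - psi e - sigma e) =
  (1 + (1 + c)^-1) * (hfun e.1.1 * hfun e.1.2) * (hfac e.1.1 * hfac e.1.2).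
Proof.
move=> ke x0 y0; have := psi_eq ke x0 y0; rewrite -!hfun_inv//.
rewrite hfac_sigma; set p := psi e; rewrite /sigma.
move: (hfun e.1.1) (hfun e.1.2) => u v E.
have muE : mu = - c ^+ 2 / (1 + c) by rewrite -mu_c mulrC mulKf.
transitivity ((p - p ^+ 2) - ((u + v + c * u * v) - (u + v + c * u * v) ^+ 2)); first by ring.
rewrite E muE; field.
by rewrite t0.
Qed.

End Convergence.

(** * Edges with large traces: exponential growth *)

Section GoodEdges.
Variable R : realType.
Local Notation C := (R[i]).
Local Notation nc := (@Normc.normc R).
Implicit Types (e : C * C * C) (x y z : C) (m : nat).
Variables (c mu : C).
Hypothesis t0 : 1 + c != 0.
Hypothesis mu_c : (1 + c) * mu = - c ^+ 2.

(** The 8 makes the weights of the two edges beyond add up to at most half the weight of the edge;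
    the summand |c| gives |c h(x)| <= 2 / |x| <= 1/4, which keeps [hfac] away from 0. *)
Definition cutoff : R := 8 + nc c.

Definition good e := [/\ cutoff <= nc e.1.1, cutoff <= nc e.1.2 &
  4 * nc e.2 <= nc e.1.1 * nc e.1.2].

Definition weight e : R := (nc e.1.1 * nc e.1.2)^-1.

Lemma cutoff_ge8 : 8 <= cutoff. Proof. by rewrite lerDl nc_ge0. Qed.

Lemma good_tnew e : good e -> 3 * (nc e.1.1 * nc e.1.2) <= 4 * nc (tnew e).
Proof.
move=> [_ _ h]; have := ncB_ge (e.1.1 * e.1.2) e.2; rewrite -/(tnew e) ncM.
lra.
Qed.

Lemma good_step d e : good e -> good (tstep d e).
Proof.
move=> g; have w := good_tnew g; case: g => h1 h2 _.
have c8 := cutoff_ge8; move: w h1 h2; rewrite /good; case: e => [[x y] z] /=.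
have := nc_ge0 x; have := nc_ge0 y; have := nc_ge0 (tnew (x, y, z)).
case: d => /=; move: (nc x) (nc y) (nc (tnew _)) => X Y W W0 Y0 X0 w h1 h2.
  have X8 : 8 <= X by lra.
  have XY8 : 8 * Y <= X * Y by rewrite ler_wpM2r.
  have XW : 8 * W <= X * W by rewrite ler_wpM2r.
  by split; lra.
have Y8 : 8 <= Y by lra.
have YX8 : 8 * X <= X * Y by rewrite mulrC ler_wpM2l.
have WY : 8 * W <= W * Y by rewrite mulrC ler_wpM2l.
by split; lra.
Qed.

Lemma weight_ge0 e : 0 <= weight e.
Proof. by rewrite invr_ge0 mulr_ge0 ?nc_ge0. Qed.

Lemma weight_step e : good e ->
  weight (tstep true e) + weight (tstep false e) <= weight e / 2.
Proof.
move=> g; have w := good_tnew g; case: g => h1 h2 _.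
have c8 := cutoff_ge8; move: w h1 h2; rewrite /weight; case: e => [[x y] z] /=.
move: (nc x) (nc y) (nc (tnew _)) => X Y W w h1 h2.
have X0 : 0 < X by lra.
have Y0 : 0 < Y by lra.
have XY0 : 0 < X * Y by rewrite mulr_gt0.
have W0 : 0 < W by lra.
have wi : W^-1 <= 4 / 3 * (X * Y)^-1.
  by rewrite -[_^-1]mul1r ler_pdivrMr// mulrAC ler_pdivlMr// mul1r; lra.
have Xi : X^-1 <= 8^-1 by rewrite lef_pV2 ?posrE//; lra.
have Yi : Y^-1 <= 8^-1 by rewrite lef_pV2 ?posrE//; lra.
rewrite (invfM X W) (invfM W Y).
have XYi : 0 < (X * Y)^-1 by rewrite invr_gt0.
have Wi0 : 0 < W^-1 by rewrite invr_gt0.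
nra.
Qed.

Lemma nc_hfac_ge x : cutoff <= nc x -> 2^-1 <= nc (hfac c x).
Proof.
move=> kx; have c8 := cutoff_ge8.
have x0 : x != 0 by rewrite -nc_gt0; lra.
have h := nc_hfun_le x0; have := ncD_ge 1 (c * hfun x).
rewrite nc1 ncM -/(hfac c x) => le; apply: le_trans le.
have x2 : 0 < nc x ^+ 2 by rewrite exprn_gt0// nc_gt0.
suff : nc c * nc (hfun x) <= 4^-1 by lra.
have cx : nc c <= nc x by apply: le_trans kx; rewrite lerDr.
have : nc c * nc (hfun x) <= nc x * (2 / nc x ^+ 2).
  by apply: ler_pM; rewrite ?nc_ge0.
move/le_trans; apply; rewrite mulrA ler_pdivrMr//; nra.
Qed.

(** In [psi_sigma] the factor 1 - psi - sigma has modulus at least 1/2 on a good edge, and |h(x)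
    h(y)| is at most the weight. *)
Lemma err_good e : tkappa e = mu -> good e ->
  err c e <= 2 * nc (1 + (1 + c)^-1) * weight e.
Proof.
move=> ke [h1 h2 h3]; have c8 := cutoff_ge8.
have x0 : e.1.1 != 0 by rewrite -nc_gt0; lra.
have y0 : e.1.2 != 0 by rewrite -nc_gt0; lra.
(* Where the denominator vanishes [err] is 0 by the convention for division. *)
have [HH0|HH0] := eqVneq (hfac c e.1.1 * hfac c e.1.2) 0.
  by rewrite /err HH0 invr0 mulr0 nc0 !mulr_ge0 ?nc_ge0 ?weight_ge0.
have := psi_sigma t0 mu_c ke x0 y0; set H := _ * hfac _ _ in HH0 *.
move=> /(congr1 (fun u => nc (u / H))); rewrite mulfK// mulrAC ncM -/(err c e).
rewrite 2!ncM; have hx := nc_hfun_le x0; have hy := nc_hfun_le y0.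
set s := 1 - psi e - sigma c e.
have [X0 Y0] : 0 < nc e.1.1 /\ 0 < nc e.1.2 by rewrite !nc_gt0.
have wE : weight e = (nc e.1.1)^-1 * (nc e.1.2)^-1 by rewrite /weight invfM.
have Xi : (nc e.1.1)^-1 <= 8^-1 by rewrite lef_pV2 ?posrE//; lra.
have Yi : (nc e.1.2)^-1 <= 8^-1 by rewrite lef_pV2 ?posrE//; lra.
have Xi0 : 0 < (nc e.1.1)^-1 by rewrite invr_gt0.
have Yi0 : 0 < (nc e.1.2)^-1 by rewrite invr_gt0.
have cX : nc c * (nc e.1.1)^-1 <= 1.
  by rewrite ler_pdivrMr// mul1r; apply: le_trans h1; rewrite lerDr.
have ps : nc (psi e) <= 4^-1.
  rewrite /psi ncM ncV ncM ler_pdivrMr ?mulr_gt0//; lra.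
rewrite -!exprVn in hx hy; move: hx hy ps.
have cc0 := nc_ge0 c; have u0 := nc_ge0 (hfun e.1.1); have v0 := nc_ge0 (hfun e.1.2).
have sl : 1 - nc (psi e) - (nc (hfun e.1.1) + nc (hfun e.1.2) +
    nc c * nc (hfun e.1.1) * nc (hfun e.1.2)) <= nc s.
  have := ncB_ge (1 - psi e) (sigma c e); have := ncB_ge 1 (psi e); rewrite nc1.
  have := ncD (hfun e.1.1 + hfun e.1.2) (c * hfun e.1.1 * hfun e.1.2).
  have := ncD (hfun e.1.1) (hfun e.1.2); rewrite -/(sigma c e) 2!ncM -/s; lra.
move: sl cX Xi Yi Xi0 Yi0; rewrite wE.
move: (nc (hfun e.1.1)) (nc (hfun e.1.2)) u0 v0 => u v u0 v0.
move: (nc (psi e)) (nc s) (nc c) cc0 (nc e.1.1)^-1 (nc e.1.2)^-1 => p S k k0 a b.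
have T0 := nc_ge0 (1 + (1 + c)^-1); move: (nc (1 + _)) T0 => T T0.
have := err_ge0 c e; move: (err c e) => E E0 sl ka a8 b8 a0 b0 ua vb p4 EE.
have uv : u * v <= a * b.
  have : u * v <= (2 * a ^+ 2) * (2 * b ^+ 2) by apply: ler_pM.
  move/le_trans; apply.
  have ab : 0 < a * b by rewrite mulr_gt0.
  have : a * b <= 64^-1 by nra.
  by move=> ?; nra.
have u1 : u <= 32^-1 by nra.
have v1 : v <= 32^-1 by nra.
have kuv : k * u * v <= 8^-1.
  have : k * u <= 4^-1.
    have : k * u <= k * (2 * a ^+ 2) by rewrite ler_wpM2l.
    by move/le_trans; apply; rewrite expr2; nra.
  by move=> ku; have : 0 <= k * u by [rewrite mulr_ge0]; nra.
have S2 : 2^-1 <= S by lra.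
have : T * (u * v) <= T * (a * b) by rewrite ler_wpM2l.
nra.
Qed.

Lemma good_edge_sum m e : tkappa e = mu -> good e ->
  edge_sum (err c) m e <= 2 * nc (1 + (1 + c)^-1) * weight e * 2^-1 ^+ m.
Proof.
elim: m e => [|m IH] e ke g; first by rewrite expr0 mulr1; exact: err_good.
rewrite edge_foldS.
have := IH _ (etrans (tkappa_step true e) ke) (good_step true g).
have := IH _ (etrans (tkappa_step false e) ke) (good_step false g).
have := weight_step g; rewrite exprS.
have q0 : 0 <= 2^-1 ^+ m :> R by rewrite exprn_ge0// invr_ge0.
have T0 := nc_ge0 (1 + (1 + c)^-1).
move: (edge_sum _ _ (tstep true e)) (edge_sum _ _ (tstep false e)).
move: (weight (tstep true e)) (weight (tstep false e)) => w1 w2 A B ww le1 le2.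
have : 2 * nc (1 + (1 + c)^-1) * 2^-1 ^+ m * (w1 + w2) <=
    2 * nc (1 + (1 + c)^-1) * 2^-1 ^+ m * (weight e / 2).
  by apply: ler_wpM2l ww; rewrite !mulr_ge0.
lra.
Qed.

Lemma good_region_sum m e : good e ->
  region_sum (fun w => nc w ^- 2) m e <= 2 * weight e.
Proof.
elim: m e => [|m IH] e g; first by apply: mulr_ge0 => //; exact: weight_ge0.
rewrite region_foldS; have := weight_step g.
have := IH _ (good_step true g); have := IH _ (good_step false g).
suff : nc (tnew e) ^- 2 <= weight e by lra.
have := good_tnew g; have := cutoff_ge8; case: g => h1 h2 _ c8.
rewrite /weight; move: (nc (tnew e)) h1 h2; move: (nc e.1.1) (nc e.1.2) => X Y W h1 h2 w.
have XY : 64 <= X * Y by nra.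
by rewrite lef_pV2 ?posrE; nra.
Qed.

Lemma convergent_good e : tkappa e = mu -> good e -> convergent c e.
Proof.
move=> ke g; split; first by exists (2 * weight e) => m; exact: good_region_sum.
move=> eps e0; set B := 2 * nc (1 + (1 + c)^-1) * weight e.
have B0 : 0 <= B by rewrite !mulr_ge0 ?nc_ge0 ?weight_ge0.
exists (Num.truncn (B / eps)).+1 => m hm; apply: le_trans (good_edge_sum m ke g) _.
rewrite -/B exprVn ler_pdivrMr ?exprn_gt0// mulrC -ler_pdivrMr//.
apply: le_trans (_ : m%:R <= _); last first.
  by rewrite -natrX ler_nat ltnW// ltn_expl.
apply: le_trans (_ : (Num.truncn (B / eps)).+1%:R <= _); last by rewrite ler_nat.
by apply/ltW; rewrite truncnS_gt.
Qed.

End GoodEdges.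

(** * Traces around a single region *)

Section FanGrowth.
Variable R : realType.
Local Notation C := (R[i]).
Local Notation nc := (@Normc.normc R).
Variables (e : C * C * C).
Local Notation x := (e.1.1).
Hypothesis x0 : x != 0.
Hypothesis xnot : ~ in_open_m2_2 x.
Hypothesis kappa4 : tkappa e != 4.
Local Notation fan_edge n := (iter n (tstep true) e).
Hypothesis fan2 : forall n, 2 < nc (fan_edge n).1.2.

Let f n := fan_edge n.
Let lam := big_root x.
Let lami := small_root x.
(** U and V are the components of the recursion y'' = x y' - y along its two eigenvectors: a step
    multiplies U by [lam] and V by [lami]. *)
Let U n := (f n).1.2 - lami * (f n).2.
Let V n := (f n).1.2 - lam * (f n).2.

Lemma fan_pivot n : (fan_edge n).1.1 = x.
Proof. by elim: n => [//|n IH]; rewrite iterS /= IH. Qed.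

Let lamM : lam * lami = 1. Proof. exact: rootM. Qed.
Let lamD : x = lam + lami. Proof. by rewrite /lam /lami rootD. Qed.

Let fS n : f n.+1 = (x, x * (f n).1.2 - (f n).2, (f n).1.2).
Proof. by rewrite /f iterS /tstep /tnew fan_pivot. Qed.

Let US n : U n.+1 = lam * U n.
Proof.
rewrite /U fS /= mulrBr mulrA lamM mul1r {1}lamD.
by ring.
Qed.

Let VS n : V n.+1 = lami * V n.
Proof.
rewrite /V fS /= mulrBr mulrA [lami * lam]mulrC lamM mul1r {1}lamD.
by ring.
Qed.

Let UE n : U n = lam ^+ n * U 0%N.
Proof. by elim: n => [|n IH]; rewrite ?expr0 ?mul1r// US IH exprS mulrA. Qed.

Let nclami : nc lami <= 1. Proof. by have [] := nc_small_root x0. Qed.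
Let nclam : 1 <= nc lam. Proof. by have [] := nc_small_root x0. Qed.

Let ncV0 n : nc (V n) <= nc (V 0%N).
Proof.
elim: n => [//|n IH]; rewrite VS ncM; apply: le_trans IH.
by rewrite ler_piMl ?nc_ge0.
Qed.

Let bernoulli (r : R) n : 1 <= r -> 1 + n%:R * (r - 1) <= r ^+ n.
Proof.
move=> r1; elim: n => [|n IH]; first by rewrite mul0r addr0 expr0.
have n0 : 0 <= n%:R :> R by [].
rewrite exprS; apply: le_trans (_ : r * (1 + n%:R * (r - 1)) <= _); last first.
  by rewrite ler_wpM2l//; lra.
by rewrite -addn1 natrD; have : 0 <= n%:R * (r - 1) * (r - 1) by [rewrite !mulr_ge0 ?subr_ge0]; lra.
Qed.

Let small_pow (r s : R) : 0 <= r < 1 -> exists n, r ^+ n * s < 1.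
Proof.
move=> /andP[r0 r1]; have [s0|s0] := leP s 0.
  by exists 0%N; rewrite expr0 mul1r; lra.
have [->|rn] := eqVneq r 0; first by exists 1%N; rewrite expr1 mul0r.
have rp : 0 < r by rewrite lt_neqAle eq_sym rn.
have ri : 1 <= r^-1 by rewrite invf_ge1// ltW.
have d0 : 0 < r^-1 - 1 by rewrite subr_gt0 invf_gt1.
exists (Num.truncn (s / (r^-1 - 1))).+1; set n := _.+1.
have : s / (r^-1 - 1) < n%:R by exact: truncnS_gt.
rewrite ltr_pdivrMr// => sn; have := bernoulli n ri; rewrite exprVn => le.
have rn0 : 0 < r ^+ n by rewrite exprn_gt0.
rewrite -ltr_pdivlMl// mulr1; lra.
Qed.

(* The forward neighbours of the pivot grow at least linearly; the extreme
   case x = 2, -2 is where kappa /= 4 is needed. *)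
Lemma fan_growth : exists2 k : R, 0 < k &
  exists n0, forall n, (n0 <= n)%N -> k * n%:R <= nc (fan_edge n).1.2.
Proof.
have lin (p q D : R) : 0 < p -> 0 < D -> (forall n, p * n%:R - q <= D * nc (f n).1.2) ->
    exists2 k : R, 0 < k & exists n0, forall n, (n0 <= n)%N -> k * n%:R <= nc (f n).1.2.
  move=> p0 D0 h; exists (p / (2 * D)); first by rewrite divr_gt0// mulr_gt0.
  exists (Num.truncn (2 * q / p)).+1 => n hn.
  have : 2 * q / p < n%:R.
    by apply: lt_le_trans (truncnS_gt _) _; rewrite ler_nat.
  rewrite ltr_pdivrMr// => qn; have := h n.
  rewrite mulrAC ler_pdivrMr ?mulr_gt0//; lra.
have [l1|l1] := eqVneq (nc lam) 1.
  have [x4 ll] := hfun_unit x0 xnot l1; rewrite -/lam -/lami in ll.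
  have lam2 : lam * lam = 1 by rewrite {2}ll lamM.
  have U0 : U 0%N != 0.
    apply: contra kappa4 => /eqP U0; apply/eqP.
    have : tkappa e = 4 + U 0%N ^+ 2.
      have -> : tkappa e = x ^+ 2 + e.1.2 ^+ 2 + lam * lam * e.2 ^+ 2 -
          (lam + lam) * e.1.2 * e.2 by rewrite lam2 {2}ll -lamD /tkappa mul1r.
      by rewrite x4 /U /f /= -ll; ring.
    by rewrite U0 expr0n addr0.
  apply: (lin (nc (U 0%N)) (nc (f 0%N).1.2) 1); rewrite ?nc_gt0// => n.
  (* Here [lam] is a double root of the recursion, hence the linear factor. *)
  have -> : (f n).1.2 = lam ^+ n * ((f 0%N).1.2 + n%:R * U 0%N).
    elim: n => [|n IH]; first by rewrite expr0 mul1r mul0r addr0.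
    have := UE n.+1; rewrite {1}/U -ll fS [X in X = _ -> _]/= => /eqP.
    rewrite subr_eq => /eqP E1; rewrite /= E1 IH -addn1 natrD exprD expr1.
    by ring.
  rewrite mul1r ncM ncX l1 expr1n mul1r.
  have := ncD_ge (n%:R * U 0%N) (f 0%N).1.2.
  by rewrite [n%:R * _ + _]addrC ncM nc_nat [n%:R * nc _]mulrC.
have l1' : 1 < nc lam by rewrite lt_neqAle eq_sym l1.
(* Without the growing component the neighbours would decay geometrically and fall below 2. *)
have U0 : U 0%N != 0.
  apply/eqP => U0; have yE n : (f n.+1).1.2 = lami ^+ n.+1 * (f 0%N).1.2.
    elim: n => [|n IH].
      have := UE 1%N; rewrite U0 mulr0 => /eqP; rewrite subr_eq0 fS [X in _ * X]/= => /eqP ->.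
      by rewrite expr1.
    have := UE n.+2; rewrite U0 mulr0 => /eqP; rewrite subr_eq0 fS [X in _ * X]/= => /eqP ->.
    by rewrite IH [in RHS]exprS mulrA.
  have ll1 : 0 <= nc lami < 1.
    rewrite nc_ge0 /=; have := congr1 nc lamM; rewrite nc1 ncM => E.
    by have := nc_ge0 lami; nra.
  have [n hn] := small_pow (nc (f 0%N).1.2) ll1.
  have := fan2 n; rewrite -/(f n); case: n hn => [|n].
    by rewrite expr0 mul1r => h1 h2; lra.
  by rewrite yE ncM ncX => h1 h2; lra.
apply: (lin ((nc lam - 1) * nc (U 0%N)) (nc (V 0%N)) (nc (lam - lami))).
- by rewrite mulr_gt0 ?subr_gt0// nc_gt0.
- rewrite nc_gt0 subr_eq0; apply: contra l1 => /eqP E.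
  have := congr1 nc lamM; rewrite nc1 -E ncM => E1.
  by apply/eqP; have := nc_ge0 lam; nra.
move=> n; have E : (lam - lami) * (f n).1.2 = lam * U n - lami * V n.
  by rewrite /U /V; ring.
rewrite -ncM E; apply: le_trans (ncB_ge _ _).
have -> : nc (lam * U n) = nc lam ^+ n.+1 * nc (U 0%N).
  by rewrite -US UE ncM ncX.
have := bernoulli n.+1 nclam; rewrite -addn1 natrD => b.
have := ncV0 n; have u0 := nc_ge0 (U 0%N); rewrite ncM => v.
have : nc lami * nc (V n) <= nc (V 0%N).
  by apply: le_trans v; rewrite ler_piMl ?nc_ge0.
have : (1 + (n%:R + 1) * (nc lam - 1)) * nc (U 0%N) <= nc lam ^+ (n + 1) * nc (U 0%N).
  by rewrite ler_wpM2r.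
have : 0 <= (nc lam - 1) * nc (U 0%N) by rewrite mulr_ge0 ?subr_ge0.
lra.
Qed.

(** Up to sign the difference of psi and h(x) is [lami] V / (x y), and V does not grow. *)
Lemma fan_psi : exists B, forall n,
  nc (psi (fan_edge n) - hfun x) * nc (fan_edge n).1.2 <= B.
Proof.
exists (nc (V 0%N) / nc x) => m.
have y0 : (f m).1.2 != 0 by rewrite -nc_gt0; apply: lt_trans (fan2 m).
have -> : psi (fan_edge m) - hfun x = - (lami * V m) / (x * (f m).1.2).
  have hE : hfun x = lami / x by rewrite /lami /small_root mulrAC mulfV ?mul1r.
  have -> : lami * V m = lami * (f m).1.2 - lam * lami * (f m).2 by rewrite /V; ring.
  rewrite /psi fan_pivot hE -/(f m) lamM; field.
  by rewrite x0 y0.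
have nX : nc x != 0 by rewrite nc_eq0.
have nY : nc (f m).1.2 != 0 by rewrite nc_eq0.
rewrite ncM ncN ncV (ncM lami) (ncM x) -/(f m).
have -> : nc lami * nc (V m) / (nc x * nc (f m).1.2) * nc (f m).1.2 =
    nc lami * nc (V m) / nc x by field; rewrite nX nY.
rewrite ler_wpM2r ?invr_ge0 ?nc_ge0//; apply: le_trans (ncV0 m).
by rewrite ler_piMl ?nc_ge0.
Qed.

End FanGrowth.

Section FanConvergence.
Variable R : realType.
Local Notation C := (R[i]).
Local Notation nc := (@Normc.normc R).
Variables (c mu : C).
Hypothesis t0 : 1 + c != 0.
Hypothesis mu_c : (1 + c) * mu = - c ^+ 2.
Variables (e : C * C * C).
Local Notation x := (e.1.1).
Hypothesis x0 : x != 0.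
Hypothesis xnot : ~ in_open_m2_2 x.
Hypothesis ke : tkappa e = mu.
Hypothesis mu4 : mu != 4.
Local Notation fan_edge n := (iter n (tstep true) e).
Hypothesis fan2 : forall n, 2 < nc (fan_edge n).1.2.
Let y n := nc (fan_edge n).1.2.

Let eventually_ge (k B : R) n0 : 0 < k -> (forall n, (n0 <= n)%N -> k * n%:R <= y n) ->
  exists n1, (n0 <= n1)%N /\ forall n, (n1 <= n)%N -> B <= y n.
Proof.
move=> k0 h; exists (n0 + (Num.truncn (B / k)).+1)%N; split; first exact: leq_addr.
move=> n hn; apply: le_trans (h n (leq_trans (leq_addr _ _) hn)).
rewrite mulrC -ler_pdivrMr//; apply: le_trans (ltW (truncnS_gt _)) _.
by rewrite ler_nat (leq_trans (leq_addl _ _) hn).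
Qed.

Let fan_false n : tstep false (fan_edge n) =
  ((fan_edge n.+1).1.2, (fan_edge n).1.2, x).
Proof. by rewrite iterS /tstep /= fan_pivot. Qed.

Let kappa_fan n : tkappa (fan_edge n) = mu.
Proof. by elim: n => [//|n IH]; rewrite iterS tkappa_step. Qed.

(** From some edge on, the trees branching off the fan start with good edges, of weight O(n^-2), and
    the fan edge that remains has an error O(1/n). *)
Lemma fan_convergent : exists n, convergent c (fan_edge n).
Proof.
have k4 : tkappa e != 4 by rewrite ke.
have [k k0 [n0 grow]] := fan_growth x0 xnot k4 fan2.
have [B psiB] := fan_psi x0 fan2.
(* The term 4 |x| serves the last condition of [good]: x is the trace behind the edges that branch
   off. *)
have [n1 [n01 big]] := eventually_ge (cutoff c + 4 * nc x + 1) k0 grow.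
have c8 := cutoff_ge8 c; have X0 := nc_ge0 x.
have goodn n : (n1 <= n)%N -> good c (tstep false (fan_edge n)).
  move=> hn; have := big n hn; have := big n.+1 (leqW hn); rewrite /y => b1 b2.
  rewrite fan_false; split=> /=; [lra|lra|].
  by rewrite -[4 * _]mulr1; apply: ler_pM; rewrite ?mulr_ge0//; lra.
(* If [hfac c x] is 0 then both the error and E are 0, so the bound by E / y holds in that case
   too. *)
pose h := nc (hfac c x); pose E := (B + 2 * h) * (h^-1 * 2).
have h0 : 0 <= h by exact: nc_ge0.
have B0 : 0 <= B by apply: le_trans (psiB 0%N); rewrite mulr_ge0 ?nc_ge0.
have E0 : 0 <= E by rewrite /E !mulr_ge0 ?invr_ge0 ?addr_ge0 ?mulr_ge0.
have errn n : (n1 <= n)%N -> err c (fan_edge n) <= E / y n.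
  move=> hn; have bn := big n hn; have y1 : 1 <= y n by lra.
  have yp : 0 < y n by lra.
  have yn0 : (fan_edge n).1.2 != 0 by rewrite -nc_gt0.
  rewrite /err fan_pivot.
  have -> : psi (fan_edge n) - sigma c (fan_edge n) = (psi (fan_edge n) - hfun x) -
      hfun (fan_edge n).1.2 * hfac c x by rewrite /sigma /hfac fan_pivot; ring.
  have -> : E / y n = (B + 2 * h) / y n * (h^-1 * 2) by rewrite /E mulrAC.
  rewrite ncM ncV (ncM (hfac c x)) invfM; apply: ler_pM; rewrite ?mulr_ge0 ?invr_ge0 ?nc_ge0//.
    apply: le_trans (ncB _ _) _; rewrite (mulrDl B); apply: lerD.
      by rewrite ler_pdivlMr//; exact: psiB.
    rewrite (ncM (hfun _)) -/h mulrAC ler_wpM2r//; apply: le_trans (nc_hfun_le yn0) _.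
    rewrite ler_pM2l// lef_pV2 ?posrE ?exprn_gt0//.
    by rewrite -/(y n) expr2 ler_peMl// ltW.
  rewrite -/h ler_wpM2l ?invr_ge0//.
  have hf : 2^-1 <= nc (hfac c (fan_edge n).1.2) by apply: nc_hfac_ge; rewrite -/(y n); lra.
  by rewrite -[leRHS]invrK lef_pV2 ?posrE//; lra.
pose n2 := maxn n1 2; exists n2.
have n2n n : (n2 <= n)%N -> (n1 <= n)%N by rewrite geq_max => /andP[].
split.
  (* 3 = 1 + 2: the next region contributes at most 1 / (k (n + 1))^2 and the tree branching off at
     most 2 / (k^2 n (n + 1)), which 3 / (k^2 n (n - 1)) majorizes; the latter telescopes. The n - 1
     is why [n2] is at least 2. *)
  exists (3 / k ^+ 2 * ((n2%:R - 1)^-1)) => m.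
  have : (n2 <= n2)%N by []; move: {2 3 4}n2.
  elim: m => [|m IH] n hn.
    rewrite /= mulr_ge0 ?invr_ge0 ?divr_ge0 ?exprn_ge0 ?(ltW k0)// subr_ge0 ler1n.
    by move: hn; rewrite geq_max => /andP[_]; case: n.
  have hn1 := n2n n hn; rewrite region_foldS.
  have n2' : (2 <= n)%N by move: hn; rewrite geq_max => /andP[].
  have nR : 2 <= n%:R :> R by rewrite ler_nat.
  have nR1 : n.+1%:R = n%:R + 1 :> R by rewrite -addn1 natrD.
  have := IH n.+1 (leqW hn); rewrite nR1 addrK => IH1.
  have := good_region_sum m (goodn n hn1); rewrite {2}fan_false /weight => G1.
  have g0 := grow n (leq_trans n01 hn1); have g1 := grow n.+1 (leqW (leq_trans n01 hn1)).
  have -> : tnew (fan_edge n) = (fan_edge n.+1).1.2 by rewrite iterS.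
  rewrite nR1 in g1; move: IH1 G1 g0 g1; rewrite -/(y n) -/(y n.+1).
  have bn := big n hn1; have bn1 := big n.+1 (leqW hn1).
  move: (region_sum _ _ _) (region_sum _ _ _) n%:R nR (y n) (y n.+1) bn bn1.
  move=> r1 r2 q q2 u v bu bv H1 H2 qu qv.
  have kq : 0 < k * q by rewrite mulr_gt0//; lra.
  have kq1 : 0 < k * (q + 1) by rewrite mulr_gt0//; lra.
  have v0 : 0 < v by lra.
  have u0 : 0 < u by lra.
  have vi : v ^- 2 <= (k * (q + 1)) ^- 2.
    by rewrite lef_pV2 ?posrE ?exprn_gt0//; apply: lerXn2r; rewrite ?nnegrE; lra.
  have uvi : (v * u)^-1 <= ((k * (q + 1)) * (k * q))^-1.
    by rewrite lef_pV2 ?posrE; [apply: ler_pM; lra|rewrite mulr_gt0|rewrite mulr_gt0].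
  have key : (k * (q + 1)) ^- 2 + (3 / k ^+ 2 * q^-1 + 2 * ((k * (q + 1)) * (k * q))^-1) <=
      3 / k ^+ 2 * (q - 1)^-1.
    rewrite -subr_ge0.
    have -> : 3 / k ^+ 2 * (q - 1)^-1 - ((k * (q + 1)) ^- 2 + (3 / k ^+ 2 * q^-1 +
       2 * ((k * (q + 1)) * (k * q))^-1)) = (7 * q + 5) / (k ^+ 2 * (q - 1) * q * (q + 1) ^+ 2).
      field; rewrite ?gt_eqF//; lra.
    have num0 : 0 <= 7 * q + 5 by lra.
    apply: (divr_ge0 num0); apply: mulr_ge0; last by apply: exprn_ge0; lra.
    apply: mulr_ge0; last by lra.
    by apply: mulr_ge0; [apply: exprn_ge0; lra|lra].
  by rewrite /= in H2 *; lra.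
move=> eps eps0; pose T := 2 * nc (1 + (1 + c)^-1).
have T0 : 0 <= T by rewrite /T mulr_ge0 ?nc_ge0.
have [n3 [n03 big3]] := eventually_ge (6 * (E + T) / eps) k0 grow.
pose n4 := maxn n2 n3; pose d := eps / 6.
have d0 : 0 < d by rewrite divr_gt0.
have small n : (n4 <= n)%N -> (E + T) / y n <= d.
  rewrite geq_max => /andP[hn2 hn3]; have yp : 0 < y n by have := big n (n2n n hn2); lra.
  have := big3 n hn3; rewrite ler_pdivrMr// ler_pdivrMr// /d; lra.
(* At depth m the fan edge costs d and the trees passed on the way cost at most d / 2^j for j < m:
   in all d (1 + 2 (1 - 2^-m)). *)
have fanm m n : (n4 <= n)%N -> edge_sum (err c) m (fan_edge n) <= d * (3 - 2 * 2^-1 ^+ m).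
  elim: m n => [|m IH] n hn.
    have hn1 : (n1 <= n)%N by apply/n2n/(leq_trans _ hn)/leq_maxl.
    have yp : 0 < y n by have := big n hn1; lra.
    have := errn n hn1; have := small n hn; rewrite mulrDl expr0.
    have : 0 <= T / y n by rewrite divr_ge0// ltW.
    by rewrite /=; lra.
  have hn1 : (n1 <= n)%N by apply/n2n/(leq_trans _ hn)/leq_maxl.
  have yp : 1 <= y n by have := big n hn1; lra.
  have yp1 : 1 <= y n.+1 by have := big n.+1 (leqW hn1); lra.
  have := IH n.+1 (leqW hn); rewrite edge_foldS.
  have kg : tkappa (tstep false (fan_edge n)) = mu by rewrite tkappa_step kappa_fan.
  have := good_edge_sum t0 mu_c m kg (goodn n hn1); rewrite -/T {2}fan_false /weight /=.
  rewrite -/(y n) -/(y n.+1) => G I.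
  have q0 : 0 <= 2^-1 ^+ m :> R by rewrite exprn_ge0.
  have le : T * (y n.+1 * y n)^-1 <= d.
    apply: le_trans (small n hn); rewrite mulrDl ler_wpDl ?divr_ge0//; first lra.
    by rewrite ler_wpM2l// lef_pV2 ?posrE ?mulr_gt0//; nra.
  have : T * (y n.+1 * y n)^-1 * 2^-1 ^+ m <= d * 2^-1 ^+ m by rewrite ler_wpM2r.
  by rewrite exprS; lra.
have P4 : vanishing (err c) (3 * d) (fan_edge n4).
  exists 0%N => m _; apply: le_trans (fanm m n4 (leqnn _)) _.
  have q0 : 0 <= 2^-1 ^+ m :> R by rewrite exprn_ge0.
  by have := mulr_ge0 (ltW d0) q0; lra.
(* The edge [n4] depends on eps, the edge [n2] must not. Going back from one to the other adds
   finitely many good trees, whose errors vanish. *)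
suff down j : forall dl, 0 < dl -> (n2 <= n4 - j)%N ->
    vanishing (err c) (3 * d + dl) (fan_edge (n4 - j)).
  have := down (n4 - n2)%N (3 * d); rewrite subKn ?leq_maxl// => /(_ _ (leqnn _)).
  by have -> : 3 * d + 3 * d = eps by [rewrite /d; lra]; apply; lra.
elim: j => [|j IH] dl dl0.
  rewrite subn0 => _; have [m0 hm] := P4; exists m0 => m /hm; lra.
move=> hj; have E1 : (n4 - j = (n4 - j.+1).+1)%N.
  have n20 : (0 < n2)%N by apply: leq_trans (leq_maxr n1 2).
  by rewrite subnSK// ltnW// -subn_gt0; apply: leq_trans hj.
rewrite E1 in IH; have {}IH := IH (dl / 2) ltac:(lra) (leqW hj).
have [_ gv] : convergent c (tstep false (fan_edge (n4 - j.+1))).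
  apply: (convergent_good t0 mu_c); first by rewrite tkappa_step kappa_fan.
  by apply: goodn; exact: n2n.
have := vanishing_step IH (gv (dl / 2) ltac:(lra)).
by have -> : 3 * d + dl / 2 + dl / 2 = 3 * d + dl by lra.
Qed.

End FanConvergence.

(** * Comparison of the traces before and behind an edge *)

Section DecreasingPaths.
Variable R : realType.
Local Notation C := (R[i]).
Local Notation nc := (@Normc.normc R).
Implicit Types (e : C * C * C).

(** From x y = w + z follows |x y| <= 2 |w|; as |x| > 2 this gives |x w| >= 2 |y|, so the next trace
    x w - y is at least as large as y. The other direction is symmetric. *)
Lemma inward_step d e : 2 < nc e.1.1 -> 2 < nc e.1.2 -> nc e.2 <= nc (tnew e) ->
  nc (tstep d e).2 <= nc (tnew (tstep d e)).
Proof.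
move=> X2 Y2 ZW.
have XY : nc e.1.1 * nc e.1.2 <= 2 * nc (tnew e).
  by have := ncD (tnew e) e.2; rewrite /tnew subrK ncM -/(tnew e); lra.
have key (X Y W : R) : 2 < X -> 2 < Y -> X * Y <= 2 * W -> 2 * Y <= X * W.
  move=> a2 b2 h; have : X * (X * Y) <= X * (2 * W) by rewrite ler_wpM2l//; lra.
  have : 2 * Y <= X * Y by rewrite ler_wpM2r//; lra.
  have : 2 * (X * Y) <= X * (X * Y) by rewrite ler_wpM2r ?mulr_ge0//; lra.
  lra.
case: d; rewrite [tnew (tstep _ e)]/tnew /=.
  have := ncB_ge (e.1.1 * tnew e) e.1.2; rewrite ncM.
  by have := key _ _ _ X2 Y2 XY; lra.
have := ncB_ge (tnew e * e.1.2) e.1.1; rewrite ncM.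
by rewrite mulrC in XY; have := key _ _ _ Y2 X2 XY; rewrite [nc e.1.2 * _]mulrC; lra.
Qed.

(* Three consecutive small decrements around a change of pivot force all three
   traces close to 2 in modulus, and kappa close to 4. *)
Lemma switch_kappa e (T h eps : R) :
  let w := tnew e in let w1 := tnew (tstep true e) in
  let w2 := tnew (tstep false (tstep true e)) in
  0 < h <= 1 -> 8 * T * eps <= h ^+ 2 -> 0 <= eps ->
  2 < nc e.1.1 <= T -> 2 < nc e.1.2 <= T -> 2 < nc w <= T ->
  nc w <= nc e.2 <= nc w + eps -> nc w1 <= nc e.1.2 <= nc w1 + eps ->
  nc w2 <= nc e.1.1 <= nc w2 + eps ->
  nc (tkappa e - 4) <= h * (((T + 2) / 2) * (1 + T ^+ 2 / 4) + 1).
Proof.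
case: e => [[x y] z] w w1 w2 /= /andP[h0 h1] hT eps0 /andP[X2 XT] /andP[Y2 YT] /andP[W2 WT].
move=> /andP[Wz zW] /andP[W1y yW1] /andP[W2x xW2].
have wE : w = x * y - z by [].
have w1E : w1 = x * w - y by [].
have w2E : w2 = w1 * w - x by [].
have kE : tkappa (x, y, z) = x ^+ 2 + y ^+ 2 + w ^+ 2 - x * y * w.
  by rewrite /tkappa /= wE; ring.
rewrite kE; clearbody w w1 w2.
set h1' := y - w1; set h2' := x - w2.
have eps1 : eps <= 1.
  have : 2 * eps <= T * eps by rewrite ler_wpM2r//; lra.
  have : h ^+ 2 <= 1 by rewrite exprn_ile1// ltW.
  lra.
(* By the parallelogram law |y - w1|^2 = 2 |y|^2 + 2 |w1|^2 - |y + w1|^2, and y + w1 = x w has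
   modulus at least 2 |y| - eps: two numbers of nearly equal size whose sum is nearly as long as
   possible are close. *)
have key (X Y W W1 H : R) : 2 < X -> 2 < Y <= T -> 2 < W -> 0 <= W1 <= Y ->
    X * Y <= 2 * W + eps -> H ^+ 2 = 2 * Y ^+ 2 + 2 * W1 ^+ 2 - (X * W) ^+ 2 ->
    H ^+ 2 <= 8 * T * eps.
  move=> Xa /andP[Ya Yb] Wa /andP[W10 W1Y] XY ->.
  have XY2 : 2 * Y <= X * Y by rewrite ler_wpM2r//; lra.
  have XW2 : 2 * W <= X * W by rewrite ler_wpM2r//; lra.
  have sq : (2 * Y - eps) ^+ 2 <= (X * W) ^+ 2.
    by apply: lerXn2r; rewrite ?nnegrE; lra.
  have sq1 : W1 ^+ 2 <= Y ^+ 2 by apply: lerXn2r; rewrite ?nnegrE; lra.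
  have YT' : Y * eps <= T * eps by rewrite ler_wpM2r.
  have Te : 0 <= T * eps by rewrite mulr_ge0//; lra.
  have e2 : 0 <= eps ^+ 2 by rewrite sqr_ge0.
  have E : (2 * Y - eps) ^+ 2 = 4 * Y ^+ 2 - 4 * (Y * eps) + eps ^+ 2 by ring.
  lra.
have e1 : nc h1' <= h.
  rewrite -(@ler_pXn2r _ 2)// ?nnegrE ?nc_ge0 ?(ltW h0)//; apply: le_trans hT.
  have := nc_parallelogram y w1; rewrite -/h1' {1}w1E addrCA subrr addr0 ncM => E.
  apply: (key (nc x) (nc y) (nc w) (nc w1)); rewrite ?Y2 ?nc_ge0//; last lra.
  by have := ncD w z; rewrite {1}wE subrK ncM; lra.
have e2 : nc h2' <= h.
  rewrite -(@ler_pXn2r _ 2)// ?nnegrE ?nc_ge0 ?(ltW h0)//; apply: le_trans hT.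
  have := nc_parallelogram x w2; rewrite -/h2' {1}w2E addrCA subrr addr0 mulrC ncM => E.
  have xw1 : nc x * nc w <= 2 * nc w1 + eps.
    by have := ncD w1 y; rewrite {1}w1E subrK ncM; lra.
  have wx2 : 2 * nc x <= nc x * nc w by rewrite mulrC ler_wpM2l ?nc_ge0//; lra.
  have XW : 2 * nc x - eps <= nc w * nc w1.
    have : 2 * nc w1 <= nc w * nc w1 by rewrite ler_wpM2r ?nc_ge0//; lra.
    lra.
  have sq : (2 * nc x - eps) ^+ 2 <= (nc w * nc w1) ^+ 2.
    by apply: lerXn2r; rewrite ?nnegrE; lra.
  have sq1 : nc w2 ^+ 2 <= nc x ^+ 2 by apply: lerXn2r; rewrite ?nnegrE ?nc_ge0//; lra.
  have YT' : nc x * eps <= T * eps by rewrite ler_wpM2r.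
  have Te : 0 <= T * eps by rewrite mulr_ge0//; lra.
  have e2 : 0 <= eps ^+ 2 by rewrite sqr_ge0.
  have E2 : (2 * nc x - eps) ^+ 2 = 4 * nc x ^+ 2 - 4 * (nc x * eps) + eps ^+ 2 by ring.
  lra.
have x0 : x != 0 by rewrite -nc_gt0; lra.
(* This makes w^2 close to 4; the identity for kappa - 4 below then has two small terms. *)
have xw : x * (w ^+ 2 - 4) = w * h1' - 2 * h2'.
  rewrite /h1' /h2' w2E w1E; ring.
have yE : 2 * y = x * w + h1' by rewrite /h1' w1E; ring.
have kE2 : x ^+ 2 + y ^+ 2 + w ^+ 2 - x * y * w - 4 =
    (w ^+ 2 - 4) * (1 - x ^+ 2 / 4) + h1' ^+ 2 / 4.
  have -> : h1' = 2 * y - x * w by rewrite yE; ring.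
  by field.
rewrite kE2; apply: le_trans (ncD _ _) _; rewrite ncM ncM ncV ncX nc_nat.
have w4 : nc (w ^+ 2 - 4) <= h * ((T + 2) / 2).
  have := congr1 nc xw; rewrite ncM => E.
  have := ncB (w * h1') (2 * h2'); rewrite -E !ncM nc_nat.
  have := nc_ge0 h1'; have := nc_ge0 h2'; have := nc_ge0 (w ^+ 2 - 4).
  by move: (nc x) (nc w) (nc h1') (nc h2') (nc (w ^+ 2 - 4)) X2 WT W2 e1 e2 => *; nra.
have x4 : nc (1 - x ^+ 2 / 4) <= 1 + T ^+ 2 / 4.
  apply: le_trans (ncB _ _) _; rewrite nc1 ncM ncV nc_nat ncX lerD2l.
  by rewrite ler_wpM2r// ler_pXn2r ?nnegrE//; lra.
have : nc (w ^+ 2 - 4) * nc (1 - x ^+ 2 / 4) <= h * ((T + 2) / 2) * (1 + T ^+ 2 / 4).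
  by apply: ler_pM; rewrite ?nc_ge0.
have : nc h1' ^+ 2 / 4 <= h.
  have := nc_ge0 h1'; nra.
lra.
Qed.

End DecreasingPaths.

(** * No infinite path of edges without convergence *)

Section PathConvergence.
Variable R : realType.
Local Notation C := (R[i]).
Local Notation nc := (@Normc.normc R).
Implicit Types (e : C * C * C).
Variables (c mu : C).
Hypothesis t0 : 1 + c != 0.
Hypothesis mu_c : (1 + c) * mu = - c ^+ 2.
Hypothesis mu4 : mu != 4.

Definition admissible e := [/\ tkappa e = mu, ~ in_open_m2_2 e.1.1,
  ~ in_open_m2_2 e.1.2, forall s, ~ in_open_m2_2 (tnew (tnode e s)) &
  forall s, 2 < nc (tnew (tnode e s))].

Lemma admissible_step d e : admissible e -> admissible (tstep d e).
Proof.
move=> [ke xe ye we we2]; split.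
- by rewrite tkappa_step.
- by case: d => //=; exact: (we [::]).
- by case: d => //=; exact: (we [::]).
- by move=> s; exact: (we (d :: s)).
- by move=> s; exact: (we2 (d :: s)).
Qed.

Lemma in_open0 : in_open_m2_2 (0 : C).
Proof. by exists 0 => //; apply/andP; split; lra. Qed.

Lemma not_open_neq0 (x : C) : ~ in_open_m2_2 x -> x != 0.
Proof. by move=> nx; apply/eqP => x0; apply: nx; rewrite x0; exact: in_open0. Qed.

Section BadPath.
Variable e0 : C * C * C.
Hypothesis adm0 : admissible e0.
Hypothesis bad0 : ~ convergent c e0.

(* If an edge is not convergent then neither is one of the two edges beyond it:
   follow such edges forever. *)
Let dir e := `[< convergent c (tstep false e) >].
Let path n := iter n (fun e => tstep (dir e) e) e0.
Let X n : R := nc (path n).1.1.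
Let Y n : R := nc (path n).1.2.
Let Z n : R := nc (path n).2.
Let W n : R := nc (tnew (path n)).

Let pathS n : path n.+1 = tstep (dir (path n)) (path n). Proof. by []. Qed.

Let path_bad n : ~ convergent c (path n).
Proof.
elim: n => [//|n IH]; rewrite pathS; case E: (dir (path n)); last first.
  by move: E; rewrite /dir => /asboolP.
by move=> ct; apply: IH; apply: convergent_step => //; apply/asboolP.
Qed.

Let path_adm n : admissible (path n).
Proof. by elim: n => [//|n IH]; rewrite pathS; exact: admissible_step. Qed.

Let kappa_path n : tkappa (path n) = mu. Proof. by have [] := path_adm n. Qed.

Let W2 n : 2 < W n. Proof. by have [_ _ _ _ h] := path_adm n; exact: (h [::]). Qed.

Let good_path n : ~ good c (path n).
Proof. by move=> /(convergent_good t0 mu_c (kappa_path n)); exact: path_bad. Qed.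

Let XYS n : dir (path n) = true ->
  [/\ X n.+1 = X n, Y n.+1 = W n & Z n.+1 = Y n].
Proof. by move=> dn; rewrite /X /Y /Z pathS dn. Qed.

Let XYS' n : dir (path n) = false ->
  [/\ X n.+1 = W n, Y n.+1 = Y n & Z n.+1 = X n].
Proof. by move=> dn; rewrite /X /Y /Z pathS dn. Qed.

(** A path that always turns the same way circles around one region, where [fan_convergent] applies;
    [sw] reflects the tree to treat both sides at once. *)
Lemma path_fan (sw : bool) (e := fun n => if sw then tswap (path n) else path n) n0 :
  (forall n, (n0 <= n)%N -> dir (path n) = ~~ sw) -> False.
Proof.
move=> dn.
have eS n : (n0 <= n)%N -> e n.+1 = tstep true (e n).
  move=> /dn dn'; rewrite /e pathS dn'; case: (sw) => //.
  by rewrite tswap_step.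
have e_iter k : iter k (tstep true) (e n0.+1) = e (n0.+1 + k)%N.
  elim: k => [|k IH]; first by rewrite addn0.
  by rewrite iterS IH addnS [RHS]eS// addSnnS leq_addr.
have ke : tkappa (e n0.+1) = mu.
  rewrite /e; case: (sw) => //; rewrite -(kappa_path n0.+1) /tswap /tkappa /=; ring.
have xnot : ~ in_open_m2_2 (e n0.+1).1.1.
  by have [_ ? ? _ _] := path_adm n0.+1; rewrite /e; case: (sw).
have fan2 k : 2 < nc (iter k (tstep true) (e n0.+1)).1.2.
  rewrite e_iter addSn eS ?leq_addr//= /e; case: (sw); last exact: W2.
  by rewrite tnew_swap; exact: W2.
have [k] := fan_convergent t0 mu_c (not_open_neq0 xnot) xnot ke mu4 fan2.
rewrite e_iter /e; case: (sw) => [/convergent_swap|]; exact: path_bad.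
Qed.

Let dir_often b n0 : exists n, (n0 <= n)%N /\ dir (path n) = b.
Proof.
apply: contrapT => nh; apply: (@path_fan b n0) => n hn.
by case E: (dir (path n)); case: (b) nh => // nh; exfalso; apply: nh; exists n.
Qed.

Let dir_big : exists n0, forall n, (n0 <= n)%N -> 2 < X n /\ 2 < Y n.
Proof.
have [n1 [_ d1]] := dir_often true 0; have [n2 [_ d2]] := dir_often false 0.
have Yb n : (n1 < n)%N -> 2 < Y n.
  elim: n => // n IH; rewrite ltnS leq_eqVlt => /orP[/eqP <-|/IH].
    by have [_ -> _] := XYS d1; exact: W2.
  case E: (dir (path n)); first by have [_ -> _] := XYS E; move=> _; exact: W2.
  by have [_ -> _] := XYS' E.
have Xb n : (n2 < n)%N -> 2 < X n.
  elim: n => // n IH; rewrite ltnS leq_eqVlt => /orP[/eqP <-|/IH].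
    by have [-> _ _] := XYS' d2; exact: W2.
  case E: (dir (path n)); first by have [-> _ _] := XYS E.
  by have [-> _ _] := XYS' E; move=> _; exact: W2.
exists (maxn n1 n2).+1 => n; rewrite gtn_max => /andP[/Yb ? /Xb ?] //.
Qed.

Let product_le n : X n * Y n <= W n + Z n.
Proof. by have := ncD (tnew (path n)) (path n).2; rewrite subrK ncM. Qed.

(** With the moduli of x and y at least 2a and 2b, an edge with |z| <= |w| has |w| >= 2ab. So each
    time the path has turned both ways the common lower bound is multiplied by r > 1, until an edge
    is good. *)
Lemma path_not_inward n : 2 < X n -> 2 < Y n -> Z n <= W n -> False.
Proof.
move=> X2 Y2 ZW.
pose r : R := Num.min (X n) (Y n) / 2.
have r1 : 1 < r by rewrite /r; case: (leP (X n) (Y n)) => _; lra.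
pose Q a b k := [/\ (n <= k)%N, Z k <= W k, 2 * a <= X k & 2 * b <= Y k].
have WQ a b k : 0 <= a -> 0 <= b -> Q a b k -> 2 * (a * b) <= W k.
  move=> a0 b0 [_ zw Xa Yb]; have := product_le k.
  have : (2 * a) * (2 * b) <= X k * Y k by apply: ler_pM; lra.
  lra.
have Qt a b b' k : 1 < a -> 1 < b -> Q a b k -> dir (path k) = true ->
    b' <= a * b -> Q a b' k.+1.
  move=> a1 b1 q dk b'ab; have wq := WQ a b k ltac:(lra) ltac:(lra) q.
  have [nk zw Xa Yb] := q; have [E1 E2 E3] := XYS dk.
  split; [exact: leqW| |by rewrite E1|by rewrite E2; lra].
  rewrite /Z /W pathS; apply: inward_step => //; rewrite -/(X k) -/(Y k); lra.
have Qf a b a' k : 1 < a -> 1 < b -> Q a b k -> dir (path k) = false ->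
    a' <= a * b -> Q a' b k.+1.
  move=> a1 b1 q dk a'ab; have wq := WQ a b k ltac:(lra) ltac:(lra) q.
  have [nk zw Xa Yb] := q; have [E1 E2 E3] := XYS' dk.
  split; [exact: leqW| |by rewrite E1; lra|by rewrite E2].
  rewrite /Z /W pathS; apply: inward_step => //; rewrite -/(X k) -/(Y k); lra.
have le_ab (a b : R) : 1 < a -> 1 < b -> a <= a * b /\ b <= a * b.
  by move=> a1 b1; split; [rewrite ler_peMr//; lra|rewrite ler_peMl//; lra].
have Qkeep (a b : R) k j : 1 < a -> 1 < b -> Q a b k -> Q a b (k + j)%N.
  move=> a1 b1 q; elim: j => [|j IH]; first by rewrite addn0.
  have [la lb] := le_ab a b a1 b1.
  by rewrite addnS; case E: (dir (path (k + j)%N)); [exact: Qt IH E _|exact: Qf IH E _].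
have grow (rho : R) k : r <= rho -> Q rho rho k -> exists k', Q (r * rho) (r * rho) k'.
  move=> rr q; have rho1 : 1 < rho by lra.
  have rr1 : 1 < r * rho by have [+ _] := le_ab _ _ r1 rho1; lra.
  have rrr : r * rho <= rho * rho by rewrite ler_wpM2r//; lra.
  have [k1 [kk1 d1]] := dir_often true k.
  have q1 : Q rho rho k1 by rewrite -(subnKC kk1); exact: Qkeep.
  have q1' : Q rho (r * rho) k1.+1 by apply: Qt q1 d1 _.
  have [k2 [kk2 d2]] := dir_often false k1.+1.
  have q2 : Q rho (r * rho) k2 by rewrite -(subnKC kk2); exact: Qkeep.
  exists k2.+1; apply: Qf q2 d2 _ => //.
  by have [] := le_ab _ _ rho1 rr1.
have Qpow j : exists k, Q (r ^+ j.+1) (r ^+ j.+1) k.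
  elim: j => [|j [k IH]].
    exists n; split=> //; rewrite expr1 /r; case: (leP (X n) (Y n)) => ?; lra.
  rewrite exprS; apply: (grow _ k) => //; rewrite exprS ler_peMr//; first lra.
  by rewrite exprn_ege1// ltW.
have [j hj] : exists j, cutoff c <= r ^+ j.+1.
  have bern k : 1 + k%:R * (r - 1) <= r ^+ k.
    elim: k => [|k IH]; first by rewrite mul0r addr0 expr0.
    have k0 : 0 <= k%:R :> R by [].
    rewrite exprS; apply: le_trans (_ : r * (1 + k%:R * (r - 1)) <= _); last first.
      by rewrite ler_wpM2l//; lra.
    have : 0 <= k%:R * (r - 1) * (r - 1) by rewrite !mulr_ge0//; lra.
    by rewrite -addn1 natrD; lra.
  exists (Num.truncn (cutoff c / (r - 1))); set k := _.+1.
  have r0 : 0 < r - 1 by lra.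
  have ck : cutoff c / (r - 1) < k%:R by exact: truncnS_gt.
  clearbody k; rewrite ltr_pdivrMr// in ck; have := bern k.
  by move: (k%:R * _) (r ^+ k) ck => u v; lra.
have [k q] := Qpow j; have c8 := cutoff_ge8 c.
have [k1 [kk1 d1]] := dir_often true k.
have q1 : Q (r ^+ j.+1) (r ^+ j.+1) k1 by rewrite -(subnKC kk1); apply: Qkeep => //; lra.
have [_ zw Xa Ya] := q1; have [E1 E2 E3] := XYS d1.
apply: (@good_path k1.+1); rewrite /good -/(X _) -/(Y _) -/(Z _) E1 E2 E3.
have XY := product_le k1; have XY8 : 8 * Y k1 <= X k1 * Y k1 by rewrite ler_wpM2r//; lra.
have XW : 8 * W k1 <= X k1 * W k1 by rewrite ler_wpM2r//; [have := W2 k1; lra|lra].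
by split; lra.
Qed.

(** Every edge far enough along the path now has |w| < |z|, so the sum of the three moduli decreases
    by |z| - |w|. The sums are bounded below, the decrements tend to 0, and at a turn [switch_kappa]
    gives |mu - 4| < |mu - 4|. *)
Lemma path_inward : False.
Proof.
have [n0 big] := dir_big.
have out n : (n0 <= n)%N -> W n < Z n.
  move=> /big[X2 Y2]; rewrite ltNge; apply/negP; exact: path_not_inward.
pose S n : R := X (n0 + n)%N + Y (n0 + n)%N + Z (n0 + n)%N.
have Spos n : 0 <= S n by rewrite !addr_ge0 ?nc_ge0.
have SS n : S n.+1 = S n - (Z (n0 + n)%N - W (n0 + n)%N).
  rewrite /S addnS; case E: (dir (path (n0 + n)%N)).
    by have [-> -> ->] := XYS E; ring.
  by have [-> -> ->] := XYS' E; ring.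
have Sdec n m : (n <= m)%N -> S m <= S n.
  move=> /subnKC <-; elim: (m - n)%N => [|k IH]; first by rewrite addn0.
  apply: le_trans IH; rewrite addnS SS; have := out (n0 + (n + k))%N (leq_addr _ _); lra.
pose T : R := S 0%N + 2.
pose K : R := (((T + 2) / 2) * (1 + T ^+ 2 / 4) + 1).
have T2 : 2 <= T by have := Spos 0%N; rewrite /T; lra.
have K0 : 1 <= K.
  by rewrite /K lerDr; have := sqr_ge0 T => TT; apply: mulr_ge0; lra.
pose D : R := nc (mu - 4); have D0 : 0 < D by rewrite nc_gt0 subr_eq0.
(* Chosen so that the bound h K of [switch_kappa] stays below |mu - 4|; eps is then the largest
   decrement that lemma allows. *)
pose h : R := Num.min 1 (D / (2 * K)).
have h0 : 0 < h by rewrite lt_min ltr01 divr_gt0//; lra.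
have hD : h * K < D.
  apply: le_lt_trans (_ : D / (2 * K) * K < D); first by rewrite ler_wpM2r ?ge_min ?lexx ?orbT//; lra.
  rewrite invfM mulrA -mulrA mulVf; last by rewrite gt_eqF//; lra.
  by rewrite mulr1; lra.
pose eps : R := h ^+ 2 / (8 * T).
have eps0 : 0 < eps by rewrite divr_gt0 ?exprn_gt0//; lra.
have [n1 small] : exists n1, forall n, (n1 <= n)%N -> Z (n0 + n)%N <= W (n0 + n)%N + eps.
  have hinf : has_inf [set S n | n in setT].
    by split; [exists (S 0%N); exists 0%N|exists 0 => _ [k _ <-]].
  have [_ [n1 _ <-] Sn1] := inf_adherent eps0 hinf.
  exists n1 => n hn; have := SS n; have := Sdec _ _ hn.
  have : inf [set S n | n in setT] <= S n.+1.
    by apply: ge_inf; [have [] := hinf|exists n.+1].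
  lra.
have [k1 [n1k1 d1]] := dir_often true (n0 + n1)%N.
(* The first false turn at or after [k1] comes right after a true one, which is the pattern of
   [switch_kappa]. *)
have ex2 : exists k, (k1 <= k)%N && ~~ dir (path k).
  by have [k2 [? E]] := dir_often false k1; exists k2; rewrite E andbT.
have [k2 /andP[k12 /negbTE d2] k2min] := ex_minnP ex2.
have k12' : (k1 < k2)%N.
  by rewrite ltn_neqAle k12 andbT; apply/eqP => E; move: d2; rewrite -E d1.
have [k k2E] : exists k, k2 = k.+1 by case: (k2) k12' => // k _; exists k.
have k1k : (k1 <= k)%N by rewrite -ltnS -k2E.
have dk : dir (path k) = true.
  apply: contraT => dk; have := k2min k; rewrite k1k => /(_ dk).
  by rewrite k2E ltnn.
rewrite k2E in d2.
have nk : (n0 + n1 <= k)%N by exact: leq_trans n1k1 k1k.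
have n0k : (n0 <= k)%N by exact: leq_trans (leq_addr _ _) nk.
have sm j : (n0 + n1 <= j)%N -> Z j <= W j + eps.
  move=> hj; have := small (j - n0)%N; rewrite subnKC; last exact: leq_trans (leq_addr _ _) hj.
  by apply; rewrite leq_subRL// (leq_trans (leq_addr _ _) hj).
have bT j : (n0 <= j)%N -> [/\ X j <= T, Y j <= T & W j <= T].
  move=> hj; have := Sdec 0%N (j - n0)%N (leq0n _); rewrite {1}/S subnKC// => le.
  have := out j hj; have := nc_ge0 (path j).1.1; have := nc_ge0 (path j).1.2.
  have := nc_ge0 (path j).2; rewrite -/(X j) -/(Y j) -/(Z j) /T.
  by move=> ? ? ? ?; split; lra.
have [X2 Y2] := big k n0k; have [XT YT WT] := bT k n0k.
have p1 : path k.+1 = tstep true (path k) by rewrite pathS dk.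
have p2 : path k.+2 = tstep false (path k.+1) by rewrite pathS d2.
have [E1 E2 E3] := XYS dk; have [F1 F2 F3] := XYS' d2.
have o1 := out k.+1 (leqW n0k); have o2 := out k.+2 (leqW (leqW n0k)).
have s1 := sm k.+1 (leqW nk); have s2 := sm k.+2 (leqW (leqW nk)).
rewrite E3 in o1 s1; rewrite F3 E1 in o2 s2.
have Teps : 8 * T * eps = h ^+ 2.
  by rewrite /eps mulrC divfK// gt_eqF//; lra.
have key := @switch_kappa R (path k) T h eps; cbv zeta in key.
rewrite -p1 -p2 kappa_path in key.
suff : D <= h * K by lra.
apply: key.
- by rewrite h0 ge_min lexx.
- by rewrite Teps.
- exact: ltW.
- by apply/andP.
- by apply/andP.
- by apply/andP; split; [exact: W2|exact: WT].
- by apply/andP; split; [exact/ltW/out|exact: sm].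
- by apply/andP; split; [exact: ltW|exact: s1].
- by apply/andP; split; [exact: ltW|exact: s2].
Qed.

End BadPath.

Lemma convergent_admissible e : admissible e -> convergent c e.
Proof. by move=> adm; apply: contrapT => bad; exact: (path_inward adm bad). Qed.

Lemma convergent_eventually_admissible M e : tkappa e = mu ->
  ~ in_open_m2_2 e.1.1 -> ~ in_open_m2_2 e.1.2 ->
  (forall s, ~ in_open_m2_2 (tnew (tnode e s))) ->
  (forall s, (M <= size s)%N -> 2 < nc (tnew (tnode e s))) -> convergent c e.
Proof.
elim: M e => [|M IH] e ke xe ye we we2.
  by apply: convergent_admissible; split=> // s; exact: we2.
have step d : convergent c (tstep d e).
  apply: IH; first by rewrite tkappa_step.
  - by case: d => //=; exact: (we [::]).
  - by case: d => //=; exact: (we [::]).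
  - by move=> s; exact: (we (d :: s)).
  - by move=> s hs; exact: (we2 (d :: s)).
by apply: convergent_step.
Qed.

End PathConvergence.

(** * Summation identities *)

Notation edge_prod := (edge_fold *%R).
Notation region_prod := (region_fold *%R 1).

Section TreeIdentities.
Variable R : realType.
Local Notation C := (R[i]).
Local Notation nc := (@Normc.normc R).
Implicit Types (e : C * C * C) (w : C).
Variables (c mu : C).
Hypothesis mu_c : (1 + c) * mu = - c ^+ 2.

(** For mu = tau + 2 these are the traces at which the summand is defined. *)
Definition regular_trace w := w != 0 /\ w ^+ 2 != mu.
Definition regular e := [/\ tkappa e = mu, regular_trace e.1.1,
  regular_trace e.1.2 & forall s, regular_trace (tnew (tnode e s))].

Lemma regular_step d e : regular e -> regular (tstep d e).
Proof.
move=> [ke xe ye we]; split; first by rewrite tkappa_step.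
- by case: d => //=; exact: (we [::]).
- by case: d => //=; exact: (we [::]).
- by move=> s; exact: (we (d :: s)).
Qed.

Definition Psi e := 1 + c * psi e.
Definition gap w := 1 - mu / w ^+ 2.
Definition Hfac e := hfac c e.1.1 * hfac c e.1.2.

Lemma Psi_step e : regular e -> Psi e * gap (tnew e) =
  Psi (tstep true e) * Psi (tstep false e).
Proof.
move=> [ke [x0 _] [y0 _] /(_ [::]) [w0 _]]; move: ke x0 y0 w0.
case: e => [[x y] z]; rewrite /tkappa /Psi /psi /gap /tstep /=.
set w := tnew _; rewrite -/w => ke x0 y0 w0.
have zE : z = x * y - w by rewrite /w /tnew /=; ring.
have kw : mu = x ^+ 2 + y ^+ 2 + w ^+ 2 - x * y * w by rewrite -ke zE; ring.
clearbody w; rewrite zE.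
have -> : (1 + c * ((x * y - w) / (x * y))) * (1 - mu / w ^+ 2) =
  ((1 + c) * x * y * w ^+ 2 - x * y * ((1 + c) * mu) - c * w ^+ 3 + c * w * mu) / (x * y * w ^+ 2).
  by field; rewrite x0 y0 w0.
by rewrite mu_c kw; field; rewrite x0 y0 w0.
Qed.

Lemma edge_prod_Psi m e : regular e ->
  edge_prod Psi m e = Psi e * region_prod gap m e.
Proof.
elim: m e => [|m IH] e re; first by rewrite mulr1.
rewrite edge_foldS region_foldS !IH; try exact: regular_step.
by rewrite mulrACA -Psi_step// -mulrA.
Qed.

(** Each region in between borders two of the edges at depth m, and each of the two regions along e
    borders one. *)
Lemma edge_prod_Hfac m e :
  edge_prod Hfac m e = Hfac e * region_prod (fun w => hfac c w ^+ 2) m e.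
Proof.
elim: m e => [|m IH] e; first by rewrite mulr1.
rewrite edge_foldS region_foldS !IH /Hfac /=.
by move: (region_prod _ _ _) (region_prod _ _ _) => p q; ring.
Qed.

(** The second factor is 1 + c times the denominator under the logarithm of the summand; this is
    what turns the quotient there into [Qfac]. *)
Lemma hfac_gap w : w != 0 -> hfac c w * (1 + c - c * hfun w) = (1 + c) * gap w.
Proof.
move=> w0; rewrite /hfac /gap.
have -> : (1 + c) * (1 - mu / w ^+ 2) = (1 + c) - (1 + c) * mu * w ^- 2 by ring.
by rewrite mu_c -hfun_inv//; ring.
Qed.

Lemma gap_neq0 w : regular_trace w -> gap w != 0.
Proof.
move=> [w0 wmu]; rewrite /gap subr_eq0; apply: contra wmu => /eqP E.
by rewrite -[w ^+ 2]mul1r E divfK// expf_neq0.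
Qed.

Hypothesis t0 : 1 + c != 0.

Lemma hfac_neq0 w : regular_trace w -> hfac c w != 0.
Proof.
move=> rw; have := hfac_gap rw.1; apply: contra_eq_neq => ->.
by rewrite mul0r eq_sym mulf_neq0// gap_neq0.
Qed.

Lemma Hfac_neq0 e : regular e -> Hfac e != 0.
Proof. by move=> [_ xe ye _]; rewrite mulf_neq0// hfac_neq0. Qed.

(* The exponential of the summand of the identity. *)
Definition Qfac w := hfac c w ^+ 2 / gap w.

Lemma Qfac_neq0 w : regular_trace w -> Qfac w != 0.
Proof. by move=> rw; rewrite mulf_neq0 ?invr_neq0 ?gap_neq0// expf_neq0// hfac_neq0. Qed.

Lemma region_prod_Qfac m e : regular e ->
  region_prod Qfac m e * edge_prod (fun e => Psi e / Hfac e) m e = Psi e / Hfac e.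
Proof.
move=> re; have -> : edge_prod (fun e => Psi e / Hfac e) m e =
    edge_prod Psi m e / edge_prod Hfac m e.
  by elim: m e {re} => [//|m IH] e; rewrite !edge_foldS !IH invfM [LHS]mulrACA.
have -> : region_prod Qfac m e =
    region_prod (fun w => hfac c w ^+ 2) m e / region_prod gap m e.
  elim: m e {re} => [|m IH] e; first by rewrite invr1 mulr1.
  by rewrite !region_foldS !IH !invfM [X in _ * X = _]mulrACA [LHS]mulrACA.
have nz m' e' : regular e' -> region_prod gap m' e' != 0 /\
    region_prod (fun w => hfac c w ^+ 2) m' e' != 0.
  elim: m' e' => [|m' IH] e' re'; first by rewrite oner_eq0.
  have [_ _ _ /(_ [::]) rw] := re'.
  have [? ?] := IH _ (regular_step true re'); have [? ?] := IH _ (regular_step false re').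
  by rewrite !region_foldS !mulf_neq0 ?gap_neq0 ?expf_neq0 ?hfac_neq0.
have [n1 n2] := nz m e re; have n3 := Hfac_neq0 re.
rewrite edge_prod_Psi// edge_prod_Hfac.
move: n1 n2; set p := region_prod gap m e; set q := region_prod _ m e => n1 n2.
by field; rewrite n1 n2 n3.
Qed.

(** In this form errors of factors add up in the exponent, so a small sum of errors makes the whole
    product close to 1. *)
Lemma nc_prod_sub1 (a b : C) (r s : R) : nc (a - 1) <= expR r - 1 ->
  nc (b - 1) <= expR s - 1 -> nc (a * b - 1) <= expR (r + s) - 1.
Proof.
move=> ha hb; have -> : a * b - 1 = (a - 1) * (b - 1) + ((a - 1) + (b - 1)) by ring.
apply: le_trans (ncD _ _) _; rewrite ncM expRD.
have := ncD (a - 1) (b - 1).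
have : nc (a - 1) * nc (b - 1) <= (expR r - 1) * (expR s - 1).
  by apply: ler_pM; rewrite ?nc_ge0.
lra.
Qed.

Lemma edge_prod_err m e : regular e ->
  nc (edge_prod (fun e => Psi e / Hfac e) m e - 1) <=
  expR (nc c * edge_sum (err c) m e) - 1.
Proof.
elim: m e => [|m IH] e re; last first.
  rewrite !edge_foldS mulrDr; apply: nc_prod_sub1; apply: IH; exact: regular_step.
have -> : edge_prod (fun e => Psi e / Hfac e) 0 e - 1 =
    c * ((psi e - sigma c e) / Hfac e).
  rewrite /= -[X in _ - X](divff (Hfac_neq0 re)) -mulrBl mulrA; congr (_ / _).
  by rewrite /Hfac hfac_sigma /Psi; ring.
rewrite ncM -/(err c e); have := expR_ge1Dx (nc c * err c e); rewrite /=; lra.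
Qed.

End TreeIdentities.

Section AdditiveTreeIdentity.
Variable R : realType.
Local Notation C := (R[i]).
Local Notation nc := (@Normc.normc R).
Implicit Types (e : C * C * C) (w : C).

Lemma psi_step e : regular 0 e -> psi e = psi (tstep true e) + psi (tstep false e).
Proof.
move=> [ke [x0 _] [y0 _] /(_ [::]) [w0 _]]; move: ke x0 y0 w0.
case: e => [[x y] z]; rewrite /tkappa /psi /tstep /=.
set w := tnew _; rewrite -/w => ke x0 y0 w0.
have zE : z = x * y - w by rewrite /w /tnew /=; ring.
have kw : x ^+ 2 + y ^+ 2 + w ^+ 2 - x * y * w = 0 by rewrite -ke zE; ring.
clearbody w; rewrite zE; apply/eqP; rewrite -subr_eq0; apply/eqP.
transitivity (- (x ^+ 2 + y ^+ 2 + w ^+ 2 - x * y * w) / (x * y * w)).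
  by field; rewrite x0 y0 w0.
by rewrite kw oppr0 mul0r.
Qed.

(** For c = 0 [sigma] is h(x) + h(y), and every region beyond e borders two edges at depth m, hence
    the factor 2. *)
Lemma region_sum_hfun m e : regular 0 e ->
  nc (psi e - (hfun e.1.1 + hfun e.1.2 + 2 * region_sum (@hfun R) m e)) <=
  edge_sum (err 0) m e.
Proof.
elim: m e => [|m IH] e re.
  rewrite /= mulr0 addr0 /err /sigma /hfac !mul0r !addr0 mulr1 invr1 mulr1.
  exact: lexx.
rewrite edge_foldS region_foldS.
apply: le_trans (lerD (IH _ (regular_step true re)) (IH _ (regular_step false re))).
apply: le_trans (ncD _ _); rewrite le_eqVlt; apply/orP; left; apply/eqP; congr nc.
rewrite (psi_step re) /=; ring.
Qed.

End AdditiveTreeIdentity.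

(** * Telescoping along the boundary of the fixed region *)

Section PeriodicFan.
Variable R : realType.
Local Notation C := (R[i]).
Variables (c mu x : C) (y : nat -> C) (N : nat).
Hypothesis mu_c : (1 + c) * mu = - c ^+ 2.
Hypothesis yS : forall n, y n.+2 = x * y n.+1 - y n.
Hypothesis yk : forall n, tkappa (y n.+1, y n, x) = mu.
Hypothesis yN : forall n, y (n + N.+1)%N = y n.
Hypothesis y0 : forall n, regular_trace mu (y n).

Let rel n : mu = x ^+ 2 + y n ^+ 2 + y n.+1 ^+ 2 - x * y n * y n.+1.
Proof. by rewrite -(yk n) /tkappa /=; ring. Qed.

Lemma prod_shift (a : nat -> C) : a N.+1 = a 0%N ->
  \prod_(k < N.+1) a k.+1 = \prod_(k < N.+1) a k.
Proof. by move=> aN; rewrite big_ord_recr big_ord_recl /= mulrC aN. Qed.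

Let yN0 n : y (N.+1 + n)%N = y n. Proof. by rewrite addnC yN. Qed.

(* Telescoping along the fan; the two telescoping quantities correspond to the
   two orientations, and cannot both vanish. *)
Lemma fan_prod : c != 0 -> 2 + c != 0 ->
  \prod_(k < N.+1) (y k * y k.+1 + c * x) = \prod_(k < N.+1) (y k ^+ 2 - mu).
Proof.
move=> c0 c2.
pose V n := x * y n + c * y n.+1; pose T n := x * y n.+1 + c * y n.
have VS n : (y n * y n.+1 + c * x) * V n = V n.+1 * (y n ^+ 2 - mu).
  rewrite /V yS; apply/eqP; rewrite -subr_eq0; apply/eqP.
  transitivity (x * y n.+1 * ((1 + c) * mu + c ^+ 2) + c * y n *
     (x ^+ 2 + y n ^+ 2 + y n.+1 ^+ 2 - x * y n * y n.+1 - mu)); first by ring.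
  by rewrite mu_c -rel subrr addNr !mulr0 addr0.
have TS n : (y n.+1 * y n.+2 + c * x) * T n.+1 = T n * (y n.+2 ^+ 2 - mu).
  have E : y n = x * y n.+1 - y n.+2 by rewrite yS; ring.
  rewrite /T E; apply/eqP; rewrite -subr_eq0; apply/eqP.
  transitivity (x * y n.+1 * ((1 + c) * mu + c ^+ 2) + c * y n.+2 *
     (x ^+ 2 + y n.+1 ^+ 2 + y n.+2 ^+ 2 - x * y n.+1 * y n.+2 - mu)); first by ring.
  by rewrite mu_c -rel subrr addNr !mulr0 addr0.
have Vprod m : \prod_(k < m) (y k * y k.+1 + c * x) * V 0%N =
    V m * \prod_(k < m) (y k ^+ 2 - mu).
  elim: m => [|m IH]; first by rewrite !big_ord0 mulr1 mul1r.
  rewrite !big_ord_recr /= mulrAC IH; set D := \prod_(_ < _) _.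
  transitivity (D * ((y m * y m.+1 + c * x) * V m)); first by ring.
  by rewrite VS; ring.
have Tprod m : \prod_(k < m) (y k.+1 * y k.+2 + c * x) * T m =
    T 0%N * \prod_(k < m) (y k.+2 ^+ 2 - mu).
  elim: m => [|m IH]; first by rewrite !big_ord0 mulr1 mul1r.
  by rewrite !big_ord_recr /= -mulrA TS mulrA IH mulrA.
have [V0|V0] := eqVneq (V 0%N) 0; last first.
  apply: (mulIf V0); rewrite Vprod mulrC; congr (_ * _).
  by rewrite /V -[N.+1]addn0 -addnS !yN0.
(* If both vanished then x^2 = c^2 and y1^2 = y0^2, so mu = c^2 + (2 + c) y0^2; with (1 + c) mu = -
   c^2 this gives y0^2 = mu, against regularity. *)
have T0 : T 0%N != 0.
  apply/eqP => T0; have [y00 y0mu] := y0 0%N; move/eqP: y0mu; apply.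
  have E1 : x * y 0%N = - (c * y 1%N) by apply/eqP; rewrite -addr_eq0 -/(V 0%N) V0.
  have E2 : x * y 1%N = - (c * y 0%N) by apply/eqP; rewrite -addr_eq0 -/(T 0%N) T0.
  have yy : y 1%N ^+ 2 = y 0%N ^+ 2.
    apply: (mulfI c0); rewrite !expr2 !mulrA -[c * y 1%N]opprK -E1.
    by rewrite -[c * y 0%N]opprK -E2; ring.
  have xx : x ^+ 2 = c ^+ 2.
    apply: (mulIf y00); rewrite !expr2 -!mulrA E1 mulrN mulrCA E2; ring.
  have t1 : 1 + c != 0.
    apply: contra c0 => /eqP t; have := mu_c; rewrite t mul0r => /esym/eqP.
    by rewrite oppr_eq0 sqrf_eq0.
  have muE : mu = c ^+ 2 + (2 + c) * y 0%N ^+ 2.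
    rewrite (rel 0) xx yy E1 mulNr -mulrA -expr2 yy; ring.
  apply: (mulfI t1); apply: (mulfI c2); rewrite mu_c; apply/eqP.
  rewrite -subr_eq0; apply/eqP; transitivity ((1 + c) * mu + c ^+ 2); last by rewrite mu_c addNr.
  by rewrite muE; ring.
apply: (mulIf T0); have := Tprod N.+1.
have -> : T N.+1 = T 0%N by rewrite /T -[N.+1]addn0 -addnS !yN0.
rewrite (prod_shift (a := fun k => y k * y k.+1 + c * x)); last first.
  by rewrite -[N.+1]addn0 -addnS !yN0.
rewrite (prod_shift (a := fun k => y k.+1 ^+ 2 - mu)); last by rewrite -[N.+1]addn0 -addnS yN0.
rewrite (prod_shift (a := fun k => y k ^+ 2 - mu)); last by rewrite -[N.+1]addn0 yN0.
by move=> ->; rewrite mulrC.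
Qed.

Lemma fan_prod_Qfac : c != 0 -> 2 + c != 0 -> 1 + c != 0 ->
  \prod_(k < N.+1) (Qfac c mu (y k) * (Psi c (y k.+1, y k, x) / Hfac c (y k.+1, y k, x))) = 1.
Proof.
move=> c0 c2 t1; rewrite big_split /=.
have -> : \prod_(k < N.+1) (Psi c (y k.+1, y k, x) / Hfac c (y k.+1, y k, x)) =
    \prod_(k < N.+1) (y k * y k.+1 + c * x) /
      (\prod_(k < N.+1) y k ^+ 2 * \prod_(k < N.+1) hfac c (y k) ^+ 2).
  have -> : \prod_(k < N.+1) y k ^+ 2 = \prod_(k < N.+1) (y k * y k.+1).
    rewrite [RHS]big_split /= (prod_shift (a := y)); last by rewrite -[N.+1]addn0 yN0.
    by rewrite -big_split; apply: eq_bigr => k _; exact: expr2.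
  have -> : \prod_(k < N.+1) hfac c (y k) ^+ 2 =
      \prod_(k < N.+1) (hfac c (y k) * hfac c (y k.+1)).
    rewrite [RHS]big_split /= (prod_shift (a := fun k => hfac c (y k))); last first.
      by rewrite -[N.+1]addn0 yN0.
    by rewrite -big_split; apply: eq_bigr => k _; exact: expr2.
  rewrite -big_split -prodf_div /=; apply: eq_bigr => k _.
  have [n1 _] := y0 k; have [n2 _] := y0 k.+1.
  have h1 := hfac_neq0 mu_c t1 (y0 k); have h2 := hfac_neq0 mu_c t1 (y0 k.+1).
  by rewrite /Psi /Hfac /psi /=; field; rewrite n1 n2 h1 h2.
rewrite fan_prod// -big_split -prodf_div -big_split big1//= => k _.
have [n1 _] := y0 k; have h1 := hfac_neq0 mu_c t1 (y0 k).
have g1 := gap_neq0 (y0 k).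
have -> : y k ^+ 2 - mu = gap mu (y k) * y k ^+ 2.
  by rewrite /gap mulrBl mul1r divfK// expf_neq0.
by rewrite /Qfac; field; rewrite n1 h1 g1.
Qed.

Lemma fan_sum : mu = 0 -> \sum_(k < N.+1) psi (y k.+1, y k, x) = 0.
Proof.
move=> mu0; have [x0|x0] := eqVneq x 0.
  by rewrite big1// => k _; rewrite /psi /= x0 mul0r.
(* A discrete primitive of psi along the fan for mu = 0. *)
pose A n := y n.+1 / (x * y n).
rewrite (eq_bigr (fun k : 'I_N.+1 => A k.+1 - A k)) => [|k _].
  rewrite -(big_mkord xpredT (fun k => A k.+1 - A k)) telescope_sumr//.
  by rewrite /A -[N.+1]addn0 -addnS !yN0 subrr.
have [n1 _] := y0 k; have [n2 _] := y0 k.+1.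
rewrite /psi /A yS /=; apply/eqP; rewrite -subr_eq0; apply/eqP.
transitivity ((x ^+ 2 + y k ^+ 2 + y k.+1 ^+ 2 - x * y k * y k.+1) / (x * y k * y k.+1)).
  by field; rewrite x0 n1 n2.
by rewrite -rel mu0 mul0r.
Qed.

End PeriodicFan.

(** * Exponential and logarithm *)

Section ComplexExp.
Import numFieldNormedType.Exports.
Variable R : realType.
Local Notation C := (R[i]).
Local Notation nc := (@Normc.normc R).
Implicit Types (z w u : C).

Lemma expcD z w : expc (z + w) = expc z * expc w.
Proof.
case: z => a b; case: w => c d; rewrite /expc /= expRD cosD sinD; simpc.
by congr (_ +i* _); ring.
Qed.

Lemma expc0 : expc (0 : C) = 1.
Proof. by rewrite /expc /= expR0 cos0 sin0; simpc. Qed.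

Lemma expc_sum (I : Type) (r : seq I) (F : I -> C) :
  expc (\sum_(i <- r) F i) = \prod_(i <- r) expc (F i).
Proof. by elim: r => [|i r IH]; rewrite ?big_nil ?expc0// !big_cons expcD IH. Qed.

Lemma expc_neq0 z : expc z != 0.
Proof.
apply/eqP => z0; have := expcD z (- z); rewrite subrr expc0 z0 mul0r.
by move/eqP; rewrite oner_eq0.
Qed.

Lemma expc_2pi (k : int) : expc (0 +i* (2 * pi * k%:~R)) = 1 :> C.
Proof.
have e2 : expc (0 +i* (2 * pi)) = 1 :> C.
  by rewrite /expc /= expR0 mulr_natl cos2pi sin2pi; simpc.
have pos n : expc (0 +i* (2 * pi * n%:R)) = 1 :> C.
  elim: n => [|n IH]; first by rewrite mulr0 -[RHS]expc0.
  have -> : 0 +i* (2 * pi * n.+1%:R) = 0 +i* (2 * pi * n%:R) + 0 +i* (2 * pi) :> C.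
    by simpc; congr (_ +i* _); rewrite -addn1 natrD; ring.
  by rewrite expcD IH e2 mulr1.
case: k => n; first exact: pos.
have -> : 0 +i* (2 * pi * (Negz n)%:~R) = - (0 +i* (2 * pi * n.+1%:R)) :> C.
  by rewrite NegzE mulrNz mulrN; apply/eqP; rewrite eq_complex /= oppr0 !eqxx.
by rewrite expcN pos invr1.
Qed.

Lemma expc_eq1 z : expc z = 1 -> exists k : int, z = 0 +i* (2 * pi * k%:~R).
Proof.
case: z => a b E; have := congr1 nc E; rewrite nc1 /expc ncM nc_real /=.
rewrite cos2Dsin2 sqrtr1 mulr1 ger0_norm ?expR_ge0// => ea.
have a0 : a = 0 by apply: expR_inj; rewrite ea expR0.
have p0 : 0 < 2 * pi :> R by rewrite mulr_gt0 ?pi_gt0.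
pose k := Num.floor (b / (2 * pi)); exists k; rewrite a0; congr (_ +i* _).
pose th := b - 2 * pi * k%:~R.
have [th0 th1] : 0 <= th /\ th < 2 * pi.
  have := floor_le_tmp (b / (2 * pi)); have := floorD1_gt (b / (2 * pi)).
  rewrite -/k ler_pdivlMr// ltr_pdivrMr// intrD /th; lra.
have : expc (0 +i* th) = 1 :> C.
  have -> : 0 +i* th = (a +i* b) - (0 +i* (2 * pi * k%:~R)) :> C by rewrite a0; simpc.
  by rewrite expcD E expcN expc_2pi invr1 mulr1.
rewrite /expc /= expR0; simpc => -[cth _].
suff : th = 0 by rewrite /th; lra.
apply/eqP; rewrite eq_le th0 andbT leNgt; apply/negP => thp.
have sp : 0 < sin (th / 2) by apply: sin_gt0_pi; apply/andP; split; lra.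
have thE : th = (th / 2) *+ 2 by rewrite -mulr_natr divfK.
move: cth; rewrite {1}thE cos_mulr2n cos2sin2 mulr2n => cth.
have := exprn_gt0 2 sp.
lra.
Qed.

Lemma nc_le_ReIm z : nc z <= `|complex.Re z| + `|complex.Im z|.
Proof.
case: z => a b /=; rewrite -[leRHS]ger0_norm ?addr_ge0// -sqrtr_sqr ler_sqrt ?sqr_ge0//.
rewrite sqrrD !real_normK ?num_real// mulr2n.
by have := mulr_ge0 (normr_ge0 a) (normr_ge0 b); lra.
Qed.

Lemma continuous_near0 (f : R -> R) (eps : R) : continuous f -> 0 < eps ->
  exists2 d : R, 0 < d & forall x, `|x| < d -> `|f x - f 0| < eps.
Proof.
move=> cf e0; have /cvgrPdist_lt/(_ eps e0) := cf 0.
rewrite -nbhs_nearE => /nbhs_ballP[d /= d0 h]; exists d => // x xd.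
by rewrite distrC; apply: h; rewrite /ball /= sub0r normrN.
Qed.

Lemma expc_near0 (eps : R) : 0 < eps ->
  exists2 d : R, 0 < d & forall z, nc z < d -> nc (expc z - 1) < eps.
Proof.
move=> e0; pose h : R := Num.min 1 (eps / 8).
have h0 : 0 < h by rewrite lt_min ltr01 divr_gt0.
have h1 : h <= 1 by rewrite ge_min lexx.
have he : h <= eps / 8 by rewrite ge_min lexx orbT.
have [d1 d10 hd1] := continuous_near0 (@continuous_expR R) h0.
have [d2 d20 hd2] := continuous_near0 (@continuous_cos R) h0.
have [d3 d30 hd3] := continuous_near0 (@continuous_sin R) h0.
exists (Num.min d1 (Num.min d2 d3)); first by rewrite !lt_min d10 d20.
move=> z; rewrite !lt_min => /and3P[zd1 zd2 zd3].
have := hd1 _ (le_lt_trans (Re_nc z) zd1); have := hd2 _ (le_lt_trans (Im_nc z) zd2).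
have := hd3 _ (le_lt_trans (Im_nc z) zd3); rewrite expR0 cos0 sin0 subr0.
case: z {zd1 zd2 zd3} => a b hs hc he1; rewrite /= in hs hc he1.
apply: le_lt_trans (nc_le_ReIm _) _.
have -> : expc (a +i* b) - 1 = (expR a * cos b - 1) +i* (expR a * sin b).
  by rewrite /expc /=; simpc.
rewrite [complex.Re _]/= [complex.Im _]/=.
have -> : expR a * cos b - 1 = (expR a - 1) * cos b + (cos b - 1) by ring.
apply: le_lt_trans (lerD (ler_normD _ _) (lexx _)) _; rewrite !normrM.
have c1 := cos_max b; have ea : `|expR a| < 2.
  by have := ler_normD (expR a - 1) 1; rewrite subrK normr1; lra.
have : `|expR a - 1| * `|cos b| <= h * 1 by apply: ler_pM => //; exact: ltW.
have : `|expR a| * `|sin b| <= 2 * h by apply: ler_pM => //; exact: ltW.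
lra.
Qed.

(** Mean value theorem: sin x = x cos y with y < x, and cos decreases on [0, pi]. It bounds an
    argument by its sine where the cosine is bounded below. *)
Lemma sin_ge_cos_arg (x : R) : 0 <= x <= pi -> x * cos x <= sin x.
Proof.
move=> /andP[x0 xp]; have [->|xn] := eqVneq x 0; first by rewrite mul0r sin0.
have xpos : 0 < x by rewrite lt_neqAle eq_sym xn.
have [y yx E] := @MVT R sin cos 0 x xpos (fun y _ => is_derive_sin y)
  (continuous_subspaceT (@continuous_sin R)).
rewrite sin0 !subr0 in E; rewrite E mulrC ler_pM2r//.
move: yx; rewrite in_itv /= => /andP[y0 yx].
by rewrite ltW// ltr_cos// in_itv/=; apply/andP; split; lra.
Qed.

(** With d = |u - 1| and logarithm a + ib: |a| <= 2d from the modulus, cos b >= 1/3 from the real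
    part, then |b| <= 6d from the imaginary part. *)
Lemma nc_logc u : nc (u - 1) <= 2^-1 -> nc (logc u) <= 8 * nc (u - 1).
Proof.
move=> u1; set d := nc (u - 1) in u1 *; have d0 : 0 <= d by exact: nc_ge0.
have u0 : u != 0.
  by apply/eqP => u00; move: u1; rewrite /d u00 sub0r ncN nc1; lra.
have [E /andP[b1 b2]] := logcP u0; move: E b1 b2; case: (logc u) => a b E b1 b2; rewrite /= in b1 b2.
have ue : nc u = expR a.
  by rewrite -E /expc ncM nc_real /= cos2Dsin2 sqrtr1 mulr1 ger0_norm ?expR_ge0.
have e1 : 1 - d <= expR a.
  by rewrite -ue /d; have := ncB 1 (u - 1); have := ncB_ge 1 (1 - u);
     rewrite subKr nc1 -[1 - u]opprB ncN; lra.
have e2 : expR a <= 1 + d.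
  by rewrite -ue /d; have := ncD (u - 1) 1; rewrite subrK nc1; lra.
have ea := expR_gt0 a.
have a1 : a <= d by have := expR_ge1Dx a; lra.
have a2 : - a <= 2 * d.
  have := expR_ge1Dx (- a); rewrite expRN => h.
  have : (expR a)^-1 <= 1 + 2 * d.
    by rewrite -[_^-1]mul1r ler_pdivrMr//; nra.
  lra.
have Re1 : `|expR a * cos b - 1| <= d.
  have := Re_nc (u - 1); rewrite -/d -E /expc /=; simpc.
  by rewrite /= ?mul0r ?subr0 ?mulr0.
have Im1 : `|expR a * sin b| <= d.
  have := Im_nc (u - 1); rewrite -/d -E /expc /=; simpc.
  by rewrite /= ?mul0r ?addr0 ?mulr0.
have cb : 3^-1 <= cos b.
  move: Re1; rewrite ler_norml => /andP[h _].
  by rewrite leNgt; apply/negP => cb; nra.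
have sb : `|sin b| <= 2 * d.
  by move: Im1; rewrite normrM (gtr0_norm ea); have := normr_ge0 (sin b); nra.
have bd : `|b| <= 6 * d.
  have bp : 0 <= `|b| <= pi.
    by rewrite normr_ge0 ler_norml b2 andbT ltW.
  have := sin_ge_cos_arg bp; rewrite cos_norm.
  have : sin `|b| <= `|sin b|.
    have [b0|b0] := ger0P b; first exact: ler_norm.
    by rewrite sinN -normrN ler_norm.
  by have := normr_ge0 b; nra.
apply: le_trans (nc_le_ReIm _) _ => /=.
have : `|a| <= 2 * d by rewrite ler_norml; apply/andP; split; lra.
lra.
Qed.

End ComplexExp.

(** * Absolutely convergent sums *)

Section AbsoluteSums.
Variables (R : realType) (I : choiceType).
Local Notation C := (R[i]).
Local Notation nc := (@Normc.normc R).
Implicit Types (D : set I) (f g : I -> C) (r : seq I).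

Lemma nc_sum r f : nc (\sum_(i <- r) f i) <= \sum_(i <- r) nc (f i).
Proof.
elim: r => [|i r IH]; first by rewrite !big_nil nc0.
by rewrite !big_cons; apply: le_trans (ncD _ _) _; rewrite lerD2l.
Qed.

Lemma sum_sub_seq (F : I -> R) r s : (forall i, 0 <= F i) -> uniq r -> uniq s ->
  {subset r <= s} -> \sum_(i <- r) F i <= \sum_(i <- s) F i.
Proof.
move=> F0 ur us rs; rewrite [leRHS](bigID (mem r)) /= -[X in _ <= X + _]big_filter.
have P : perm_eq [seq i <- s | i \in r] r.
  apply: uniq_perm; rewrite ?filter_uniq// => i; rewrite mem_filter /=.
  by case: (boolP (i \in r)) => //= /rs ->.
by rewrite (perm_big r P) lerDl sumr_ge0.
Qed.

Definition seq_in D r := uniq r /\ (forall i, i \in r -> D i).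

Lemma fsets_seq D A : fsets D A -> exists2 r, seq_in D r & A = [set` r].
Proof.
move=> [fA AD]; have /finite_seqP[r rA] := fA.
exists (undup r); last by rewrite rA; apply/seteqP; split=> i /=; rewrite mem_undup.
by split; [exact: undup_uniq|move=> i; rewrite mem_undup => ir; apply: AD; rewrite rA].
Qed.

Lemma fsum_seq (V : zmodType) (F : I -> V) r : uniq r ->
  \sum_(i \in [set` r]) F i = \sum_(i <- r) F i.
Proof. by move=> ur; rewrite -fsbig_seq. Qed.

Lemma fsum_seqE (F : I -> R) r : uniq r ->
  (\sum_(i \in [set` r]) (F i)%:E = (\sum_(i <- r) F i)%:E)%E.
Proof. by move=> ur; rewrite -fsbig_seq// sumEFin. Qed.

Lemma abs_summable_bound D f B :
  (forall r, seq_in D r -> \sum_(i <- r) nc (f i) <= B) -> abs_summable D f.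
Proof.
move=> h; apply: le_lt_trans (ltry B); apply: ub_ereal_sup => _ [A /fsets_seq[r rD ->] <-].
by rewrite fsum_seqE ?rD.1// lee_fin; exact: h.
Qed.

Lemma abs_summable_le D f : abs_summable D f ->
  exists B, forall r, seq_in D r -> \sum_(i <- r) nc (f i) <= B.
Proof.
rewrite /abs_summable; set S := (X in (X < _)%E) => Sfin.
have Sge r : seq_in D r -> ((\sum_(i <- r) nc (f i))%:E <= S)%E.
  move=> [ur rD]; apply: esum_ge; exists [set` r]; last by rewrite fsum_seqE.
  by split; [exact: finite_seq|move=> i; exact: rD].
exists (fine S) => r /Sge; move: Sfin; case: (S) => //= x _.
Qed.

Lemma abs_summable_dom D f g (B : R) : abs_summable D g ->
  (forall i, D i -> nc (f i) <= B * nc (g i)) -> abs_summable D f.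
Proof.
move=> /abs_summable_le[M hM] fg.
apply: (@abs_summable_bound _ _ (`|B| * M)) => r rD.
apply: le_trans (_ : \sum_(i <- r) `|B| * nc (g i) <= _).
  rewrite !big_seq; apply: ler_sum => i ir; apply: le_trans (fg i (rD.2 i ir)) _.
  by rewrite ler_wpM2r ?nc_ge0// ler_norm.
by rewrite -mulr_sumr ler_wpM2l//; exact: hM.
Qed.

Lemma abs_summable_finite D f (d : R) : abs_summable D f -> 0 < d ->
  finite_set [set i | D i /\ d <= nc (f i)].
Proof.
move=> /abs_summable_le[B hB] d0; apply: contrapT => inf.
have [X0 X0A nX] := infinite_set_fset (Num.truncn (B / d)).+1 inf.
pose X := finmap.enum_fset X0.
have XA i : i \in X -> D i /\ d <= nc (f i) by move=> iX; exact: (X0A i iX).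
have rD : seq_in D X by split; [exact: finmap.fset_uniq|move=> i /XA[]].
have := hB X rD; apply/negP; rewrite -ltNge.
have : B / d < (Num.truncn (B / d)).+1%:R by exact: truncnS_gt.
rewrite ltr_pdivrMr// => lt; apply: lt_le_trans lt _.
apply: le_trans (_ : \sum_(i <- X) d <= _); last first.
  by rewrite !big_seq; apply: ler_sum => i /XA[].
rewrite big_const_seq count_predT iter_addr_0 -[d *+ _]mulr_natl.
by apply: ler_wpM2r; [exact: ltW|rewrite ler_nat].
Qed.

(** Only finitely many terms of g have modulus at least d; for those the constant is enlarged by the
    sum of their |f| divided by d. *)
Lemma abs_summable_dom_eventually D f g (B d : R) : abs_summable D g -> 0 < d ->
  (forall i, D i -> nc (g i) < d -> nc (f i) <= B * nc (g i)) -> abs_summable D f.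
Proof.
move=> sg d0 fg; have fin := abs_summable_finite sg d0.
set E := [set i | _] in fin.
have [r rE Er] := fsets_seq (conj fin (@subset_refl _ E)).
apply: (abs_summable_dom (B := `|B| + (\sum_(i <- r) nc (f i)) / d) sg) => i Di.
have S0 : 0 <= \sum_(i <- r) nc (f i) by apply: sumr_ge0 => j _; exact: nc_ge0.
have [gd|gd] := ltP (nc (g i)) d.
  apply: le_trans (fg i Di gd) _; rewrite ler_wpM2r ?nc_ge0//.
  by rewrite -[leLHS]addr0 lerD ?ler_norm// divr_ge0// ltW.
have ir : i \in r by have : E i by []; rewrite Er.
have fS : nc (f i) <= \sum_(i <- r) nc (f i).
  rewrite (big_rem i)//= lerDl sumr_ge0// => j _; exact: nc_ge0.
rewrite mulrDl; apply: le_trans (_ : (\sum_(i <- r) nc (f i)) / d * nc (g i) <= _).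
  by apply: le_trans fS _; rewrite mulrAC ler_pdivlMr// ler_wpM2l.
by rewrite lerDr mulr_ge0 ?nc_ge0.
Qed.

(** The limit is the supremum of the eventual lower bounds. *)
Lemma real_cauchy (u : nat -> R) :
  (forall eps, 0 < eps -> exists m0, forall m n, (m0 <= m)%N -> (m0 <= n)%N ->
     u m <= u n + eps) ->
  exists l, forall eps, 0 < eps -> exists m0, forall m, (m0 <= m)%N -> `|u m - l| <= eps.
Proof.
move=> cu; pose A := [set x | exists m0, forall m, (m0 <= m)%N -> x <= u m].
have [M hM] := cu 1 ltr01.
have supA : has_sup A.
  split.
    by exists (u M - 1), M => m Mm; have := hM M m (leqnn _) Mm; lra.
  exists (u M + 1) => x [m0 h]; apply: le_trans (h (maxn m0 M) (leq_maxl _ _)) _.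
  by apply: hM => //; exact: leq_maxr.
exists (sup A) => eps e0; have [m0 h] := cu (eps / 2) ltac:(lra).
have h1 : sup A <= u m0 + eps / 2.
  apply: ge_sup; first by case: supA.
  move=> x [m1 h1]; apply: le_trans (h1 (maxn m1 m0) (leq_maxl _ _)) _.
  by apply: h => //; exact: leq_maxr.
have h2 : u m0 - eps / 2 <= sup A.
  apply: ub_le_sup; first by case: supA.
  by exists m0 => m hm; have := h m0 m (leqnn _) hm; lra.
exists m0 => m hm; have := h m0 m (leqnn _) hm; have := h m m0 hm (leqnn _).
by rewrite ler_norml => ? ?; apply/andP; split; lra.
Qed.

(** * Unordered sums along an exhaustion of the index set *)

Section Exhaustion.
Variables (D : set I) (L : nat -> seq I).
Hypothesis LD : forall m, seq_in D (L m).
Hypothesis Lex : forall i, D i -> exists m0, forall m, (m0 <= m)%N -> i \in L m.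

Lemma exhaust_seq r : (forall i, i \in r -> D i) ->
  exists m0, forall m, (m0 <= m)%N -> {subset r <= L m}.
Proof.
elim: r => [|i r IH] h; first by exists 0%N.
have [|m1 h1] := IH; first by move=> j jr; apply: h; rewrite inE jr orbT.
have [m2 h2] := Lex (h i (mem_head _ _)).
exists (maxn m1 m2) => m; rewrite geq_max => /andP[/h1 k1 /h2 k2] j.
by rewrite inE => /orP[/eqP ->|/k1].
Qed.

Lemma abs_summable_exhaust f B : (forall m, \sum_(i <- L m) nc (f i) <= B) ->
  abs_summable D f.
Proof.
move=> h; apply: (@abs_summable_bound _ _ B) => r [ur rD].
have [m0 hm] := exhaust_seq rD; apply: le_trans (h m0).
by apply: sum_sub_seq; rewrite ?(LD m0).1//; [move=> i; exact: nc_ge0|exact: hm].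
Qed.

(** r0 is chosen with its sum of moduli within eps of the supremum of all such sums. *)
Lemma abs_summable_tail f (eps : R) : abs_summable D f -> 0 < eps ->
  exists2 r0, seq_in D r0 & forall r, seq_in D r -> {subset r0 <= r} ->
    nc (\sum_(i <- r) f i - \sum_(i <- r0) f i) <= eps.
Proof.
move=> /abs_summable_le[B hB] e0.
pose S := [set x | exists2 r, seq_in D r & x = \sum_(i <- r) nc (f i)].
have supS : has_sup S.
  split; first by exists 0, [::]; [split|rewrite big_nil].
  by exists B => _ [r rD ->]; exact: hB.
have [_ [r0 r0D ->] Sr0] := sup_adherent e0 supS.
exists r0 => // r [ur rD] r0r; have [ur0 _] := r0D.
have split_sum (V : zmodType) (F : I -> V) : \sum_(i <- r) F i - \sum_(i <- r0) F i =
    \sum_(i <- [seq i <- r | i \notin r0]) F i.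
  rewrite (bigID (mem r0)) /= -[X in X + _ - _]big_filter.
  have P : perm_eq [seq i <- r | i \in r0] r0.
    apply: uniq_perm; rewrite ?filter_uniq// => i; rewrite mem_filter /=.
    by case: (boolP (i \in r0)) => //= /r0r ->.
  by rewrite (perm_big r0 P) addrAC subrr add0r big_filter.
rewrite split_sum; apply: le_trans (nc_sum _ _) _; rewrite -split_sum.
have : \sum_(i <- r) nc (f i) <= sup S.
  by apply: ub_le_sup; [case: supS|exists r].
lra.
Qed.

Lemma has_sum_exhaust f s : abs_summable D f ->
  (forall eps : R, 0 < eps -> exists m0, forall m, (m0 <= m)%N ->
     nc (\sum_(i <- L m) f i - s) <= eps) -> has_sum D f s.
Proof.
move=> sf lim eps e0.
have [r0 [ur0 r0D] tail] := abs_summable_tail sf (eps := eps / 4) ltac:(lra).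
exists [set` r0]; split; [exact: finite_seq|by move=> i /r0D|move=> A fA r0A AD].
have [r rD AE] := fsets_seq (conj fA AD); rewrite AE in r0A *.
rewrite fsum_seq ?rD.1//.
have [m1 h1] := lim (eps / 4) ltac:(lra); have [m2 h2] := exhaust_seq r0D.
pose m := maxn m1 m2.
have tr := tail r rD r0A; have tm := tail (L m) (LD m) (h2 m (leq_maxr _ _)).
have lm := h1 m (leq_maxl _ _).
have -> : \sum_(i <- r) f i - s = (\sum_(i <- r) f i - \sum_(i <- r0) f i) -
   (\sum_(i <- L m) f i - \sum_(i <- r0) f i) + (\sum_(i <- L m) f i - s) by ring.
apply: le_lt_trans (ncD _ _) _; have := ncB (\sum_(i <- r) f i - \sum_(i <- r0) f i)
   (\sum_(i <- L m) f i - \sum_(i <- r0) f i).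
lra.
Qed.

Lemma exhaust_lim f : abs_summable D f -> exists s, forall eps : R, 0 < eps ->
  exists m0, forall m, (m0 <= m)%N -> nc (\sum_(i <- L m) f i - s) <= eps.
Proof.
move=> sf; pose u m := \sum_(i <- L m) f i.
have cu (eps : R) : 0 < eps -> exists m0, forall m n, (m0 <= m)%N -> (m0 <= n)%N ->
    nc (u m - u n) <= eps.
  move=> e0; have [r0 [ur0 r0D] tail] := abs_summable_tail sf (eps := eps / 2) ltac:(lra).
  have [m0 hm] := exhaust_seq r0D; exists m0 => m n /hm km /hm kn.
  have tm := tail _ (LD m) km; have tn := tail _ (LD n) kn.
  have -> : u m - u n = (u m - \sum_(i <- r0) f i) - (u n - \sum_(i <- r0) f i) by ring.
  apply: le_trans (ncB _ _) _; rewrite -/(u m) -/(u n) in tm tn; lra.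
have [lr hr] : exists l, forall eps, 0 < eps -> exists m0, forall m, (m0 <= m)%N ->
    `|complex.Re (u m) - l| <= eps.
  apply: real_cauchy => eps /cu[m0 h]; exists m0 => m n hm hn.
  have := le_trans (Re_nc _) (h m n hm hn); case: (u m) => a b; case: (u n) => a' b' /=.
  by rewrite ler_norml => /andP[_]; lra.
have [li hi] : exists l, forall eps, 0 < eps -> exists m0, forall m, (m0 <= m)%N ->
    `|complex.Im (u m) - l| <= eps.
  apply: real_cauchy => eps /cu[m0 h]; exists m0 => m n hm hn.
  have := le_trans (Im_nc _) (h m n hm hn); case: (u m) => a b; case: (u n) => a' b' /=.
  by rewrite ler_norml => /andP[_]; lra.
exists (lr +i* li) => eps e0.
have [m1 h1] := hr (eps / 2) ltac:(lra); have [m2 h2] := hi (eps / 2) ltac:(lra).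
exists (maxn m1 m2) => m; rewrite geq_max => /andP[/h1 k1 /h2 k2]; rewrite -/(u m).
apply: le_trans (nc_le_ReIm _) _; move: k1 k2; case: (u m) => a b /=; lra.
Qed.

End Exhaustion.

End AbsoluteSums.

(** * The summand *)

Section Summand.
Variable R : realType.
Local Notation C := (R[i]).
Local Notation nc := (@Normc.normc R).
Variable tau : C.
Implicit Types (w : C).

Definition tau_c : C := expc (acoshc (- tau / 2)) - 1.
Local Notation c := tau_c.
Local Notation mu := (tau + 2).

Let tE : 1 + c = expc (acoshc (- tau / 2)).
Proof. by rewrite /tau_c addrC subrK. Qed.

Lemma tau_c_neq0 : 1 + c != 0. Proof. by rewrite tE expc_neq0. Qed.

Lemma tau_c_inv : (1 + c) + (1 + c)^-1 = - tau.
Proof.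
have [E _ _ _] := acoshcP (- tau / 2); rewrite tE -expcN.
by move: E; rewrite /coshc; apply: mulIf; rewrite invr_neq0// pnatr_eq0.
Qed.

Lemma tau_c_mu : (1 + c) * mu = - c ^+ 2.
Proof.
have -> : tau = - ((1 + c) + (1 + c)^-1) by rewrite tau_c_inv opprK.
have t0 := tau_c_neq0.
transitivity (- (1 + c) ^+ 2 - (1 + c) * (1 + c)^-1 + 2 * (1 + c)); first by ring.
by rewrite mulfV//; ring.
Qed.

Lemma tau_cE0 : tau = -2 -> c = 0.
Proof.
move=> t2; have := tau_c_mu; rewrite t2 addNr mulr0 => /esym/eqP.
by rewrite oppr_eq0 sqrf_eq0 => /eqP.
Qed.

Lemma tau_c_eq0 : c = 0 -> tau = -2.
Proof.
by move=> c0; have := tau_c_mu; rewrite c0 addr0 mul1r expr0n oppr0 => /eqP;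
  rewrite addr_eq0 => /eqP.
Qed.

Lemma tau_c_neqN2 : tau <> 2 -> 2 + c != 0.
Proof.
move=> t2; apply/eqP => c2; apply: t2; have := tau_c_inv.
have -> : 1 + c = -1 by rewrite -[c](addKr 2) c2; ring.
by rewrite invrN1 => /(congr1 -%R); rewrite opprK => <-; ring.
Qed.

Lemma hfrak_definedP w : hfrak_defined tau w <-> regular_trace mu w.
Proof.
have sq := sqr_sqrtc mu; split=> [[w0 h]|[w0 h]].
  split; first exact/eqP.
  apply/eqP => E; have [t2|t2] := eqVneq tau (-2).
    by move: E; rewrite t2 addNr => /eqP; rewrite sqrf_eq0 => /eqP.
  have [h1 h2] := h (elimN eqP t2); move/eqP: E; rewrite -sq eqf_sqr.
  by move=> /orP[/eqP|/eqP].
split; first exact/eqP.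
by move=> _; split=> E; move/eqP: h; apply; rewrite E ?sqrrN.
Qed.

Lemma hfun_tau_logc w : regular_trace mu w -> hfun_tau tau w = logc (Qfac c mu w).
Proof.
move=> rw; have t0 := tau_c_neq0; rewrite /hfun_tau /= -/tau_c expcN -tE.
congr (logc _).
have H0 := hfac_neq0 tau_c_mu t0 rw; have g0 := gap_neq0 rw.
have -> : 1 + ((1 + c)^-1 - 1) * hfun w = gap mu w / hfac c w.
  apply: (mulIf H0); rewrite divfK//; apply: (mulfI t0).
  rewrite -(hfac_gap tau_c_mu rw.1) /hfac; field; exact: t0.
by rewrite /Qfac -/(hfac c w); field; rewrite H0 g0.
Qed.

(** Measures the exponential of the summand against 1, for the bounds from above and from below. The
    factor c (2 + c) vanishes only for tau = -2 and tau = 2. *)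
Lemma Qfac_sub1 w : regular_trace mu w ->
  (Qfac c mu w - 1) * (1 + c - c * hfun w) = c * (2 + c) * hfun w.
Proof.
move=> rw; have t0 := tau_c_neq0; have H0 := hfac_neq0 tau_c_mu t0 rw.
have g0 := gap_neq0 rw; have E := hfac_gap tau_c_mu rw.1.
have -> : (Qfac c mu w - 1) * (1 + c - c * hfun w) =
    hfac c w * (hfac c w * (1 + c - c * hfun w)) / gap mu w - (1 + c - c * hfun w).
  by rewrite /Qfac; ring.
by rewrite E mulrA mulfK// /hfac; ring.
Qed.

Lemma expc_hfrak w : tau <> -2 -> regular_trace mu w ->
  expc (hfrak tau w) = Qfac c mu w.
Proof.
move=> /eqP/negbTE t2 rw; rewrite /hfrak t2 hfun_tau_logc//.
by have [] := logcP (Qfac_neq0 tau_c_mu tau_c_neq0 rw).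
Qed.

Lemma hfrak_le : exists B d : R, 0 < d /\ forall w, regular_trace mu w ->
  nc (w ^- 2) < d -> nc (hfrak tau w) <= B * nc (w ^- 2).
Proof.
have hw w : regular_trace mu w -> nc (hfun w) <= 2 * nc (w ^- 2).
  by move=> [w0 _]; rewrite ncV ncX; exact: nc_hfun_le.
have [t2|t2] := eqVneq tau (-2).
  by exists 2, 1; split=> // w /hw; rewrite /hfrak t2 eqxx.
have t0 : 0 < nc (1 + c) by rewrite nc_gt0 tau_c_neq0.
set T := nc (1 + c) in t0; have cc := nc_ge0 c; have c2 := nc_ge0 (2 + c).
(* Small enough for |c h| <= |1 + c| / 2 and |Q - 1| <= 1/2, the range of [nc_logc]. *)
pose d := T / (8 * (nc c + 1) * (nc (2 + c) + 1)).
have den : 0 < 8 * (nc c + 1) * (nc (2 + c) + 1) by rewrite !mulr_gt0//; lra.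
have d0 : 0 < d by rewrite divr_gt0.
exists (32 * (nc c * nc (2 + c)) / T), d; split=> // w rw wd.
have h := hw w rw; have h0 := nc_ge0 (hfun w).
have dT : d * (8 * (nc c + 1) * (nc (2 + c) + 1)) = T by rewrite divfK// gt_eqF.
have w20 := nc_ge0 (w ^- 2).
rewrite /hfrak (negbTE t2) hfun_tau_logc//.
have ch : nc c * nc (hfun w) <= T / 2.
  have : nc c * nc (hfun w) <= nc c * (2 * d) by rewrite ler_wpM2l//; lra.
  have cd0 : 0 <= nc c * d by rewrite mulr_ge0// ltW.
  have : nc c * d <= nc c * d * (nc (2 + c) + 1) by rewrite ler_peMr//; lra.
  have : 0 <= d * (nc (2 + c) + 1) by apply: mulr_ge0; lra.
  have : 0 <= nc c * d * (nc (2 + c) + 1) by apply: mulr_ge0; lra.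
  lra.
have den2 : T / 2 <= nc (1 + c - c * hfun w).
  by have := ncB_ge (1 + c) (c * hfun w); rewrite ncM -/T; lra.
have := congr1 nc (Qfac_sub1 rw).
rewrite (ncM (Qfac c mu w - 1)) (ncM (c * (2 + c))) (ncM c) => E.
have q0 := nc_ge0 (Qfac c mu w - 1).
have Q1 : nc (Qfac c mu w - 1) <= 4 * (nc c * nc (2 + c)) / T * nc (w ^- 2).
  rewrite mulrAC ler_pdivlMr//.
  have : nc (Qfac c mu w - 1) * (T / 2) <= nc c * nc (2 + c) * nc (hfun w).
    by rewrite -E ler_wpM2l.
  have : nc c * nc (2 + c) * nc (hfun w) <= nc c * nc (2 + c) * (2 * nc (w ^- 2)).
    by rewrite ler_wpM2l// mulr_ge0.
  lra.
have Q2 : nc (Qfac c mu w - 1) <= 2^-1.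
  apply: le_trans Q1 _; rewrite mulrAC ler_pdivrMr// -dT.
  have : nc c * nc (2 + c) * nc (w ^- 2) <= nc c * nc (2 + c) * d.
    by rewrite ler_wpM2l ?mulr_ge0// ltW.
  have : 0 <= nc c * d by rewrite mulr_ge0// ltW.
  have : 0 <= nc (2 + c) * d by rewrite mulr_ge0// ltW.
  lra.
apply: le_trans (nc_logc Q2) _.
have -> : 32 * (nc c * nc (2 + c)) / T * nc (w ^- 2) =
  8 * (4 * (nc c * nc (2 + c)) / T * nc (w ^- 2)) by ring.
by rewrite ler_pM2l.
Qed.

(** A bounded trace keeps h, and with it Q - 1, away from 0; the logarithm is then away from 0 since
    exp is continuous there. *)
Lemma hfrak_ge (B : R) : tau <> 2 -> exists2 d : R, 0 < d &
  forall w, regular_trace mu w -> nc w <= B -> d <= nc (hfrak tau w).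
Proof.
move=> tn2; pose e : R := Num.min 1 (2 * (`|B| + 1) ^+ 2)^-1.
have B1 : 0 < `|B| + 1 by rewrite ltr_wpDl.
have e0 : 0 < e by rewrite lt_min ltr01 invr_gt0 mulr_gt0 ?exprn_gt0.
have hw w : regular_trace mu w -> nc w <= B -> e <= nc (hfun w).
  move=> [w0 _] wB; have wB' : nc w <= `|B| + 1.
    by have := ler_norm B; lra.
  by rewrite ge_min; case: (nc_hfun_ge w0 wB') => ->; rewrite ?orbT.
have [t2|t2] := eqVneq tau (-2).
  by exists e => // w; rewrite /hfrak t2 eqxx; rewrite t2 in hw; exact: hw.
have c0 : c != 0 by apply: contra t2 => /eqP/tau_c_eq0 ->.
have c2 := tau_c_neqN2 tn2.
have t0 : 0 < nc (1 + c) by rewrite nc_gt0 tau_c_neq0.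
set T := nc (1 + c) in t0; have cc : 0 < nc c by rewrite nc_gt0.
have cc2 : 0 < nc (2 + c) by rewrite nc_gt0.
have P0 : 0 < nc c * nc (2 + c) by rewrite mulr_gt0.
have D0 : 0 < T + nc c * e by rewrite addr_gt0// mulr_gt0.
(* h has no upper bound here, but u / (T + |c| u) increases with u, so its value at the lower bound
   e of |h| serves. *)
pose th := nc c * nc (2 + c) * e / (T + nc c * e).
have th0 : 0 < th by rewrite divr_gt0// mulr_gt0.
have [d d0 near] := expc_near0 th0; exists d => // w rw wB.
rewrite leNgt; apply/negP => /near; apply/negP; rewrite -leNgt.
rewrite expc_hfrak//; last exact/eqP.
have h := hw w rw wB.
have := congr1 nc (Qfac_sub1 rw).
rewrite (ncM (Qfac c mu w - 1)) (ncM (c * (2 + c))) (ncM c) => E.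
have den := ncB (1 + c) (c * hfun w); rewrite ncM -/T in den.
have q0 := nc_ge0 (Qfac c mu w - 1).
rewrite /th ler_pdivrMr//.
have : nc c * nc (2 + c) * nc (hfun w) <= nc (Qfac c mu w - 1) * (T + nc c * nc (hfun w)).
  by rewrite -E ler_wpM2l.
move: (nc (hfun w)) h (nc (Qfac c mu w - 1)) q0 => u eu q q0 hq.
have u0 : 0 < u by lra.
rewrite -(ler_pM2r u0); apply: le_trans (_ : q * (T + nc c * u) * e <= _).
  by rewrite mulrAC ler_pM2r.
have : q * (T * e) <= q * (T * u) by rewrite ler_wpM2l// ler_pM2l.
lra.
Qed.

End Summand.

(** * The identity for periodic trees *)

Section PivotLemmas.
Variable R : realType.
Local Notation C := (R[i]).
Local Notation nc := (@Normc.normc R).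
Implicit Types (e : C * C * C) (x : C).

Lemma iter_step_pivot n e : (iter n (tstep true) e).1.1 = e.1.1.
Proof. by elim: n => [//|n IH]; rewrite iterS /= IH. Qed.

Lemma iter_step_node n e s : iter n (tstep true) (tnode e s) = tnode e (s ++ nseq n true).
Proof.
elim: n => [|n IH]; first by rewrite cats0.
by rewrite iterS IH /tnode -addn1 nseqD catA [in RHS]foldl_cat.
Qed.

Lemma iter_step_neighbour n e s : (iter n.+1 (tstep true) (tnode e s)).1.2 =
  tnew (tnode e (s ++ nseq n true)).
Proof. by rewrite iterS /= iter_step_node. Qed.

Lemma iter_step_swap_node n e s : iter n (tstep true) (tswap (tnode e s)) =
  tswap (tnode e (s ++ nseq n false)).
Proof.
elim: n => [|n IH]; first by rewrite cats0.
by rewrite iterS IH tswap_step /tnode -addn1 nseqD catA [in RHS]foldl_cat.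
Qed.

Lemma iter_step_swap_neighbour n e s :
  (iter n.+1 (tstep true) (tswap (tnode e s))).1.2 = tnew (tnode e (s ++ nseq n false)).
Proof. by rewrite iterS /= iter_step_swap_node tnew_swap. Qed.

(** The initial pair lies on the contracting eigenline of the recursion around x, so each neighbour
    is the small root times the one before. *)
Lemma fan_shrinks e : e.1.1 != 0 -> nc (small_root e.1.1) < 1 ->
  e.1.2 = small_root e.1.1 * e.2 ->
  exists n0, forall n, (n0 <= n)%N -> nc (iter n (tstep true) e).1.2 <= 2.
Proof.
move=> x0 l1 E0; set l := small_root e.1.1 in l1 E0 *.
have lx : e.1.1 = big_root e.1.1 + l by rewrite rootD.
have lM : big_root e.1.1 * l = 1 by exact: rootM.
have E n : (iter n (tstep true) e).1.2 = l * (iter n (tstep true) e).2.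
  have key z : e.1.1 * (l * z) - z = l * (l * z).
    transitivity ((big_root e.1.1 * l - 1) * z + l * (l * z)); last by rewrite lM subrr mul0r add0r.
    by rewrite [X in X * (l * z)]lx; ring.
  by elim: n => [//|n IH]; rewrite iterS /= /tnew iter_step_pivot IH key.
have yE n : (iter n (tstep true) e).1.2 = l ^+ n * e.1.2.
  elim: n => [|n IH]; first by rewrite expr0 mul1r.
  by rewrite E iterS /= IH exprS mulrA.
have l0 := nc_ge0 l; have b0 := nc_ge0 e.1.2.
have lnz : 0 < nc l.
  by rewrite nc_gt0; apply/eqP => l00; move/eqP: lM; rewrite l00 mulr0 eq_sym oner_eq0.
have d0 : 0 < (nc l)^-1 - 1 by rewrite subr_gt0 invf_gt1.
have bern (r : R) k : 1 <= r -> 1 + k%:R * (r - 1) <= r ^+ k.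
  move=> r1; elim: k => [|k IH]; first by rewrite mul0r addr0 expr0.
  have k0 : 0 <= k%:R :> R by [].
  rewrite exprS; apply: le_trans (_ : r * (1 + k%:R * (r - 1)) <= _); last first.
    by rewrite ler_wpM2l//; lra.
  have : 0 <= k%:R * (r - 1) * (r - 1) by rewrite !mulr_ge0//; lra.
  by rewrite -addn1 natrD; lra.
exists (Num.truncn (nc e.1.2 / ((nc l)^-1 - 1))).+1 => n hn.
rewrite yE ncM ncX.
have kn : nc e.1.2 / ((nc l)^-1 - 1) < n%:R.
  by apply: lt_le_trans (truncnS_gt _) _; rewrite ler_nat.
rewrite ltr_pdivrMr// in kn.
have := bern (nc l)^-1 n; rewrite invf_ge1// ltW// => /(_ isT); rewrite exprVn => le.
have ln0 : 0 < nc l ^+ n by rewrite exprn_gt0.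
rewrite mulrC -ler_pdivlMr// mulrC.
move: (n%:R * _) kn le => q kn le; move: (nc l ^+ n)^-1 le => p le.
lra.
Qed.

(* Around a pivot in (-2, 2) the traces stay bounded: the Hermitian form
   |y|^2 + |z|^2 - r Re (y z^* ) is invariant and definite. *)
Lemma fan_bounded e : in_open_m2_2 e.1.1 ->
  exists B, forall n, nc (iter n (tstep true) e).1.2 <= B.
Proof.
move=> [r /andP[r1 r2] xE].
pose q (y z : C) : R := nc y ^+ 2 + nc z ^+ 2 -
  r * (complex.Re y * complex.Re z + complex.Im y * complex.Im z).
have qS n : q (iter n (tstep true) e).1.2 (iter n (tstep true) e).2 = q e.1.2 e.2.
  elim: n => [//|n <-]; rewrite iterS /= /tnew iter_step_pivot xE /q !nc_sqr.
  by case: (iter n _ _) => [[u [y1 y2]] [z1 z2]] /=; simpc => /=; ring.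
pose B := 1 + q e.1.2 e.2 / (1 - `|r| / 2).
have r3 : 0 < 1 - `|r| / 2.
  have : `|r| < 2 by rewrite ltr_norml r1 r2.
  lra.
exists B => n; set y := (iter n _ _).1.2; set z := (iter n (tstep true) e).2.
have : (1 - `|r| / 2) * nc y ^+ 2 <= q e.1.2 e.2.
  rewrite -(qS n) -/y -/z /q !nc_sqr.
  case: (y) (z) => [y1 y2] [z1 z2] /=.
  have a1 : 2 * `|y1 * z1 + y2 * z2| <= y1 ^+ 2 + y2 ^+ 2 + z1 ^+ 2 + z2 ^+ 2.
    rewrite -[2]ger0_norm// -normrM ler_norml; apply/andP; split.
      by have := sqr_ge0 (y1 + z1); have := sqr_ge0 (y2 + z2); rewrite !sqrrD; lra.
    by have := sqr_ge0 (y1 - z1); have := sqr_ge0 (y2 - z2); rewrite !sqrrB; lra.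
  have : r * (y1 * z1 + y2 * z2) <= `|r| * `|y1 * z1 + y2 * z2|.
    by rewrite -normrM ler_norm.
  have r0 := normr_ge0 r; have : `|r| * (2 * `|y1 * z1 + y2 * z2|) <=
      `|r| * (y1 ^+ 2 + y2 ^+ 2 + z1 ^+ 2 + z2 ^+ 2) by rewrite ler_wpM2l.
  have : `|r| * (z1 ^+ 2 + z2 ^+ 2) <= 2 * (z1 ^+ 2 + z2 ^+ 2).
    by rewrite ler_wpM2r ?addr_ge0 ?sqr_ge0//; lra.
  lra.
rewrite mulrC -ler_pdivlMr// => h.
have : nc y <= 1 + nc y ^+ 2.
  by have := sqr_ge0 (nc y - 1); have := nc_ge0 y; rewrite sqrrB; nra.
by rewrite /B; lra.
Qed.

(** For x^2 = mu the Markoff equation reduces to p^2 - x p q + q^2 = 0, which factors over the roots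
    of X^2 - x X + 1. *)
Lemma isotropic_pivot (x p q mu : C) : x != 0 ->
  x ^+ 2 = mu -> tkappa (x, p, q) = mu -> p = small_root x * q \/ p = big_root x * q.
Proof.
move=> x0 xx; rewrite /tkappa /= xx => /eqP; rewrite -subr_eq0 => /eqP E.
have : (p - small_root x * q) * (p - big_root x * q) = 0.
  transitivity (p ^+ 2 + big_root x * small_root x * q ^+ 2 -
     (big_root x + small_root x) * p * q); first by ring.
  by rewrite rootM// rootD -E; ring.
by move/eqP; rewrite mulf_eq0 !subr_eq0 => /orP[/eqP|/eqP]; [left|right].
Qed.

End PivotLemmas.

(** * Sums over one period of the tree *)

Fixpoint words m : seq (seq bool) :=
  if m is m'.+1 then
    [::] :: (map (cons true) (words m') ++ map (cons false) (words m'))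
  else [::].

Lemma mem_words m s : (s \in words m) = (size s < m)%N.
Proof.
elim: m s => [|m IH] s; first by [].
case: s => [|d s]; first by rewrite /= inE eqxx.
rewrite [words _]/= inE mem_cat /= ltnS -(IH s).
have inj b : injective (cons b : seq bool -> _) by move=> u v [].
case: d; rewrite mem_map// ?orbF; last first.
  by rewrite (_ : (_ \in map (cons true) _) = false)//; apply/mapP => -[? _ []].
by rewrite (_ : (_ \in map (cons false) _) = false) ?orbF//; apply/mapP => -[? _ []].
Qed.

Lemma uniq_words m : uniq (words m).
Proof.
elim: m => [//|m IH]; rewrite [words _]/= cons_uniq mem_cat negb_or cat_uniq.
have inj b : injective (cons b : seq bool -> _) by move=> u v [].
rewrite !map_inj_uniq// IH /= andbT -andbA; apply/and3P; split.
- by apply/negP => /mapP[].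
- by apply/negP => /mapP[].
by apply/hasPn => _ /mapP[s _ ->]; apply/negP => /mapP[].
Qed.

Lemma region_fold_words (K : comPzRingType) (V : nmodType) (f : K -> V) m e :
  region_fold +%R 0 f m e = \sum_(s <- words m) f (tnew (tnode e s)).
Proof.
elim: m e => [|m IH] e; first by rewrite big_nil.
by rewrite region_foldS !IH big_cons big_cat !big_map.
Qed.

Lemma region_prod_words (K : comPzRingType) (V : comPzRingType) (f : K -> V) m e :
  region_fold *%R 1 f m e = \prod_(s <- words m) f (tnew (tnode e s)).
Proof.
elim: m e => [|m IH] e; first by rewrite big_nil.
by rewrite region_foldS !IH big_cons big_cat !big_map.
Qed.

Section PeriodicTree.
Variables (R : realType) (tau : R[i]) (I : choiceType) (D : set I).
Local Notation C := (R[i]).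
Local Notation nc := (@Normc.normc R).
Local Notation mu := (tau + 2).
Local Notation c := (tau_c tau).
(* phi k None is the k-th region around the fixed region, of trace x, and
   phi k (Some s) the region reached by the path s behind the k-th edge of its
   boundary; the period is N + 1. *)
Variables (phi : int -> option (seq bool) -> I) (T : I -> C).
Variables (x : C) (y : int -> C) (N : nat).
Definition root (k : int) : C * C * C := (y (k + 1), y k, x).
Hypothesis tau2 : tau <> 2.
Hypothesis kappa_root : forall k, tkappa (root k) = mu.
Hypothesis yS : forall k, y (k + 1 + 1) = x * y (k + 1) - y k.
Hypothesis T_phi : forall k o,
  T (phi k o) = if o is Some s then tnew (tnode (root k) s) else y k.
Hypothesis DE : forall O, D O <-> exists k o, O = phi k o.
Hypothesis phiE : forall k o k' o',
  phi k o = phi k' o' <-> o = o' /\ exists j : int, k = k' + j * N.+1%:Z.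
Implicit Types (k : int) (o : option (seq bool)) (s : seq bool) (m : nat).

Lemma phi_shift k j o : phi (k + j * N.+1%:Z) o = phi k o.
Proof. by apply/phiE; split=> //; exists j. Qed.

Lemma y_shift k : y (k + N.+1%:Z) = y k.
Proof. by have := T_phi (k + 1 * N.+1%:Z) None; rewrite phi_shift T_phi mul1r. Qed.

Lemma phi_mod k o : exists2 k0, (k0 < N.+1)%N & phi k o = phi (Posz k0) o.
Proof.
have := modz_ge0 k (isT : N.+1%:Z != 0); have := ltz_pmod k (isT : 0 < N.+1%:Z).
have := divz_eq k N.+1%:Z; case: (modz _ _) => // k0 E k0N _.
by exists k0 => //; rewrite E addrC phi_shift.
Qed.

Definition options m := None :: [seq Some s | s <- words m].
(** One period of the fan with the trees behind it cut at depth m; these lists exhaust the index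
    set. *)
Definition layers m : seq I := [seq phi (Posz i) o | i <- iota 0 N.+1, o <- options m].

Lemma layers_in m : seq_in D (layers m).
Proof.
split=> [|_ /allpairsP[[k o] [_ _ ->]]]; last by apply/DE; exists k, o.
apply: allpairs_uniq; first exact: iota_uniq.
  rewrite /= map_inj_uniq ?uniq_words ?andbT; last by move=> ? ? [].
  by apply/negP => /mapP[].
move=> [k o] [k' o'] /allpairsP[[? ?] [kN _ [-> ->]]].
move=> /allpairsP[[? ?] [kN' _ [-> ->]]] /phiE[/= -> [j jE]].
move: kN kN'; rewrite !mem_iota !add0n => /= kN kN'; congr pair.
have j0 : j = 0 by nia.
by move: jE; rewrite j0 mul0r addr0 => -[].
Qed.

Lemma phi_layers k s m : phi k (Some s) \in layers m -> (size s < m)%N.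
Proof.
move=> /allpairsP[[k' o] /= [_ + /phiE[so _]]]; rewrite -so inE /=.
by move=> /mapP[t ? [->]]; rewrite -mem_words.
Qed.

Lemma layers_exhaust O : D O -> exists m0, forall m, (m0 <= m)%N -> O \in layers m.
Proof.
move=> /DE[k [ o' ->]]; have [k0 kN ->] := phi_mod k o'.
exists (if o' is Some s then (size s).+1 else 0%N) => m hm.
apply/allpairsP; exists (k0, o'); split=> //; first by rewrite mem_iota.
case: o' hm => [s|] hm; last by rewrite inE.
by rewrite inE /=; apply/mapP; exists s => //; rewrite mem_words.
Qed.

Lemma sum_layers (V : zmodType) (f : C -> V) m : \sum_(O <- layers m) f (T O) =
  \sum_(k < N.+1) (f (y (Posz k)) + region_sum f m (root (Posz k))).
Proof.
rewrite /layers big_allpairs_dep -{1}[N.+1]subn0 -/(index_iota 0 N.+1) big_mkord.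
apply: eq_bigr => k _; rewrite big_cons T_phi big_map region_fold_words.
by congr (_ + _); apply: eq_bigr => s _; rewrite T_phi.
Qed.

(** The path s depends only on the orbit, so finitely many orbits occur at bounded depth, uniformly
    in k. *)
Lemma deep (B : R) : finite_set [set O | D O /\ nc (T O) <= B] ->
  exists M, forall k s, (M <= size s)%N -> B < nc (tnew (tnode (root k) s)).
Proof.
set E := [set O | _] => fin.
have [r [_ rE] Er] := fsets_seq (conj fin (@subset_refl _ E)).
have rD i : i \in r -> D i by move=> /rE[].
have [m0 hm] := exhaust_seq layers_exhaust rD.
exists m0 => k s sm; rewrite ltNge; apply/negP => le.
have /(hm _ (leqnn _))/phi_layers : phi k (Some s) \in r.
  have : E (phi k (Some s)) by split; [apply/DE; exists k, (Some s)|rewrite T_phi].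
  by rewrite Er.
by rewrite ltnNge sm.
Qed.

Lemma root_fst k : (root (k - 1)).1.1 = y k.
Proof. by rewrite /= subrK. Qed.

Lemma mu_neq4 : mu != 4.
Proof. by apply/eqP => E; apply: tau2; rewrite -[tau](addrK 2) E; ring. Qed.

(** Circling around the region reaches every depth while the traces stay bounded, which [deep]
    forbids for finitely many orbits. *)
Lemma open_infinite O : D O -> in_open_m2_2 (T O) ->
  exists B : R, infinite_set [set O | D O /\ nc (T O) <= B].
Proof.
move=> /DE[k [ o' ->]] op.
(* Every region is the first region along some edge: of one of the two edges that follow its node,
   or of the preceding boundary edge. *)
suff [k' [s E]] : exists k' s, (tnode (root k') s).1.1 = T (phi k o').
  rewrite -E in op; have [B hB] := fan_bounded op; exists B => /deep[M hM].
  have := hM k' (s ++ nseq M true); rewrite size_cat size_nseq leq_addl => /(_ isT).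
  by rewrite -iter_step_neighbour ltNge hB.
rewrite T_phi; case: o' op => [s|] _; last by exists (k - 1), [::]; exact: root_fst.
by exists k, (rcons s false); rewrite /tnode foldl_rcons.
Qed.

Section Backward.
Hypothesis notopen : forall k o, ~ in_open_m2_2 (T (phi k o)).
Variable M : nat.
Hypothesis deep2 : forall k s, (M <= size s)%N -> 2 < nc (tnew (tnode (root k) s)).

Let T_neq0 k o : T (phi k o) != 0.
Proof. by apply: not_open_neq0; exact: notopen. Qed.

(** The decaying neighbours would be regions of arbitrary depth with traces of modulus at most 2.
    [sw] tells which region along the edge is the pivot. *)
Lemma no_shrink k s (sw : bool) (e := tnode (root k) s) :
  (if sw then e.1.1 = small_root e.1.2 * e.2 else e.1.2 = small_root e.1.1 * e.2) ->
  (if sw then e.1.2 else e.1.1) != 0 -> 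
  nc (small_root (if sw then e.1.2 else e.1.1)) < 1 -> False.
Proof.
case: sw => E e0 l1.
  have [n0 h] := @fan_shrinks _ (tswap e) e0 l1 E.
  have := h (maxn n0 M).+1 (leqW (leq_maxl _ _)); rewrite iter_step_swap_neighbour.
  by rewrite leNgt deep2// size_cat size_nseq (leq_trans (leq_maxr n0 M))// leq_addl.
have [n0 h] := @fan_shrinks _ e e0 l1 E.
have := h (maxn n0 M).+1 (leqW (leq_maxl _ _)); rewrite iter_step_neighbour.
by rewrite leNgt deep2// size_cat size_nseq (leq_trans (leq_maxr n0 M))// leq_addl.
Qed.

(** Around a region with w^2 = mu consecutive neighbours have one of the two roots as quotient, so
    they decay in one of the two directions; [no_shrink] excludes either. *)
Lemma regular_phi k o : regular_trace mu (T (phi k o)).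
Proof.
have w0 := T_neq0 k o; split=> //; apply/eqP => wmu.
(* Modulus 1 would force w^2 = 4, that is mu = 4. *)
have l1 : nc (small_root (T (phi k o))) < 1.
  have [l1 b1] := nc_small_root w0; rewrite lt_neqAle l1 andbT; apply/eqP => le1.
  have := congr1 nc (rootM w0); rewrite nc1 ncM le1 mulr1 => bb.
  have [E4 _] := hfun_unit w0 (@notopen k o) bb.
  by move/eqP: mu_neq4; apply; rewrite -wmu.
move: w0 wmu l1; rewrite T_phi; case: o => [s|] w0 wmu l1.
  set e := tnode (root k) s in w0 wmu l1; have ke : tkappa (tnew e, e.1.1, e.1.2) = mu.
    by rewrite -(kappa_root k) -(tkappa_node (root k) s) -/e /tkappa /tnew /=; ring.
  have [E|E] := isotropic_pivot w0 wmu ke.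
    apply: (@no_shrink k (rcons s true) true); rewrite /tnode foldl_rcons -/(tnode _ s) -/e //=.
  apply: (@no_shrink k (rcons s false) false); rewrite /tnode foldl_rcons -/(tnode _ s) -/e //=.
  by rewrite E mulrA [small_root _ * _]mulrC rootM// mul1r.
have ke : tkappa (y k, y (k + 1), x) = mu by rewrite -(kappa_root k) /tkappa /=; ring.
have [E|E] := isotropic_pivot w0 wmu ke; first by apply: (@no_shrink k [::] true).
apply: (@no_shrink (k - 1) [::] false); rewrite /= subrK//.
have := yS (k - 1); rewrite subrK E => /eqP; rewrite eq_sym subr_eq => /eqP yE.
apply: (addrI (big_root (y k) * x)); rewrite -yE -mulrDl rootD mulrC //.
Qed.

Lemma regular_root k : regular mu (root k).
Proof.
split; first exact: kappa_root.
- by have := regular_phi (k + 1) None; rewrite T_phi.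
- by have := regular_phi k None; rewrite T_phi.
- by move=> s; have := regular_phi k (Some s); rewrite T_phi.
Qed.

Lemma convergent_root k : convergent c (root k).
Proof.
apply: (convergent_eventually_admissible (tau_c_neq0 tau) (tau_c_mu tau) mu_neq4
  (M := M) (kappa_root k)).
- by have := @notopen (k + 1) None; rewrite T_phi.
- by have := @notopen k None; rewrite T_phi.
- by move=> s; have := @notopen k (Some s); rewrite T_phi.
- by move=> s; exact: deep2.
Qed.

Lemma summable_inverse_squares : abs_summable D (fun O => (T O) ^- 2).
Proof.
have /choice[B hB] : forall k : nat, exists b : R, forall m,
    region_sum (fun w => nc w ^- 2) m (root (Posz k)) <= b.
  by move=> k; have [[B hB] _] := convergent_root (Posz k); exists B.
apply: (@abs_summable_exhaust _ _ _ _ layers_in layers_exhaust _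
  (\sum_(k < N.+1) (nc (y (Posz k)) ^- 2 + B k))) => m.
under eq_bigr => O _ do rewrite ncV ncX.
by rewrite (sum_layers (fun w => nc w ^- 2)); apply: ler_sum => k _; rewrite lerD2l.
Qed.

Lemma summable_hfrak : abs_summable D (fun O => hfrak tau (T O)).
Proof.
have [B [d [d0 h]]] := hfrak_le tau.
apply: (abs_summable_dom_eventually summable_inverse_squares d0 (B := B)).
by move=> O /DE[k [ o' ->]]; apply: h; exact: regular_phi.
Qed.

Lemma edge_sum_lim (eps : R) : 0 < eps -> exists m0, forall m, (m0 <= m)%N ->
  \sum_(k < N.+1) edge_sum (err c) m (root (Posz k)) <= eps.
Proof.
move=> e0; have e1 : 0 < eps / N.+1%:R by rewrite divr_gt0.
have /choice[M0 hM0] : forall k : nat, exists m0, forall m, (m0 <= m)%N ->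
    edge_sum (err c) m (root (Posz k)) <= eps / N.+1%:R.
  by move=> k; have [_ v] := convergent_root (Posz k); exact: v.
exists (\max_(k < N.+1) M0 k) => m hm.
apply: le_trans (_ : \sum_(k < N.+1) eps / N.+1%:R <= _).
  by apply: ler_sum => k _; apply: hM0; apply: leq_trans hm; exact: leq_bigmax.
by rewrite sumr_const card_ord -[(_ / _) *+ _]mulr_natr divfK ?pnatr_eq0.
Qed.

Let yN n : y (Posz (n + N.+1)%N) = y (Posz n).
Proof. by rewrite PoszD y_shift. Qed.

Lemma has_sum_hfrak0 : tau = -2 -> has_sum D (fun O => hfrak tau (T O)) 0.
Proof.
move=> t2; apply: (has_sum_exhaust layers_in layers_exhaust summable_hfrak) => eps e0.
have [m0 hm] := edge_sum_lim e0; exists m0 => m /hm le; rewrite subr0.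
have c0 : c = 0 by exact: tau_cE0.
have mu0 : mu = 0 by rewrite t2 addNr.
have hE w : hfrak tau w = hfun w by rewrite /hfrak t2 eqxx.
under eq_bigr => O _ do rewrite hE.
rewrite (sum_layers (@hfun R)).
have psi0 : \sum_(k < N.+1) psi (root (Posz k)) = 0.
  rewrite -[RHS](fan_sum (mu := mu) (x := x) (y := fun n => y (Posz n)) (N := N))//.
  - by apply: eq_bigr => k _; rewrite /root -PoszD addn1.
  - by move=> n; have := yS (Posz n); rewrite -!PoszD !addn1.
  - by move=> n; have := kappa_root (Posz n); rewrite /root -PoszD addn1.
  - by move=> n; have := regular_phi (Posz n) None; rewrite T_phi.
(* Each boundary region lies along two consecutive root edges; over a period both counts agree. *)
have hy : \sum_(k < N.+1) hfun (y (Posz k + 1)) = \sum_(k < N.+1) hfun (y (Posz k)).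
  rewrite big_ord_recr [RHS]big_ord_recl /= addrC; congr (_ + _).
    by have := yN 0; rewrite add0n -addn1 PoszD => ->.
  by apply: eq_bigr => k _; rewrite /bump /= -PoszD addn1 add1n.
have : nc (\sum_(k < N.+1) (psi (root (Posz k)) - (hfun (y (Posz k + 1)) +
   hfun (y (Posz k)) + 2 * region_sum (@hfun R) m (root (Posz k))))) <= eps.
  apply: le_trans (nc_sum _ _) _; apply: le_trans le; apply: ler_sum => k _.
  by rewrite c0; apply: region_sum_hfun; rewrite -mu0; exact: regular_root.
have key (p q r : 'I_N.+1 -> C) : \sum_i p i = \sum_i q i ->
    \sum_i (p i + q i + 2 * r i) = 2 * \sum_i (q i + r i).
  by move=> pq; rewrite !big_split /= pq -mulr_sumr; ring.
rewrite sumrB psi0 sub0r ncN (key _ _ (fun i => region_sum _ m (root (Posz i))) hy).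
set u := \sum_i _; rewrite (ncM 2 u) nc_nat; have := nc_ge0 u; lra.
Qed.

Lemma expc_region_sum m k : tau <> -2 ->
  expc (region_sum (hfrak tau) m (root k)) = region_prod (Qfac c mu) m (root k).
Proof.
move=> t2; rewrite region_fold_words expc_sum region_prod_words; apply: eq_bigr => s _.
by rewrite expc_hfrak//; have := regular_phi k (Some s); rewrite T_phi.
Qed.

Lemma prod_near1 n (a : nat -> C) (r : nat -> R) :
  (forall k : nat, nc (a k - 1) <= expR (r k) - 1) ->
  nc (\prod_(k < n) a k - 1) <= expR (\sum_(k < n) r k) - 1.
Proof.
move=> h; elim: n => [|n IH]; first by rewrite !big_ord0 expR0 !subrr nc0.
by rewrite !big_ord_recr /=; apply: nc_prod_sub1.
Qed.

(** The partial sums satisfy exp(S_m) E_m = 1 with E_m tending to 1, so their limit S, which exists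
    by absolute convergence, satisfies exp S = 1. *)
Lemma has_sum_hfrak : tau <> -2 -> exists k : int,
  has_sum D (fun O => hfrak tau (T O)) (0 +i* (2 * pi * k%:~R)).
Proof.
move=> t2; have c0 : c != 0 by apply/eqP => /tau_c_eq0.
have [S lim] := exhaust_lim layers_in layers_exhaust summable_hfrak.
suff S1 : expc S = 1.
  have [k SE] := expc_eq1 S1; exists k; rewrite -SE.
  exact: (has_sum_exhaust layers_in layers_exhaust summable_hfrak).
pose E m := \prod_(k < N.+1) edge_prod (fun e => Psi c e / Hfac c e) m (root (Posz k)).
have SE m : expc (\sum_(O <- layers m) hfrak tau (T O)) * E m = 1.
  rewrite (sum_layers (hfrak tau)) expc_sum -big_split /=.
  rewrite -[RHS](fan_prod_Qfac (c := c) (mu := mu) (x := x) (y := fun n => y (Posz n))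
    (N := N) (tau_c_mu tau))//.
  - apply: eq_bigr => k _; rewrite expcD expc_region_sum// -mulrA.
    rewrite region_prod_Qfac ?tau_c_neq0//; [|exact: tau_c_mu|exact: regular_root].
    rewrite expc_hfrak//; first by rewrite /root -PoszD addn1.
    by have := regular_phi (Posz k) None; rewrite T_phi.
  - by move=> n; have := yS (Posz n); rewrite -!PoszD !addn1.
  - by move=> n; have := kappa_root (Posz n); rewrite /root -PoszD addn1.
  - by move=> n; have := regular_phi (Posz n) None; rewrite T_phi.
  - exact: tau_c_neqN2.
  - exact: tau_c_neq0.
have E1 m : nc (E m - 1) <=
    expR (nc c * \sum_(k < N.+1) edge_sum (err c) m (root (Posz k))) - 1.
  rewrite mulr_sumr; apply: (@prod_near1 N.+1 (fun i => edge_prod _ m (root (Posz i)))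
    (fun i => nc c * edge_sum (err c) m (root (Posz i)))) => i.
  by apply: (edge_prod_err (mu := mu)); [exact: tau_c_mu|exact: tau_c_neq0|exact: regular_root].
apply/eqP; rewrite -subr_eq0 -nc_eq0; apply/eqP/le_anti; rewrite nc_ge0 andbT.
apply/ler_addgt0Pr => eps e0; rewrite add0r.
have S0 := nc_ge0 (expc S); pose d : R := eps / (2 * (nc (expc S) + 1)).
have d0 : 0 < d by rewrite divr_gt0//; lra.
have l0 : 0 < ln (1 + d) / (nc c + 1) by rewrite divr_gt0 ?ln_gt0//; have := nc_ge0 c; lra.
have [m1 h1] := edge_sum_lim l0.
have [d' d'0 h3] := expc_near0 (eps := eps / 2) ltac:(lra).
have [m2 h2] := lim (d' / 2) ltac:(lra).
pose m := maxn m1 m2; have k1 := h1 m (leq_maxl _ _); have k2 := h2 m (leq_maxr _ _).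
set Sm := \sum_(O <- _) _ in k2.
have A : nc (E m - 1) <= d.
  apply: le_trans (E1 m) _; rewrite lerBlDl -[leRHS]lnK ?posrE; last by lra.
  rewrite ler_expR; apply: le_trans (ler_wpM2l (nc_ge0 c) k1) _.
  have c1 : 0 < nc c + 1 by have := nc_ge0 c; lra.
  rewrite mulrA ler_pdivrMr// mulrC ler_pM2l ?ln_gt0//; last by lra.
  by rewrite lerDl.
have B : nc (expc S * E m - 1) <= eps / 2.
  (* As S - S_m tends to 0, continuity of the exponential at 0 suffices. *)
  have -> : expc S * E m = expc (S - Sm).
    apply: (mulfI (expc_neq0 Sm)); rewrite mulrCA SE mulr1 -expcD; congr expc; ring.
  apply/ltW/h3; rewrite -opprB ncN; apply: le_lt_trans k2 _; lra.
have -> : expc S - 1 = (expc S * E m - 1) - expc S * (E m - 1) by ring.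
apply: le_trans (ncB _ _) _; rewrite (ncM (expc S)).
have : nc (expc S) * nc (E m - 1) <= nc (expc S) * d by rewrite ler_wpM2l.
have : d * (2 * (nc (expc S) + 1)) = eps by rewrite divfK// gt_eqF//; lra.
lra.
Qed.

End Backward.

Theorem periodic_tree_identity :
  [/\ (forall O, D O -> hfrak_defined tau (T O)),
      abs_summable D (fun O => hfrak tau (T O)) &
      exists k : int, has_sum D (fun O => hfrak tau (T O)) (0 +i* (2 * pi * k%:~R))]
  <->
  (forall O, D O -> ~ in_open_m2_2 (T O)) /\ finite_set [set O | D O /\ nc (T O) <= 2].
Proof.
split=> [[def sf _]|[opn fin]].
  (* Needed for every B and not only for 2, as the bound on the traces around a region with trace in
     (-2, 2) is not explicit. *)
  have fin B : finite_set [set O | D O /\ nc (T O) <= B].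
    have [d d0 h] := hfrak_ge B tau2.
    apply: sub_finite_set (abs_summable_finite sf d0) => O [DO le]; split=> //.
    by apply: h => //; apply/hfrak_definedP; exact: def.
  by split=> // O DO /(open_infinite DO)[B]; apply.
have opn' k o : ~ in_open_m2_2 (T (phi k o)) by apply: opn; apply/DE; exists k, o.
have [M hM] := deep fin.
split.
- by move=> O /DE[k [ o' ->]]; apply/hfrak_definedP; exact: (regular_phi opn' hM).
- exact: (summable_hfrak opn' hM).
have [t2|/eqP t2] := eqVneq tau (-2); last exact: (has_sum_hfrak opn' hM).
exists 0; rewrite mulr0; exact: (has_sum_hfrak0 opn' hM).
Qed.

End PeriodicTree.

(** * From representations to trees of traces *)

Section OrbitTraces.
Variables (R : realType) (Gam : groupType) (a b : Gam) (rho : Gam -> 'M[R[i]]_2).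
Hypothesis hrho : SL2_rep rho.
Local Notation tr g := (\tr (rho g)).

Definition tr_edge (e : Gam * Gam) := (tr e.1, tr e.2, tr (e.1 * e.2^-1)%g).

Lemma tr_edge_new e : tr (e.1 * e.2)%g = tnew (tr_edge e).
Proof. exact: tr_rhoM. Qed.

Lemma tr_edge_step d e : tr_edge (farey_step d e) = tstep d (tr_edge e).
Proof.
case: d; rewrite /tr_edge /tstep /= -tr_edge_new; congr (_, _).
  by rewrite invgM mulgA tr_rhoJ// tr_rhoV.
by rewrite mulgK.
Qed.

Lemma tr_edge_node s e : tr_edge (farey_node e s) = tnode (tr_edge e) s.
Proof. by elim: s e => [//|d s IH] e; rewrite /= -tr_edge_step -IH. Qed.

Lemma tr_edge_fan k : tr_edge (fan a b (k + 1), fan a b k) =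
  (tr (fan a b (k + 1)), tr (fan a b k), tr a).
Proof. by rewrite /tr_edge /= fanS mulgK. Qed.

Lemma tr_region k o : tr (region a b k o) = if o is Some s
  then tnew (tnode (tr (fan a b (k + 1)), tr (fan a b k), tr a) s) else tr (fan a b k).
Proof. by case: o => [s|//]; rewrite -tr_edge_fan -tr_edge_node -tr_edge_new. Qed.

Lemma tr_fan k :
  tr (fan a b (k + 1 + 1)) = tr a * tr (fan a b (k + 1)) - tr (fan a b k).
Proof.
by rewrite [in LHS]fanS tr_rhoM// [in (a * _)%g]fanS invgM mulgA tr_rhoJ// tr_rhoV.
Qed.

Lemma free_basis_nielsen u v : free_basis a b -> free_basis u v -> nielsen a b u v.
Proof.
move=> hab huv; apply: nielsen_theorem => // g.
by apply/asboolP; exact: free_basis_span.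
Qed.

Lemma kappa_fan tau k : free_basis a b -> tau_rep rho tau ->
  tkappa (tr (fan a b (k + 1)), tr (fan a b k), tr a) = tau + 2.
Proof.
move=> hab [u [v [uv <-]]]; rewrite -tr_edge_fan tr_commutator//; congr (_ + _).
have hn w z : free_basis w z ->
    tr (w * z * w^-1 * z^-1)%g = tr (a * b * a^-1 * b^-1)%g.
  by move=> wz; apply: nielsen_commutator => //; exact: free_basis_nielsen.
by rewrite (hn u v)// hn//; exact: (free_basis_node k [::]).
Qed.

Variables (Hstar : {multiplicative Gam -> Gam}) (N : int).
Hypothesis hstab : conj_rep (fun g => rho (Hstar g)) rho.
Hypothesis Hreg : forall n o,
  cls (Hstar (region a b n o)) = cls (region a b (n + N) o).

Lemma tr_stabilized g : tr (Hstar g) = tr g.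
Proof.
have [P [dP ->]] := hstab; rewrite mxtrace_mulC mulmxA mulVmx ?mul1mx//.
by rewrite unitmxE dP unitr1.
Qed.

Lemma tr_region_shift k n o : tr (region a b (n + k * N) o) = tr (region a b n o).
Proof.
have step m : tr (region a b (m + N) o) = tr (region a b m o).
  by rewrite -[RHS]tr_stabilized (tr_cls hrho (Hreg m o)).
have pos (j : nat) m : tr (region a b (m + j%:Z * N) o) = tr (region a b m o).
  elim: j m => [|j IH] m; first by rewrite mul0r addr0.
  by rewrite -[RHS]IH -[RHS]step; congr (\tr (rho (region _ _ _ _))); lia.
case: k => k; first exact: pos.
by rewrite -[LHS](pos k.+1); congr (\tr (rho (region _ _ _ _))); rewrite NegzE; lia.
Qed.

Lemma tr_region_orbit n o : bijective Hstar ->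
  tr_orbit rho (region_orbit a b Hstar n o) = tr (region a b n o).
Proof.
move=> hbij; rewrite /tr_orbit; have orb := region_orbitP hbij Hreg n o.
have [|c /orb[k ->] [g /cls_eqP E ->]] := @xgetPex _ 0 [set t | exists2 c,
    region_orbit a b Hstar n o c & exists2 g, c g & t = tr g].
  exists (tr (region a b n o)), (cls (region a b n o)).
    by apply/orb; exists 0; rewrite mul0r addr0.
  by exists (region a b n o) => //; exact: cls_refl.
by rewrite (tr_cls hrho E) tr_region_shift.
Qed.

End OrbitTraces.

Lemma Omega_hat_basis (Gam : groupType) (g : Gam) : Omega_hat (cls g) ->
  exists a b, free_basis a b /\ cls a = cls g.
Proof.
move=> [_ [a [b [ab [->|->]]]] E]; first by exists a, b.
by exists b, a; split=> //; exact: free_basis_sym.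
Qed.

Theorem theorem1p9
  (R : realType)
  (Gam : groupType) (alpha beta : Gam) (hfree : free_basis alpha beta)
  (ab : Gam -> 'cV[int]_2) (hab : abelianization alpha beta ab)
  (tau : R[i]) (htau : tau <> 2)
  (rho : Gam -> 'M[R[i]]_2) (hrho : SL2_rep rho) (hrhotau : tau_rep rho tau)
  (H : 'M[int]_2) (hdet : \det H = 1) (hpar : parabolic H)
  (Hstar : {multiplicative Gam -> Gam}) (hbij : bijective Hstar)
  (hinduced : forall g, ab (Hstar g) = H *m ab g)
  (hstab : conj_rep (fun g => rho (Hstar g)) rho)
  (g0 : Gam) (hg0 : Omega_hat (cls g0)) (hfix : Hstar @` cls g0 = cls g0) :
  let idx := Omega_hat_mod Hstar `\ orbit Hstar (cls g0) in
  [/\ (forall O, idx O -> hfrak_defined tau (tr_orbit rho O)),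
      abs_summable idx (fun O => hfrak tau (tr_orbit rho O)) &
      exists k : int,
        has_sum idx (fun O => hfrak tau (tr_orbit rho O))
          (0 +i* (2 * pi * k%:~R))]
  <->
  (forall O, idx O -> ~ in_open_m2_2 (tr_orbit rho O)) /\
  finite_set [set O | Omega_hat_mod Hstar O /\ Normc.normc (tr_orbit rho O) <= 2].
Proof.
move=> idx; have [abM abA abB] := hab.
(* A basis adapted to H: its first element represents the fixed class, so the fan consists of the
   regions around it. *)
have [a [b [hb clsa]]] := Omega_hat_basis hg0.
have fixa : Hstar @` cls a = cls a by rewrite clsa.
have ind : `|det2 (ab a) (ab b)|%N = 1%N.
  rewrite (nielsen_det2 abM (free_basis_nielsen hfree hb)) abA abB.
  by rewrite /det2 !mxE.
have ind0 : det2 (ab a) (ab b) != 0 by rewrite -absz_eq0 ind.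
have [N N0 Hreg] := Hstar_region hb abM ind hdet hpar hbij hinduced fixa.
have idxE O : idx O <-> exists n o, O = region_orbit a b Hstar n o.
  by rewrite /idx -clsa; exact: (Omega_hat_mod_region hbij Hreg abM ind0 fixa hb).
(* The shift N may have either sign; the period is |N|, written as a successor since it is
   positive. *)
have N1 : exists N', `|N|%N = N'.+1 by exists `|N|.-1%N; rewrite prednK// absz_gt0.
have [N' NE] := N1.
have phiE k o k' o' : region_orbit a b Hstar k o = region_orbit a b Hstar k' o' <->
    o = o' /\ exists j : int, k = k' + j * N'.+1%:Z.
  have NE' : N'.+1%:Z = sgz N * N by rewrite -NE abszE; case: (sgzP N); lia.
  have NE2 : N = sgz N * N'.+1%:Z by rewrite NE'; case: (sgzP N); lia.
  split=> [/(region_orbit_eqP hbij Hreg abM ind0)[-> [j ->]]|[-> [j ->]]].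
    by split=> //; exists (j * sgz N); rewrite {1}NE2 mulrA.
  apply/(region_orbit_eqP hbij Hreg abM ind0); split=> //.
  by exists (j * sgz N); rewrite NE' mulrA.
have trE k o := tr_region_orbit hrho hstab Hreg k o hbij.
have main := @periodic_tree_identity R tau _ idx (region_orbit a b Hstar)
  (tr_orbit rho) (\tr (rho a)) (fun k => \tr (rho (fan a b k))) N' htau
  (fun k => kappa_fan hrho k hb hrhotau) (tr_fan a b hrho)
  (fun k o => etrans (trE k o) (tr_region a b hrho k o)) idxE phiE.
apply: (iff_trans main).
(* Condition (ii) also counts the orbit of g0, which is one further element. *)
have fin_iff : finite_set [set O | idx O /\ Normc.normc (tr_orbit rho O) <= 2] <->
    finite_set [set O | Omega_hat_mod Hstar O /\ Normc.normc (tr_orbit rho O) <= 2].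
  split=> fin; last by apply: sub_finite_set fin => O [[]].
  have fin1 := finite_set1 (orbit Hstar (cls g0)).
  apply: (@sub_finite_set _ _ ([set O | idx O /\ Normc.normc (tr_orbit rho O) <= 2] `|`
    [set orbit Hstar (cls g0)])); last by rewrite finite_setU.
  by move=> O [HO le]; have [->|nO] := pselect (O = orbit Hstar (cls g0)); [right|left].
by split=> -[opn /fin_iff fin].
Qed.
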